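(* Let $\Omega$ be a non-empty open subset of a locally convex Hausdorff space $X$ over $\mathbb{C}$, $v\colon\Omega\to(0,\infty)$ continuous, $(E,\|\cdot\|_E)$ a normed space over $\mathbb{C}$, and \[ \mathcal{H}v(\Omega,E):=\Bigl\{f\in\mathcal{H}(\Omega,E):\|f\|^E:=\sup_{z\in\Omega}\|f(z)\|_Ev(z)<\infty\Bigr\}, \] with $\mathcal{H}v(\Omega):=\mathcal{H}v(\Omega,\mathbb{C})$ and $\|\cdot\|:=\|\cdot\|^{\mathbb{C}}$. Then the following assertions hold. (a) $(\mathcal{H}v(\Omega,E),\|\cdot\|^E,\tau_{\mathrm{co}}^E)$ is a Saks space. (b) If $X$ is a $k_{\mathbb{R}}$-space and $E$ a Banach space, then $(\mathcal{H}v(\Omega,E),\|\cdot\|^E,\tau_{\mathrm{co}}^E)$ is complete. (c) If $\Omega$ is hemicompact, then $(\mathcal{H}v(\Omega,E),\|\cdot\|^E,\tau_{\mathrm{co}}^E)$ is C-sequential. (d) If $X$ is a $k$-space and $E=\mathbb{C}$, then $(\mathcal{H}v(\Omega),\|\cdot\|,\tau_{\mathrm{co}})$ is semi-Montel and $\gamma(\|\cdot\|,\tau_{\mathrm{co}})=\gamma_{\mathrm{s}}(\|\cdot\|,\tau_{\mathcal{S}})$ for $\mathcal{S}\in\{\mathcal{N}_\Omega,\mathcal{K}_\Omega\}$. (e) If $X$ is metrisable or a DFM-space, and $E$ a Banach space, then $\mathcal{H}v(\Omega,E)=\mathcal{H}v(\Omega,E)_\sigma$.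
   Context: $\mathcal{H}(\Omega,E)$ is the space of holomorphic functions $f\colon\Omega\to E$, i.e. functions that are continuous and G\^ateaux-holomorphic (for all $\xi\in\Omega$, $\eta\in X$ and $e^*\in E^*$ the function $\lambda\mapsto e^*(f(\xi+\lambda\eta))$ is holomorphic in a neighbourhood of $0\in\mathbb{C}$). Saks spaces. Let $(Y,\|\cdot\|)$ be a normed space and $\tau$ a locally convex Hausdorff topology on $Y$ coarser than the norm topology $\tau_{\|\cdot\|}$. The mixed topology $\gamma=\gamma(\|\cdot\|,\tau)$ is the finest linear topology on $Y$ that coincides with $\tau$ on $\|\cdot\|$-bounded sets and lies between $\tau$ and $\tau_{\|\cdot\|}$; it is locally convex Hausdorff. $(Y,\|\cdot\|,\tau)$ is a Saks space if there is a directed system $\Gamma_\tau$ of continuous seminorms generating $\tau$ with $\|y\|=\sup_{q\in\Gamma_\tau}q(y)$ for all $y$. The submixed topology $\gamma_{\mathrm{s}}(\|\cdot\|,\tau)$ is generated by the seminorms $y\mapsto\sup_{n\in\mathbb{N}}q_n(y)a_n$ with $(q_n)_{n\in\mathbb{N}}\subset\Gamma_\tau$ and $(a_n)_{n\in\mathbb{N}}$ a real non-negative null-sequence (independent of the choice of such $\Gamma_\tau$). A Saks space is complete if $(Y,\gamma)$ is complete; semi-Montel if $(Y,\gamma)$ is a semi-Montel space (bounded sets are relatively compact); C-sequential if every convex sequentially open subset of $(Y,\gamma)$ is open. Topologies. $\tau_{\mathrm{co}}^E$ is the (relative) topology of uniform convergence on compact subsets of $\Omega$; $\tau_{\mathrm{co}}:=\tau_{\mathrm{co}}^{\mathbb{C}}$.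 $\mathcal{N}_\Omega$ and $\mathcal{K}_\Omega$ are the families of finite resp. compact subsets of $\Omega$, and $\tau_{\mathcal{S}}$ on $\mathcal{H}v(\Omega)$ is generated by the seminorms $f\mapsto\sup_{z\in S}|f(z)|v(z)$, $S\in\mathcal{S}$. Weak version. $\mathcal{H}v(\Omega,E)_\sigma:=\{f\colon\Omega\to E:e^*\circ f\in\mathcal{H}v(\Omega)\text{ for all }e^*\in E^*\}$. Topological notions. A completely regular space $Z$ is a $k_{\mathbb{R}}$-space if for every completely regular space $W$, any map $f\colon Z\to W$ whose restriction to each compact $K\subset Z$ is continuous is continuous. A topological space $Z$ is a $k$-space if $A\subset Z$ is closed if and only if $A\cap K$ is closed in $K$ for every compact $K\subset Z$. $\Omega$ is hemicompact if there is a sequence $(K_n)_{n\in\mathbb{N}}$ of compact subsets such that every compact subset of $\Omega$ is contained in some $K_N$. A DFM-space is the strong dual of a Fr\'echet--Montel space. *)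

(* Defs.v *)
From HB Require Import structures.
From mathcomp Require Import all_boot all_order all_algebra finmap complex.
From mathcomp Require Import all_classical all_reals all_analysis.

Set Implicit Arguments.
Unset Strict Implicit.
Unset Printing Implicit Defensive.

Import Order.TTheory GRing.Theory Num.Theory.
Import numFieldNormedType.Exports.

Local Open Scope classical_set_scope.
Local Open Scope ring_scope.

(* Norms of complex normed spaces take values in R[i]; this is the real one. *)
Definition rnorm (R : realType) (V : normedZmodType R[i]) (x : V) : R :=
  complex.Re `|x|.

Section NormedAux.
Context {R : realType}.

Lemma derivable_comb (V W : normedModType R[i]) (f g : V -> W) (a : R[i]) x h :
  derivable f x h -> derivable g x h -> derivable (fun y => a *: f y + g y) x h.
Proof. by move=> df dg; apply: derivableD => //; apply: derivableZ. Qed.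

Lemma rnorm_comb (V : normedModType R[i]) (a : R[i]) (x y : V) :
  rnorm (a *: x + y) <= rnorm (a : R[i]^o) * rnorm x + rnorm y.
Proof.
have E (W : normedModType R[i]) (z : W) : `|z| = (rnorm z)%:C%C.
  by rewrite /rnorm; have /ger0_Im := normr_ge0 z; case: `|z| => u w /= ->.
rewrite -lecR rmorphD rmorphM /= -!E -normrZ.
exact: ler_normD.
Qed.

Lemma rnorm_ge0 (V : normedModType R[i]) (x : V) : 0 <= rnorm x.
Proof. by rewrite /rnorm; have := normr_ge0 x; case: `|x| => u w; rewrite lecE => /andP[]. Qed.

End NormedAux.

Section Tvs.
Context {R : realType}.
Variable V : preTopologicalLmodType R[i].

(* Stated with differences rather than with entourages: for V : tvsType the
   library does not tie the uniformity to the linear structure. *)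
Definition tvs_cauchy (F : set_system V) :=
  (fun xy : V * V => xy.1 - xy.2) @ (F, F) --> (0 : V).

Definition tvs_complete :=
  forall F : set_system V, ProperFilter F -> tvs_cauchy F -> exists l : V, F --> l.

Definition absorbed_by (B U : set V) :=
  exists2 r : R, 0 < r &
    forall a : R[i], r <= rnorm (a : R[i]^o) -> B `<=` [set a *: x | x in U].

Definition tvs_bounded (B : set V) := forall U : set V, nbhs 0 U -> absorbed_by B U.

Definition semi_montel := forall B : set V, tvs_bounded B -> precompact B.

Definition absolutely_convex (B : set V) :=
  forall (a b : R[i]) (x y : V), `|a| + `|b| <= 1 -> B x -> B y -> B (a *: x + b *: y).

Definition barrel (B : set V) :=
  [/\ closed B, absolutely_convex B & forall x : V, absorbed_by [set x] B].

Definition montel := (forall B : set V, barrel B -> nbhs 0 B) /\ semi_montel.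

Definition seq_open (A : set V) :=
  forall (u : nat -> V) (l : V), A l -> u @ \oo --> l -> \forall n \near \oo, A (u n).

Definition C_sequential :=
  forall A : set V, convex_set A -> seq_open A -> open A.

Definition cdual_pred : {pred V -> R[i]^o} :=
  mem [set f : V -> R[i]^o | linear f /\ continuous f].

Lemma cdual_submod_closed : submod_closed cdual_pred.
Proof.
split.
  apply/mem_set; split; first by move=> a x y; rewrite /= scaler0 addr0.
  exact: cst_continuous.
move=> a f g /set_mem[fl fc] /set_mem[gl gc]; apply/mem_set; split.
  move=> b x y; have E z : (a *: f + g) z = a *: f z + g z by [].
  by rewrite !E fl gl !scalerDr !scalerA (mulrC a b) addrACA.
by move=> x; apply: cvgD; [apply: cvgZr; exact: fc | exact: gc].
Qed.

HB.instance Definition _ :=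
  GRing.isSubmodClosed.Build _ _ cdual_pred cdual_submod_closed.

Definition cdual : Type := {f : V -> R[i]^o | f \in cdual_pred}.

HB.instance Definition _ := [isSub of cdual for @sval _ _].
HB.instance Definition _ := [Choice of cdual by <:].
HB.instance Definition _ := [SubChoice_isSubLmodule of cdual by <:].

Definition strong_dual : Type :=
  initial_topology (val : cdual -> {family tvs_bounded, V -> R[i]^o}).

HB.instance Definition _ := Topological.on strong_dual.
HB.instance Definition _ := GRing.Lmodule.copy strong_dual cdual.

End Tvs.

Definition metrisable (R : realType) (T : topologicalType) :=
  exists d : T -> T -> R,
    [/\ forall x y, d x y = 0 <-> x = y,
        forall x y, d x y = d y x,
        forall x y z, d x z <= d x y + d y z &
        forall x (A : set T),
          nbhs x A <-> exists2 e : R, 0 < e & [set y | d x y < e] `<=` A].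

Definition frechet_space (R : realType) (F : tvsType R[i]) :=
  [/\ hausdorff_space F, metrisable R F & tvs_complete F].

Definition DFM_space (R : realType) (X : tvsType R[i]) :=
  exists F : tvsType R[i], [/\ frechet_space F, montel F &
    exists (J : {linear X -> strong_dual F}) (K : strong_dual F -> X),
      [/\ cancel J K, cancel K J, continuous J & continuous K]].

Definition banach_space (R : realType) (E : normedModType R[i]) :=
  forall F : set_system E, ProperFilter F -> cauchy F -> cvg F.

Definition kR_space (Z : topologicalType) :=
  completely_regular_space Z /\
  forall (W : topologicalType) (f : Z -> W), completely_regular_space W ->
    (forall K : set Z, compact K -> {within K, continuous f}) -> continuous f.

(* subspace K restricts the topology to K (and isolates the points outside K). *)
Definition k_space (Z : topologicalType) :=
  forall A : set Z, closed A <->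
    forall K : set Z, compact K -> closed (A `&` K : set (subspace K)).

Definition hemicompact (Z : topologicalType) :=
  exists K : nat -> set Z, (forall n, compact (K n)) /\
    forall L : set Z, compact L -> exists n, L `<=` K n.

Section Mixed.
Context {R : realType} {Y : lmodType R[i]}.
Implicit Types (N : Y -> R) (Q Gamma : set (Y -> R)) (tau T : Topological Y).

Definition opens T : set (set Y) := @open (Topological.Pack T).

Definition is_seminorm (q : Y -> R) :=
  (forall x y, q (x + y) <= q x + q y) /\
  (forall (a : R[i]) x, q (a *: x) = rnorm (a : R[i]^o) * q x).

Definition is_norm N := is_seminorm N /\ forall x, N x = 0 -> x = 0.

Definition semiballs Q : set (set Y) :=
  [set B | exists q x (e : R), [/\ Q q, 0 < e & B = [set y | q (y - x) < e]]].

Definition seminorm_topology (Q : set (Y -> R)) : Type := Y.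

HB.instance Definition _ Q := GRing.Lmodule.on (seminorm_topology Q).
HB.instance Definition _ Q :=
  isSubBaseTopological.Build (seminorm_topology Q) (semiballs Q) id.

Definition gen_by Q : Topological Y := Topological.class (seminorm_topology Q).

Definition linear_topology T :=
  let YT := Topological.Pack T in
  continuous (fun xy : YT * YT => (xy.1 : Y) + xy.2 : YT) /\
  continuous (fun ax : R[i]^o * YT => ax.1 *: (ax.2 : Y) : YT).

Definition locally_convex_hausdorff T :=
  let YT := Topological.Pack T in
  [/\ linear_topology T,
      exists2 B : set_system YT, (forall b, b \in B -> convex_set (b : set Y)) & basis B &
      hausdorff_space YT].

Definition norm_bounded N (B : set Y) := exists M, forall y, B y -> N y <= M.

Definition between_and_agrees N tau T :=
  [/\ linear_topology T,
      opens tau `<=` opens T,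
      opens T `<=` opens (gen_by [set N]) &
      forall B, norm_bounded N B ->
        [set U `&` B | U in opens T] = [set U `&` B | U in opens tau]].

(* The finest member of the family between_and_agrees N tau, as the supremum of
   that family; see mixed_agrees and mixed_finest. *)
Definition mixed_topology (N : Y -> R) (tau : Topological Y) : Type := Y.

HB.instance Definition _ N tau := Choice.on (mixed_topology N tau).
HB.instance Definition _ N tau :=
  isSubBaseTopological.Build (mixed_topology N tau)
    [set U | exists2 T, between_and_agrees N tau T & opens T U] id.
HB.instance Definition _ N tau := GRing.Lmodule.copy (mixed_topology N tau) Y.

Definition mixed N tau : Topological Y := Topological.class (mixed_topology N tau).

Lemma opensP T (U : set Y) :
  opens T U <-> forall x, U x -> nbhs (x : Topological.Pack T) U.
Proof. by rewrite /opens openE. Qed.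

Lemma mixed_finest N tau T :
  between_and_agrees N tau T -> opens T `<=` opens (mixed N tau).
Proof.
move=> bT U oU; exists [set U]; last by rewrite bigcup_set1.
move=> _ ->; exists [fset U]%fset.
  by move=> W; rewrite in_fset1 => /eqP ->; rewrite inE; exists T.
by rewrite set_fset1 bigcap_set1.
Qed.

Lemma cvg_mixed N tau (F : set_system Y) (t : Y) : Filter F ->
  (forall T, between_and_agrees N tau T -> F --> (t : Topological.Pack T)) ->
  F --> (t : mixed_topology N tau).
Proof.
move=> FF cvFt A /=; rewrite (@nbhsE (mixed_topology N tau)).
move=> [_ [[B sB <-] [C BC Ct] sUBA]].
rewrite nbhs_filterE; apply: filterS sUBA _; apply: (@filterS _ _ _ C).
  by move=> ? ?; exists C.
have /sB [D sD IDeC] := BC; rewrite -IDeC; apply: filter_bigI => E DE.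
have /sD := DE; rewrite inE => - [T bT oE]; apply: (cvFt T bT).
by move/opensP : oE; apply; move: Ct; rewrite -IDeC => /(_ _ DE).
Qed.

Lemma nbhs_mixed N tau T (t : Y) : between_and_agrees N tau T ->
  nbhs (t : Topological.Pack T) `<=` nbhs (t : mixed_topology N tau).
Proof.
move=> bT A; rewrite (@nbhsE (Topological.Pack T)) => -[B [Bop Bt] BA].
rewrite (@nbhsE (mixed_topology N tau)); exists B => //; split => //.
exact: (mixed_finest bT Bop).
Qed.

Lemma mixed_agrees N tau :
  linear_topology tau -> opens tau `<=` opens (gen_by [set N]) ->
  between_and_agrees N tau (mixed N tau).
Proof.
move=> lt ltN.
have btau : between_and_agrees N tau tau by split.
split.
- split=> -[a b]; apply: cvg_mixed => T bT; have [[Tadd Tscl] _ _ _] := bT.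
    apply: cvg_trans (Tadd (a, b)).
    apply: cvg_app => P [[P1 P2] [/= aP1 bP2] sP]; exists (P1, P2) => //=.
    by split; apply: (nbhs_mixed bT).
  apply: cvg_trans (Tscl (a, b)).
  apply: cvg_app => P [[P1 P2] [/= aP1 bP2] sP]; exists (P1, P2) => //=.
  by split => //; apply: (nbhs_mixed bT).
- exact: mixed_finest.
- move=> U oU; apply/opensP => x Ux.
  suff : nbhs (x : seminorm_topology [set N]) --> (x : mixed_topology N tau).
    by apply; apply: open_nbhs_nbhs.
  apply: cvg_mixed => T [_ _ TN _] A.
  rewrite (@nbhsE (Topological.Pack T)) => -[B [Bop Bt] BA].
  rewrite nbhs_filterE (@nbhsE (seminorm_topology [set N])); exists B => //; split => //.
  exact: TN.
- move=> B bB; rewrite eqEsubset; split; last first.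
    by move=> _ [U oU <-]; exists U => //; apply: (mixed_finest btau).
  move=> _ [U oU <-].
  pose V := \bigcup_(W in [set W | opens tau W /\ W `&` B `<=` U]) W.
  exists V.
    by apply: (@bigcup_open (Topological.Pack tau)) => W [].
  rewrite eqEsubset; split => x [Vx Bx]; split => //.
    by case: Vx => W [_ WU] Wx; apply: WU.
  suff H : within B (nbhs (x : Topological.Pack tau)) --> (x : mixed_topology N tau).
    have /H : nbhs (x : mixed_topology N tau) U by exact: open_nbhs_nbhs.
    rewrite nbhs_filterE /within /= (@nbhsE (Topological.Pack tau)) => -[W [oW Wx] WU].
    by exists W => //; split => // y [/WU].
  apply: cvg_mixed => T [_ _ _ /(_ B bB) E] A.
  rewrite (@nbhsE (Topological.Pack T)) => -[C [oC Cx] CA].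
  have : [set U `&` B | U in opens T] (C `&` B) by exists C.
  rewrite E => -[W oW WC]; rewrite nbhs_filterE /within /=.
  rewrite (@nbhsE (Topological.Pack tau)); exists W.
    by split => //; have [] : (W `&` B) x by rewrite WC.
  by move=> y Wy By; apply: CA; have [] : (C `&` B) y by rewrite -WC.
Qed.

Definition directed_system Gamma :=
  Gamma !=set0 /\
  forall p q, Gamma p -> Gamma q ->
    exists2 r, Gamma r & forall y, p y <= r y /\ q y <= r y.

Definition saks_system N tau Gamma :=
  [/\ directed_system Gamma,
      forall q, Gamma q ->
        is_seminorm q /\ continuous (q : Topological.Pack tau -> R),
      opens tau = opens (gen_by Gamma) &
      forall y, (N y)%:E = ereal_sup [set (q y)%:E | q in Gamma]].

Definition saks_space N tau :=
  [/\ is_norm N, locally_convex_hausdorff tau,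
      opens tau `<=` opens (gen_by [set N]) &
      exists Gamma, saks_system N tau Gamma].

Definition submixed_seminorms Gamma : set (Y -> R) :=
  [set p | exists (q : nat -> Y -> R) (a : nat -> R),
    [/\ forall n, Gamma (q n), forall n, 0 <= a n, a @ \oo --> 0 &
        p = fun y => sup [set q n y * a n | n in [set: nat]]]].

(* T is the submixed topology of (N, tau), which must not depend on the
   system Gamma used to compute it. *)
Definition is_submixed N tau T :=
  (exists Gamma, saks_system N tau Gamma) /\
  forall Gamma, saks_system N tau Gamma ->
    opens T = opens (gen_by (submixed_seminorms Gamma)).

Definition saks_complete N tau :=
  saks_space N tau /\ tvs_complete (mixed_topology N tau).

Definition saks_semi_montel N tau :=
  saks_space N tau /\ semi_montel (mixed_topology N tau).

Definition saks_C_sequential N tau :=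
  saks_space N tau /\ C_sequential (mixed_topology N tau).

End Mixed.

Section WeightedHolomorphic.
Context {R : realType} {X : tvsType R[i]} {Omega : set X}.

Definition extend0 (V : zmodType) (f : Omega -> V) (x : X) : V :=
  oapp f 0 (insub x).

Definition holomorphic (E : normedModType R[i]) (f : Omega -> E) :=
  continuous f /\
  forall (xi : Omega) (eta : X) (e : cdual E),
    \forall l \near (0 : R[i]^o),
      derivable (fun m : R[i]^o => val e (extend0 f (val xi + (m : R[i]) *: eta))) l 1.

Variable v : Omega -> {posnum R}.

Definition Hv_set (E : normedModType R[i]) : set (Omega -> E) :=
  [set f : Omega -> E | holomorphic f /\
           has_ubound [set rnorm (f z) * (v z)%:num | z in [set: Omega]]].

Arguments Hv_set : clear implicits.

Definition Hv_sigma (E : normedModType R[i]) : set (Omega -> E) :=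
  [set f : Omega -> E | forall e : cdual E, Hv_set (R[i]^o) (val e \o f)].

Variable E : normedModType R[i].

Definition Hv_pred : {pred Omega -> E} := mem (Hv_set E).

Lemma Hv_submod_closed : submod_closed Hv_pred.
Proof.
have e0 (e : cdual E) : val e 0 = 0.
  have [el _] := set_mem (valP e).
  by rewrite -(subrr 0) -scaleN1r addrC el scaleN1r addNr.
split.
  apply/mem_set; split; last by exists 0 => _ [z _ <-]; rewrite /rnorm normr0 mul0r.
  split; first exact: cst_continuous.
  move=> xi eta e; apply: filterE => l; rewrite [X in derivable X](_ : _ = cst 0).
    exact: derivable_cst.
  apply/funext => m; rewrite /extend0.
  by case: insubP => [u _ _|_] /=; rewrite e0.
move=> a f g /set_mem[[fc fh] [Mf fM]] /set_mem[[gc gh] [Mg gM]]; apply/mem_set; split; last first.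
  exists (rnorm (a : R[i]^o) * Mf + Mg) => _ [z _ <-].
  rewrite (le_trans (ler_wpM2r _ (rnorm_comb _ _ _)))// mulrDl -mulrA lerD//.
    rewrite ler_wpM2l //; last by apply: fM; exists z.
    exact: (@rnorm_ge0 R R[i]^o).
  by apply: gM; exists z.
split.
  move=> z.
  have fz : (fun z => a *: f z) @ z --> a *: f z.
    exact: (@cvgZl_tmp _ E _ (nbhs z) _ a f _ (fc z)).
  have gz := gc z.
  exact: (@cvgD _ E _ (nbhs z) _ _ g _ _ fz gz).
move=> xi eta e; apply: filterS2 (fh xi eta e) (gh xi eta e) => l df dg.
pose F (h : Omega -> E) (m : R[i]^o) := val e (extend0 h (val xi + (m : R[i]) *: eta)).
rewrite [X in derivable X](_ : _ = (fun m => a *: F f m + F g m)); last first.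
  apply/funext => m; rewrite /F /extend0.
  case: insubP => [u _ _|_] /=; last by rewrite e0 scaler0 addr0.
  by have [el _] := set_mem (valP e); rewrite el.
exact: (@derivable_comb R R[i]^o R[i]^o (F f) (F g) a l 1 df dg).
Qed.

HB.instance Definition _ := GRing.isSubmodClosed.Build _ _ Hv_pred Hv_submod_closed.

Definition Hv : Type := {f : Omega -> E | f \in Hv_pred}.

HB.instance Definition _ := [isSub of Hv for @sval _ _].
HB.instance Definition _ := [Choice of Hv by <:].
HB.instance Definition _ := [SubChoice_isSubLmodule of Hv by <:].

Definition weighted_sup (S : set Omega) (f : Hv) : R :=
  sup [set rnorm (val f z) * (v z)%:num | z in S].

Definition Hv_norm : Hv -> R := weighted_sup setT.

Definition tau_co : Topological Hv :=
  Topological.class (initial_topology (val : Hv -> {family compact, Omega -> E})).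

Definition tau_S (S : set (set Omega)) : Topological Hv :=
  gen_by [set weighted_sup K | K in S].

End WeightedHolomorphic.

(* Main.v *)
(* The functions in a ball N <= k are locally bounded, hence equicontinuous by the
   Schwarz lemma on complex lines together with Hahn-Banach, so on such a ball
   pointwise convergence implies compact convergence, with limit again
   holomorphic.  This gives the completeness of the balls when E is Banach and
   their compactness when E = C.  The passage from the balls to the whole space is
   a property of mixed topologies: the mixed topology is generated by the
   seminorms p such that, on each ball, p is small wherever some seminorm of tau is
   small.  Weak holomorphy gives continuity in the same way, once the uniform
   boundedness principle has turned weak boundedness into boundedness.

   Cauchy's theorem enters only through trapezoid sums: Goursat's bisection shows
   that on log-polar grids these sums over the boundary of a rectangle tend to 0,
   so the averages of h over 2^n-th roots of unity on two circles around z0 agree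
   in the limit.  This gives the maximum principle, even for functions that are
   only continuous at z0, and the latter gives the Schwarz lemma and the
   holomorphy of uniform limits. *)
Require Import Defs.
From mathcomp Require Import all_boot all_order all_algebra finmap complex.
From mathcomp Require Import all_classical all_reals all_analysis.
From mathcomp Require Import zify ring lra.

Set Implicit Arguments.
Unset Strict Implicit.
Unset Printing Implicit Defensive.

Import Order.TTheory GRing.Theory Num.Theory.
Import numFieldNormedType.Exports.

Local Open Scope classical_set_scope.
Local Open Scope ring_scope.

(** * Norms with real values *)

(** Sums replace contour integrals because the trapezoid sum round a cell vanishes exactly for
    affine functions; this takes the place of the primitive in Goursat's proof and keeps the whole
    argument finite. The obstacle on the complex side is that the Schwarz lemma applies the maximum
    principle to a difference quotient, about which only continuity is known at the centre. Circles
    are therefore compared across an annulus that leaves the centre out. On the side of functional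
    analysis, the mixed topology is given only as a supremum of topologies, so its neighbourhoods
    are not explicit. One device makes them accessible: if an absolutely convex set contains, in
    every ball, a [tau]-neighbourhood of 0 relative to that ball, then its gauge is a mixed
    seminorm. It serves three times, to describe the mixed topology, to bring Cauchy filters near a
    ball, and to show that convex sequentially open sets are open. *)

Section RealNorm.
Context {R : realType}.
Implicit Types (V W : normedModType R[i]).

Lemma normE V (x : V) : `|x| = (rnorm x)%:C%C.
Proof. by rewrite /rnorm; have /ger0_Im := normr_ge0 x; case: `|x| => u w /= ->. Qed.

Lemma rnorm0 V : rnorm (0 : V) = 0.
Proof. by rewrite /rnorm normr0. Qed.

Lemma rnormN V (x : V) : rnorm (- x) = rnorm x.
Proof. by rewrite /rnorm normrN. Qed.

Lemma rdistC V (x y : V) : rnorm (x - y) = rnorm (y - x).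
Proof. by rewrite /rnorm distrC. Qed.

Lemma rnorm_eq0 V (x : V) : rnorm x = 0 -> x = 0.
Proof. by move=> x0; apply/normr0_eq0; rewrite normE x0. Qed.

Lemma rnormD V (x y : V) : rnorm (x + y) <= rnorm x + rnorm y.
Proof. by rewrite -lecR rmorphD /= -!normE ler_normD. Qed.

Lemma rnormB V (x y : V) : rnorm (x - y) <= rnorm x + rnorm y.
Proof. by rewrite -[rnorm y]rnormN rnormD. Qed.

Lemma rdistD V (z x y : V) : rnorm (x - y) <= rnorm (x - z) + rnorm (z - y).
Proof. by have := rnormD (x - z) (z - y); rewrite addrA subrK. Qed.

Lemma rnorm_subD V (x y : V) : rnorm x <= rnorm (x - y) + rnorm y.
Proof. by have := rnormD (x - y) y; rewrite subrK. Qed.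

Lemma rnorm_sum V (I : Type) (s : seq I) (P : pred I) (F : I -> V) :
  rnorm (\sum_(i <- s | P i) F i) <= \sum_(i <- s | P i) rnorm (F i).
Proof.
elim/big_ind2: _ => [|x a y b xa yb|//]; first by rewrite rnorm0.
by rewrite (le_trans (rnormD _ _))// lerD.
Qed.

Definition cabs (z : R[i]) : R := rnorm (z : R[i]^o).

Lemma cabsE (z : R[i]) : cabs z = Num.sqrt (complex.Re z ^+ 2 + complex.Im z ^+ 2).
Proof. by case: z. Qed.

Lemma rnormZ V (a : R[i]) (x : V) : rnorm (a *: x) = cabs a * rnorm x.
Proof. by apply: complexI; rewrite rmorphM /= -!normE normrZ. Qed.

Lemma cabs_ge0 z : 0 <= cabs z. Proof. exact: rnorm_ge0. Qed.

Lemma cabs0 : cabs 0 = 0. Proof. exact: (@rnorm0 R[i]^o). Qed.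

Lemma cabsM z w : cabs (z * w) = cabs z * cabs w.
Proof. exact: (@rnormZ R[i]^o z w). Qed.

Lemma cabs_eq0 z : (cabs z == 0) = (z == 0).
Proof.
apply/eqP/eqP => [|->]; last exact: cabs0.
exact: (@rnorm_eq0 R[i]^o).
Qed.

Lemma cabs_gt0 z : (0 < cabs z) = (z != 0).
Proof. by rewrite lt_def cabs_ge0 andbT cabs_eq0. Qed.

Lemma cabsR (r : R) : cabs r%:C%C = `|r|.
Proof. by rewrite cabsE /= expr0n addr0 sqrtr_sqr. Qed.

Lemma cabs1 : cabs 1 = 1.
Proof. by rewrite (_ : 1 = 1%:C%C)// cabsR normr1. Qed.

Lemma cabsV z : cabs z^-1 = (cabs z)^-1.
Proof.
have [->|z0] := eqVneq z 0; first by rewrite invr0 cabs0 invr0.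
apply: (@mulfI _ (cabs z)); first by rewrite cabs_eq0.
by rewrite -cabsM !divff ?cabs1// cabs_eq0.
Qed.

Lemma cabsN z : cabs (- z) = cabs z. Proof. exact: (@rnormN R[i]^o). Qed.

Lemma cdistC z w : cabs (z - w) = cabs (w - z). Proof. exact: (@rdistC R[i]^o). Qed.

Lemma cabsD z w : cabs (z + w) <= cabs z + cabs w. Proof. exact: (@rnormD R[i]^o). Qed.

Lemma cabsB z w : cabs (z - w) <= cabs z + cabs w. Proof. exact: (@rnormB R[i]^o). Qed.

Lemma cdistD y x z : cabs (x - z) <= cabs (x - y) + cabs (y - z).
Proof. exact: (@rdistD R[i]^o). Qed.

Lemma cabs_sum (I : Type) (s : seq I) (P : pred I) (F : I -> R[i]) :
  cabs (\sum_(i <- s | P i) F i) <= \sum_(i <- s | P i) cabs (F i).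
Proof. exact: (@rnorm_sum R[i]^o). Qed.

Lemma sqr_cabs z : cabs z ^+ 2 = complex.Re z ^+ 2 + complex.Im z ^+ 2.
Proof. by rewrite cabsE sqr_sqrtr// addr_ge0// sqr_ge0. Qed.

Lemma Re_le_cabs z : `|complex.Re z| <= cabs z.
Proof. by rewrite -sqrtr_sqr cabsE ler_wsqrtr// lerDl sqr_ge0. Qed.

Lemma Im_le_cabs z : `|complex.Im z| <= cabs z.
Proof. by rewrite -sqrtr_sqr cabsE ler_wsqrtr// lerDr sqr_ge0. Qed.

Lemma cabs_le_ReIm z : cabs z <= `|complex.Re z| + `|complex.Im z|.
Proof.
rewrite {1}[z]complexE (le_trans (cabsD _ _))// cabsM !cabsR lerD2l.
suff -> : cabs 'i%C = 1 by rewrite mul1r.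
by rewrite cabsE /= expr0n expr1n add0r sqrtr1.
Qed.

Lemma conj_mul_cabs z : z^*%C * z = (cabs z ^+ 2)%:C%C.
Proof. by rewrite sqr_cabs add_Re2_Im2 sqr_normc mulrC. Qed.

Lemma cabs_conj z : cabs z^*%C = cabs z.
Proof. by case: z => a b; rewrite !cabsE /= sqrrN. Qed.

Lemma nbhs_rnormP V (x : V) (A : set V) :
  nbhs x A <-> exists2 e : R, 0 < e & forall y, rnorm (y - x) < e -> A y.
Proof.
split=> [/nbhs_normP[e /= e0 eA]|[e e0 eA]].
  have eE : e = (complex.Re e)%:C%C by rewrite RRe_real// gtr0_real.
  exists (complex.Re e) => [|y xy]; first by rewrite -ltcR -eE.
  by apply: eA; rewrite /ball_ /= normE rdistC eE ltcR.
apply/nbhs_normP; exists e%:C%C => /=; first by rewrite ltcR.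
by move=> y; rewrite /ball_ /= normE rdistC ltcR => /eA.
Qed.

Lemma cvg_rnormP V (T : Type) (F : set_system T) (f : T -> V) (l : V) : Filter F ->
  f @ F --> l <-> forall e : R, 0 < e -> \forall t \near F, rnorm (f t - l) < e.
Proof.
move=> FF; split=> [fl e e0|fl A /nbhs_rnormP[e e0 eA]].
  by have /fl : nbhs l [set y | rnorm (y - l) < e] by apply/nbhs_rnormP; exists e.
by apply: (filterS (fun t => eA (f t))); exact: fl.
Qed.

End RealNorm.

(** * A discrete form of Goursat's theorem *)

Section Goursat.
Context {R : realType}.
Variables alpha beta : R[i].
Implicit Types G : nat -> nat -> R[i].

(** Twice the trapezoid sum of [G] round the boundary of a parallelogram with edge vectors [alpha]
    and [beta]. The mesh is left out, so that grids of every fineness share one formula. *)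
Definition cell G j k : R[i] :=
  alpha * (G j k + G j.+1 k - G j k.+1 - G j.+1 k.+1) +
  beta * (G j.+1 k + G j.+1 k.+1 - G j k - G j k.+1).

Definition block G m : R[i] := \sum_(j < m) \sum_(k < m) cell G j k.

(** Each interior edge belongs to two cells that traverse it in opposite directions, so only the
    four sides of the block survive. *)
Lemma block_boundary G m : block G m =
  alpha * \sum_(j < m) (G j 0 + G j.+1 0 - G j m - G j.+1 m) +
  beta * \sum_(k < m) (G m k + G m k.+1 - G 0 k - G 0 k.+1).
Proof.
have tele (F : nat -> R[i]) n : \sum_(k < n) (F k.+1 - F k) = F n - F 0.
  by rewrite -(big_mkord xpredT (fun k => F k.+1 - F k)) telescope_sumr.
rewrite /block; under eq_bigr do rewrite big_split -!mulr_sumr /=.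
rewrite big_split -!mulr_sumr /=; congr (_ * _ + _ * _).
  apply: eq_bigr => j _.
  rewrite (eq_bigr (fun k : 'I_m => - (G j k.+1 + G j.+1 k.+1) - - (G j k + G j.+1 k))).
    by rewrite (tele (fun k => - (G j k + G j.+1 k))); ring.
  by move=> k _; ring.
rewrite exchange_big; apply: eq_bigr => k _.
rewrite (eq_bigr (fun j : 'I_m => G j.+1 k + G j.+1 k.+1 - (G j k + G j k.+1))).
  by rewrite (tele (fun j => G j k + G j k.+1)); ring.
by move=> j _; ring.
Qed.

(** The trapezoid rule is exact for affine functions, and these have a primitive, so their sum round
    every cell is 0. *)
Lemma block_affine G m c d :
  block (fun j k => G j k - (c + d * (alpha * j%:R + beta * k%:R))) m = block G m.
Proof.
apply: eq_bigr => j _; apply: eq_bigr => k _; rewrite /cell -!natr1.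
by ring.
Qed.

Lemma block_bound G m (eta : R) :
  (forall j k, (j <= m)%N -> (k <= m)%N -> cabs (G j k) <= eta) ->
  cabs (block G m) <= 4 * m%:R * (cabs alpha + cabs beta) * eta.
Proof.
move=> Geta; rewrite block_boundary (le_trans (cabsD _ _))// !cabsM.
have quad (x y z t : R[i]) : cabs x <= eta -> cabs y <= eta -> cabs z <= eta ->
    cabs t <= eta -> cabs (x + y - z - t) <= eta *+ 4.
  move=> xe ye ze te; rewrite !mulrS mulr0n addr0.
  rewrite (le_trans (cabsB _ _))// (le_trans (lerD (cabsB _ _) (lexx _)))//.
  by have := cabsD x y; lra.
have sum_le (F : nat -> R[i]) : (forall j, (j < m)%N -> cabs (F j) <= eta *+ 4) ->
    cabs (\sum_(j < m) F j) <= eta *+ 4 *+ m.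
  move=> Fe; rewrite (le_trans (cabs_sum _ _ _))//.
  rewrite -[X in _ *+ X](card_ord m) -sumr_const ler_sum// => j _.
  exact: Fe.
have -> : 4 * m%:R * (cabs alpha + cabs beta) * eta =
    cabs alpha * (eta *+ 4 *+ m) + cabs beta * (eta *+ 4 *+ m).
  by rewrite -!(mulr_natr eta) -!(mulr_natr (_ * _)); ring.
rewrite lerD// ler_wpM2l ?cabs_ge0//.
  apply: (sum_le (fun j => G j 0 + G j.+1 0 - G j m - G j.+1 m)) => j jm.
  by apply: quad; apply: Geta => //; exact: ltnW.
apply: (sum_le (fun k => G m k + G m k.+1 - G 0 k - G 0 k.+1)) => k km.
by apply: quad; apply: Geta => //; exact: ltnW.
Qed.

Definition shift_grid G p q := fun j k => G (p + j)%N (q + k)%N.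

Lemma block_split G m : block G (m + m) =
  block (shift_grid G 0 0) m + block (shift_grid G 0 m) m +
  (block (shift_grid G m 0) m + block (shift_grid G m m) m).
Proof.
rewrite /block big_split_ord /=; congr (_ + _); rewrite -big_split.
  apply: eq_bigr => j _; rewrite big_split_ord /=.
  by congr (_ + _); apply: eq_bigr => k _; rewrite /cell /shift_grid ?addnS ?add0n.
apply: eq_bigr => j _; rewrite big_split_ord /=.
by congr (_ + _); apply: eq_bigr => k _; rewrite /cell /shift_grid ?addnS ?add0n ?addSn.
Qed.

End Goursat.

(** * Nested dyadic intervals *)

Section Dyadic.
Context {R : realType}.

Lemma dyadic_lt (a : nat -> nat) : a 0%N = 0%N ->
  (forall n, a n.+1 = (2 * a n)%N \/ a n.+1 = (2 * a n).+1) ->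
  forall n, (a n < 2 ^ n)%N.
Proof.
move=> a0 aS; elim=> [|n IH]; first by rewrite a0.
by rewrite expnS; case: (aS n) => ->; lia.
Qed.

(** The left ends increase and the right ends decrease, so the supremum of the left ends lies in
    every interval. *)
Lemma dyadic_limit (a : nat -> nat) : a 0%N = 0%N ->
  (forall n, a n.+1 = (2 * a n)%N \/ a n.+1 = (2 * a n).+1) ->
  exists x : R, forall n, (a n)%:R / 2 ^+ n <= x <= (a n).+1%:R / 2 ^+ n.
Proof.
move=> a0 aS.
pose u n : R := (a n)%:R / 2 ^+ n; pose w n : R := (a n).+1%:R / 2 ^+ n.
have uw n : u n <= w n by rewrite ler_wpM2r ?invr_ge0 ?exprn_ge0// ler_nat.
have step n : u n <= u n.+1 /\ w n.+1 <= w n.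
  have E : (2 : R) ^- n = 2 * 2 ^- n.+1.
    by rewrite exprS invfM mulrA divff ?mul1r// pnatr_eq0.
  have p0 : 0 <= (2 : R) ^- n.+1 by rewrite invr_ge0 exprn_ge0.
  rewrite /u /w E !mulrA; split; rewrite ler_wpM2r// -natrM ler_nat.
    by case: (aS n) => ->; lia.
  by case: (aS n) => ->; lia.
have ule m k : u m <= u (m + k)%N.
  by elim: k => [|k IH]; rewrite ?addn0// addnS (le_trans IH)//; case: (step (m + k)%N).
have wle m k : w (m + k)%N <= w m.
  by elim: k => [|k IH]; rewrite ?addn0// addnS (le_trans _ IH)//; case: (step (m + k)%N).
have uwmn m n : u m <= w n.
  by rewrite (le_trans (ule m n))// (le_trans (uw _))// addnC wle.
exists (sup (range u)) => n; apply/andP; split.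
  by apply: ub_le_sup; [exists (w 0%N) => _ [m _ <-]; exact: uwmn|exists n].
apply: ge_sup => [|_ [m _ <-]]; last exact: uwmn.
by exists (u 0%N); exists 0%N.
Qed.

End Dyadic.

(** * Goursat's bisection on the unit square *)

Section GoursatSquare.
Context {R : realType}.
Variables (alpha beta : R[i]) (K : R -> R -> R[i]).

(** Nodes of the dyadic square with lower corner [(a, b) / 2 ^ n] and side [1 / 2 ^ n], each side
    being cut into [2 ^ r] steps. *)
Definition grid n r a b : nat -> nat -> R[i] := fun j k =>
  K ((a * 2 ^ r + j)%:R / 2 ^+ (n + r)) ((b * 2 ^ r + k)%:R / 2 ^+ (n + r)).

(* Complex differentiability of K, seen as a function of the complex variable
   alpha * x + beta * y, relative to the unit square. *)
Hypothesis Kdiff : forall x y : R, 0 <= x <= 1 -> 0 <= y <= 1 -> exists d : R[i],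
  forall e : R, 0 < e -> exists2 dl : R, 0 < dl & forall x' y' : R,
    0 <= x' <= 1 -> 0 <= y' <= 1 -> `|x' - x| < dl -> `|y' - y| < dl ->
    cabs (K x' y' - K x y - d * (alpha * (x' - x)%:C%C + beta * (y' - y)%:C%C)) <=
      e * (`|x' - x| + `|y' - y|).

(** [block] omits the mesh [2 ^- (n + r)]; restoring it turns the threshold into Goursat's
    [c / 4 ^ n]. As no limit in [r] is known to exist, badness asks only for arbitrarily fine
    grids. *)
Let bad c n a b := forall M, exists2 r, (M <= r)%N &
  c * 2 ^+ r / 2 ^+ n < cabs (block alpha beta (grid n r a b) (2 ^ r)).

Lemma bad_child c n a b : bad c n a b -> exists i j : bool,
  bad c n.+1 (2 * a + i) (2 * b + j).
Proof.
apply: contraPP => noc.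
have good (i j : bool) : exists M, forall r, (M <= r)%N ->
    cabs (block alpha beta (grid n.+1 r (2 * a + i) (2 * b + j)) (2 ^ r)) <=
      c * 2 ^+ r / 2 ^+ n.+1.
  apply: contrapT => h; apply: noc; exists i, j => M; apply: contrapT => h'.
  apply: h; exists M => r Mr; rewrite leNgt; apply/negP => ?; apply: h'.
  by exists r.
have [M00 G00] := good false false; have [M01 G01] := good false true.
have [M10 G10] := good true false; have [M11 G11] := good true true.
(* The successor makes the exponent positive: a block of side [2 ^ r.+1] splits into four of side
   [2 ^ r], with [r] still beyond all four thresholds, and the four bounds add up to that of the
   parent. *)
move=> /(_ (maxn (maxn M00 M01) (maxn M10 M11)).+1)[[//|r]].
rewrite ltnS !geq_max => /andP[/andP[r00 r01] /andP[r10 r11]].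
rewrite expnS mul2n -addnn block_split.
have E (i j : bool) : shift_grid (grid n r.+1 a b) (i * 2 ^ r) (j * 2 ^ r) =
    grid n.+1 r (2 * a + i) (2 * b + j).
  apply/funext => p; apply/funext => q; rewrite /shift_grid /grid addnS addSn.
  by congr (K (_ %:R / _) (_ %:R / _)); rewrite expnS; ring.
have := E false false; have := E false true; have := E true false; have := E true true.
rewrite /= !mul0n !mul1n => -> -> -> ->; apply/negP; rewrite -leNgt.
move: (G00 _ r00) (G01 _ r01) (G10 _ r10) (G11 _ r11).
have -> : c * 2 ^+ r.+1 / 2 ^+ n = 4 * (c * 2 ^+ r / 2 ^+ n.+1) :> R.
  by rewrite !exprS; field; rewrite expf_neq0// pnatr_eq0.
move: (c * 2 ^+ r / 2 ^+ n.+1) => C h1 h2 h3 h4.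
rewrite (le_trans (cabsD _ _))// (le_trans (lerD (cabsD _ _) (cabsD _ _)))//.
lra.
Qed.

Lemma goursat_square c : 0 < c -> exists M, forall r, (M <= r)%N ->
  cabs (block alpha beta (grid 0 r 0 0) (2 ^ r)) <= c * 2 ^+ r.
Proof.
move=> c0; apply: contrapT => nex.
have bad0 : bad c 0 0 0.
  move=> M; apply: contrapT => h; apply: nex; exists M => r Mr.
  rewrite leNgt; apply/negP => ?; apply: h; exists r => //.
  by rewrite expr0 divr1.
pose child (x y : nat * (nat * nat)) := y.1 = x.1.+1 /\
  exists i j : bool, y.2 = ((2 * x.2.1 + i)%N, (2 * x.2.2 + j)%N).
pose B (x : nat * (nat * nat)) := bad c x.1 x.2.1 x.2.2.
(* The implication [B x -> B y] makes the relation total, as dependent choice demands; a chain that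
   starts at a bad square stays bad. *)
have [|f [f0 fS]] := @dependent_choice _ (fun x y => child x y /\ (B x -> B y)) _ (0%N, (0%N, 0%N)).
  move=> [n [a b]]; apply: cid.
  have [/bad_child[i [j bij]]|nb] := pselect (bad c n a b).
    by exists (n.+1, (2 * a + i, 2 * b + j)%N); split => //; split => //; exists i, j.
  by exists (n.+1, (2 * a, 2 * b)%N); split => //; split => //; exists false, false; rewrite !addn0.
have Bf n : B (f n) by elim: n => [|n]; [rewrite f0|case: (fS n) => _; apply].
have fn n : (f n).1 = n by elim: n => [|n]; [rewrite f0|case: (fS n) => [[-> _] _] ->].
have dy (i : bool) (k : nat) : (2 * k + i = 2 * k \/ 2 * k + i = (2 * k).+1)%N.
  by case: i; rewrite ?addn1 ?addn0; [right|left].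
have [|n|x xP] := @dyadic_limit R (fun n => (f n).2.1); first by rewrite f0.
  by have [[_ [i [j ->]]] _] := fS n; exact: dy.
have [|n|y yP] := @dyadic_limit R (fun n => (f n).2.2); first by rewrite f0.
  by have [[_ [i [j ->]]] _] := fS n; exact: dy.
have [x01 y01] : 0 <= x <= 1 /\ 0 <= y <= 1.
  by have := xP 0%N; have := yP 0%N; rewrite f0 /= expr0 !divr1.
have [d dP] := Kdiff x01 y01.
set A := cabs alpha + cabs beta.
have A0 : 0 <= A by rewrite addr_ge0 ?cabs_ge0.
(* With precision [eps], [block_bound] yields [4 * 2 ^ r * A * eps * 2 / 2 ^ n], whence the factor
   8; the added 1 covers [A = 0]. *)
have [|dl dl0 dlP] := dP (c / (8 * (A + 1))).
  by rewrite divr_gt0// mulr_gt0// ltr_wpDl.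
have [n ndl] : exists n, (2 : R) ^- n < dl.
  have [n _ /(_ n (leqnn n)) /=] : \forall n \near \oo, (`|0 - (2 : R)^-1 ^+ n| < dl).
    have /cvgrPdist_lt : (2 : R)^-1 ^+ n @[n --> \oo] --> (0 : R).
      by apply: cvg_expr; rewrite ger0_norm ?invf_lt1 ?invr_ge0// ltr1n.
    by move=> /(_ _ dl0).
  rewrite sub0r normrN ger0_norm ?exprn_ge0 ?invr_ge0// exprVn => ?.
  by exists n.
have := Bf n; rewrite /B fn => /(_ 0%N)[r _]; apply/negP; rewrite -leNgt.
move: (xP n) (yP n); set a := (f n).2.1; set b := (f n).2.2 => xn yn.
(* The linearisation of [K] at [(x, y)], evaluated at the corner of the small square. Subtracting
   this affine function leaves the block sum unchanged and makes every nodal value small. *)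
pose c0' := K x y + d * (alpha * (a%:R / 2 ^+ n - x)%:C%C + beta * (b%:R / 2 ^+ n - y)%:C%C).
rewrite -(block_affine alpha beta _ _ c0' (d * (2 ^- (n + r))%:C%C)).
have p2 k : 0 < (2 : R) ^+ k by rewrite exprn_gt0.
have node (p j : nat) : (j <= 2 ^ r)%N ->
    p%:R / 2 ^+ n <= (p * 2 ^ r + j)%:R / 2 ^+ (n + r) :> R /\
    (p * 2 ^ r + j)%:R / 2 ^+ (n + r) <= p.+1%:R / 2 ^+ n :> R.
  move=> jr; rewrite !exprD.
  have -> : p%:R / 2 ^+ n = (p * 2 ^ r)%:R / (2 ^+ n * 2 ^+ r) :> R.
    by rewrite natrM natrX; field; rewrite !gt_eqF.
  have -> : p.+1%:R / 2 ^+ n = (p * 2 ^ r + 2 ^ r)%:R / (2 ^+ n * 2 ^+ r) :> R.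
    by rewrite -natr1 natrD natrM natrX; field; rewrite !gt_eqF.
  by split; rewrite ler_pM2r ?invr_gt0 ?mulr_gt0// ler_nat ?leq_addr// leq_add2l.
have near1 (p j : nat) (t : R) : (j <= 2 ^ r)%N -> p%:R / 2 ^+ n <= t <= p.+1%:R / 2 ^+ n ->
    `|(p * 2 ^ r + j)%:R / 2 ^+ (n + r) - t| <= 2 ^- n.
  move=> jr tp; have := node p j jr; move: tp.
  rewrite -[p.+1%:R]natr1 mulrDl mul1r ler_norml => /andP[? ?] [? ?].
  by apply/andP; split; lra.
have in01 (p j : nat) : (j <= 2 ^ r)%N -> (p < 2 ^ n)%N ->
    0 <= ((p * 2 ^ r + j)%:R / 2 ^+ (n + r) : R) <= 1.
  move=> jr pn; rewrite divr_ge0 ?exprn_ge0//= ler_pdivrMr// mul1r.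
  have -> : (2 : R) ^+ (n + r) = (2 ^ (n + r))%:R by rewrite natrX.
  rewrite ler_nat expnD (@leq_trans (p.+1 * 2 ^ r))//; first by rewrite mulSn addnC leq_add2r.
  by rewrite leq_pmul2r// expn_gt0.
have an : (a < 2 ^ n)%N.
  apply: (@dyadic_lt (fun n => (f n).2.1)) => [|k]; first by rewrite f0.
  by have [[_ [i [j ->]]] _] := fS k; exact: dy.
have bn : (b < 2 ^ n)%N.
  apply: (@dyadic_lt (fun n => (f n).2.2)) => [|k]; first by rewrite f0.
  by have [[_ [i [j ->]]] _] := fS k; exact: dy.
apply: (le_trans (block_bound alpha beta (eta := c / (8 * (A + 1)) * (2 ^- n + 2 ^- n)) _)).
  move=> j k jr kr; rewrite /grid /c0'.
  set X := (_ / _ : R); set Y := (_ / _ : R).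
  have := dlP X Y (in01 _ _ jr an) (in01 _ _ kr bn)
    (le_lt_trans (near1 _ _ _ jr xn) ndl) (le_lt_trans (near1 _ _ _ kr yn) ndl).
  rewrite (_ : K X Y - _ - _ = K X Y - (K x y +
    d * (alpha * (a%:R / 2 ^+ n - x)%:C%C + beta * (b%:R / 2 ^+ n - y)%:C%C) +
    d * (2 ^- (n + r))%:C%C * (alpha * j%:R + beta * k%:R))).
    move=> h; apply: (le_trans h); rewrite ler_wpM2l//.
      by rewrite ltW// divr_gt0// mulr_gt0// ltr_wpDl.
    by rewrite lerD// near1.
  have EX : X = a%:R / 2 ^+ n + j%:R * 2 ^- (n + r).
    by rewrite /X natrD natrM natrX exprD; field; rewrite !gt_eqF.
  have EY : Y = b%:R / 2 ^+ n + k%:R * 2 ^- (n + r).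
    by rewrite /Y natrD natrM natrX exprD; field; rewrite !gt_eqF.
  have nC (m : nat) : m%:R = (m%:R : R)%:C%C by rewrite rmorph_nat.
  rewrite (nC j) (nC k) {2}EX {2}EY !rmorphB !rmorphD !rmorphM /=.
  by ring.
rewrite -/A natrX.
have -> : 4 * 2 ^+ r * A * (c / (8 * (A + 1)) * (2 ^- n + 2 ^- n)) =
   (A / (A + 1)) * (c * 2 ^+ r / 2 ^+ n).
  by field; rewrite !gt_eqF// ltr_wpDl.
apply: ler_piMl; last by rewrite ler_pdivrMr ?ltr_wpDl// mul1r lerDl.
by rewrite divr_ge0 ?exprn_ge0// mulr_ge0 ?exprn_ge0// ltW.
Qed.

End GoursatSquare.

(** * Complex differentiability, log-polar coordinates and the comparison of two circles *)

Section ComplexPlane.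
Context {R : realType}.
Implicit Types (z w : R[i]) (h g : R[i] -> R[i]).

Lemma cabs_continuous : continuous (cabs : R[i]^o -> R).
Proof.
move=> z; apply/(@cvgrPdist_lt _ _ _ _ (nbhs_filter z)) => e e0.
have : nbhs (z : R[i]^o) [set y | rnorm (y - z) < e] by apply/nbhs_rnormP; exists e.
apply: filterS => y; apply: le_lt_trans; rewrite ler_norml.
have := @rnorm_subD R R[i]^o y z; have := @rnorm_subD R R[i]^o z y.
by rewrite -/(cabs y) -/(cabs z) (rdistC z y) => ? ?; apply/andP; split; lra.
Qed.

Lemma Complex_continuous : continuous (fun p : R * R => Complex p.1 p.2 : R[i]^o).
Proof.
move=> [a b]; apply/cvg_rnormP => e e0.
have e2 : 0 < e / 2 by rewrite divr_gt0.
exists ([set x | `|a - x| < e / 2], [set y | `|b - y| < e / 2]).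
  by split; apply/nbhs_normP; exists (e / 2).
move=> [x y] [/= xa yb].
apply: (le_lt_trans (cabs_le_ReIm (Complex x y - Complex a b))) => /=.
by rewrite (distrC x) (distrC y); lra.
Qed.

Lemma cdisc_compact (r : R) : compact [set z : R[i]^o | cabs z <= r].
Proof.
have cI : compact (`[- r, r] : set R) by exact: segment_compact.
have cc := continuous_compact (continuous_subspaceT Complex_continuous) (compact_setX cI cI).
apply: (subclosed_compact _ cc).
  rewrite (_ : [set _ | _] = (cabs : R[i]^o -> R) @^-1` [set x | x <= r])//.
  by apply: preimage_closed; [move=> z _; exact: cabs_continuous|exact: closed_le].
move=> z /= zr; exists (complex.Re z, complex.Im z); last by case: (z).
by split; rewrite /= in_itv /= -ler_norml (le_trans _ zr)// ?Re_le_cabs ?Im_le_cabs.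
Qed.

Definition cdiff h z := exists d, forall e : R, 0 < e -> exists2 dl : R, 0 < dl &
  forall u, cabs u < dl -> cabs (h (z + u) - h z - d * u) <= e * cabs u.

Definition ccont h z := forall e : R, 0 < e -> exists2 dl : R, 0 < dl &
  forall u, cabs u < dl -> cabs (h (z + u) - h z) < e.

Lemma cdiff_cont h z : cdiff h z -> ccont h z.
Proof.
move=> [d hd] e e0; have [dl dl0 dlP] := hd 1 ltr01.
have D0 : 0 < 1 + cabs d by rewrite ltr_wpDr ?cabs_ge0.
exists (Num.min dl (e / (1 + cabs d))).
  by rewrite lt_min dl0 divr_gt0.
move=> u; rewrite lt_min => /andP[/dlP h1]; rewrite ltr_pdivlMr// => h2.
rewrite -[h (z + u) - h z](subrK (d * u)) (le_lt_trans (cabsD _ _))//.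
by rewrite cabsM; rewrite mul1r in h1; move: h1 h2; rewrite mulrDr; lra.
Qed.

Lemma cdiff_comb a b h g z : cdiff h z -> cdiff g z ->
  cdiff (fun x => a * h x + b * g x) z.
Proof.
move=> [d hd] [d' gd]; exists (a * d + b * d') => e e0.
pose e' := e / (cabs a + cabs b + 1).
have D0 : 0 < cabs a + cabs b + 1 by rewrite ltr_wpDl// addr_ge0 ?cabs_ge0.
have e'0 : 0 < e' by rewrite divr_gt0.
have [dl dl0 dlP] := hd _ e'0; have [dl' dl'0 dl'P] := gd _ e'0.
exists (Num.min dl dl'); first by rewrite lt_min dl0.
move=> u; rewrite lt_min => /andP[/dlP h1 /dl'P h2].
rewrite (_ : _ - _ - _ = a * (h (z + u) - h z - d * u) +
  b * (g (z + u) - g z - d' * u)); last by ring.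
rewrite (le_trans (cabsD _ _))// !cabsM.
rewrite (le_trans (lerD (ler_wpM2l (cabs_ge0 a) h1) (ler_wpM2l (cabs_ge0 b) h2)))//.
have -> : e * cabs u = (cabs a + cabs b + 1) * (e' * cabs u).
  by rewrite /e'; field; rewrite gt_eqF.
have : 0 <= e' * cabs u by rewrite mulr_ge0 ?cabs_ge0 ?ltW.
by lra.
Qed.

Lemma cdiff_id z : cdiff id z.
Proof.
exists 1 => e e0; exists 1 => // u _.
by rewrite /= mul1r [z + u]addrC addrK subrr cabs0 mulr_ge0 ?cabs_ge0 ?ltW.
Qed.

(* exp (s + i t) *)
Definition cexp (s t : R) : R[i] := Complex (expR s * cos t) (expR s * sin t).

Lemma cexpD s t a b : cexp (s + a) (t + b) = cexp s t * cexp a b.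
Proof.
by rewrite /cexp expRD cosD sinD; apply/eqP; rewrite eq_complex /=;
  apply/andP; split; apply/eqP; ring.
Qed.

Lemma cabs_cexp s t : cabs (cexp s t) = expR s.
Proof.
by rewrite cabsE /= !exprMn -mulrDr cos2Dsin2 mulr1 sqrtr_sqr ger0_norm// expR_ge0.
Qed.

Lemma is_derive_eps (f : R -> R) (x df : R) : is_derive x 1 f df ->
  forall e, 0 < e -> exists2 dl, 0 < dl &
    forall u, `|u| < dl -> `|f (x + u) - f x - df * u| <= e * `|u|.
Proof.
move=> [fx fdf] e e0; move: fx => /cvg_ex[l fl].
have ldf : l = df by rewrite -fdf; apply/esym/cvg_lim.
move: fl; rewrite ldf => /cvgrPdist_le /(_ _ e0).
move=> /nbhs_normP[dl /= dl0 dlP]; exists dl => // u udl.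
have [->|u0] := eqVneq u 0; first by rewrite addr0 mulr0 !subrr normr0 mulr0.
have := dlP u; rewrite /ball_ /= sub0r normrN => /(_ udl u0).
rewrite /= /GRing.scale /= mulr1 (addrC u x) => h.
rewrite (_ : _ - _ - _ = (df - u^-1 * (f (x + u) - f x)) * (- u)); last by field.
by rewrite normrM normrN ler_wpM2r.
Qed.

Lemma cexp_diff0 (e : R) : 0 < e -> exists2 dl : R, 0 < dl &
  forall a b : R, `|a| < dl -> `|b| < dl ->
    cabs (cexp a b - 1 - Complex a b) <= e * (`|a| + `|b|).
Proof.
(* Real and imaginary parts together cost at most [e' * |a| + 5 * e' * |b|], so a sixth of [e]
   leaves room; [e' <= 1] serves to bound [|sin b|] by [2 * |b|]. *)
move=> e0; pose e' := Num.min 1 (e / 6).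
have e'0 : 0 < e' by rewrite lt_min ltr01 divr_gt0.
have e'1 : e' <= 1 by rewrite ge_min lexx.
have e'e : e' <= e / 6 by rewrite ge_min lexx orbT.
have [d1 d10 h1] := is_derive_eps (is_derive_expR 0) e'0.
have [d2 d20 h2] := is_derive_eps (is_derive_sin 0) e'0.
have [d3 d30 h3] := is_derive_eps (is_derive_cos 0) e'0.
pose D := Num.min (Num.min d1 d2) (Num.min d3 (e' / 2)).
have D0 : 0 < D by rewrite !lt_min d10 d20 d30 divr_gt0.
exists D => // a b; rewrite !lt_min => /andP[/andP[/h1 ha _] /andP[_ a2]].
move=> /andP[/andP[_ /h2 hs] /andP[/h3 hc _]].
rewrite !add0r expR0 mul1r in ha; rewrite !add0r sin0 cos0 mul1r subr0 in hs.
rewrite !add0r cos0 sin0 oppr0 mul0r subr0 in hc.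
apply: le_trans (cabs_le_ReIm _) _ => /=; rewrite subr0.
have a0 := normr_ge0 a; have b0 := normr_ge0 b.
have eb : e' * `|b| <= `|b| by rewrite ler_piMl.
have ea : e' * `|a| <= `|a| by rewrite ler_piMl.
have expa : `|expR a - 1| <= e'.
  rewrite -[expR a - 1](subrK a) (le_trans (ler_normD _ _))//; lra.
have sb : `|sin b| <= 2 * `|b|.
  by rewrite -[sin b](subrK b) (le_trans (ler_normD _ _))//; lra.
have cb : `|cos b| <= 1 by rewrite ler_norml cos_geN1 cos_le1.
have E1 : `|expR a * cos b - 1 - a| <= e' * `|a| + 2 * (e' * `|b|).
  rewrite (_ : _ - _ - _ = (expR a - 1 - a) * cos b + (1 + a) * (cos b - 1)); last by ring.
  rewrite (le_trans (ler_normD _ _))// !normrM lerD//.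
    by rewrite (le_trans (ler_piMr _ cb)).
  rewrite ler_pM// (le_trans (ler_normD _ _))// normr1.
  by lra.
have E2 : `|expR a * sin b - b| <= 3 * (e' * `|b|).
  rewrite (_ : _ - _ = (expR a - 1) * sin b + (sin b - b)); last by ring.
  rewrite (le_trans (ler_normD _ _))// normrM.
  have : `|expR a - 1| * `|sin b| <= e' * (2 * `|b|) by rewrite ler_pM.
  by lra.
have : e' * (`|a| + `|b|) <= e / 6 * (`|a| + `|b|) by rewrite ler_wpM2r ?addr_ge0.
have : 0 <= e' * `|a| by rewrite mulr_ge0 // ltW.
have : 0 <= e * `|a| by rewrite mulr_ge0 // ltW.
have : 0 <= e * `|b| by rewrite mulr_ge0 // ltW.
by move: E1 E2; rewrite !mulrDr; lra.
Qed.

(** The chain rule for [h] after [z0 + exp]. The increment enters only through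
    [(s2 - s1) * dx + 2 pi i * dy], which is the differentiability that [goursat_square] expects
    with these values of [alpha] and [beta]. *)
Lemma cdiff_polar h z0 (s1 s2 x y : R) :
  let K x y := h (z0 + cexp (s1 + (s2 - s1) * x) (pi *+ 2 * y)) in
  cdiff h (z0 + cexp (s1 + (s2 - s1) * x) (pi *+ 2 * y)) ->
  exists d : R[i], forall e : R, 0 < e -> exists2 dl : R, 0 < dl & forall x' y' : R,
    `|x' - x| < dl -> `|y' - y| < dl ->
    cabs (K x' y' - K x y - d * ((s2 - s1)%:C%C * (x' - x)%:C%C +
      Complex 0 (pi *+ 2) * (y' - y)%:C%C)) <= e * (`|x' - x| + `|y' - y|).
Proof.
move=> K; set k := cexp _ _ => -[d hd]; exists (d * k) => e e0.
pose P : R := pi *+ 2; pose A : R := `|s2 - s1| + P + 1.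
have P0 : 0 <= P by rewrite mulrn_wge0// pi_ge0.
have A0 : 0 < A by rewrite ltr_wpDl// addr_ge0.
(* [e1] pays for the remainder of [h] and [e2] for that of the exponential; each ends up costing
   [e / 2] times [|a| + |b|]. *)
pose e1 : R := e / (4 * A * (cabs k + 1)).
have k1 : 0 < cabs k + 1 by rewrite ltr_wpDl// cabs_ge0.
have e10 : 0 < e1 by rewrite divr_gt0// !mulr_gt0.
pose e2 : R := Num.min 1 (e / (2 * A * ((cabs d + 1) * (cabs k + 1)))).
have d1 : 0 < cabs d + 1 by rewrite ltr_wpDl// cabs_ge0.
have e20 : 0 < e2 by rewrite lt_min ltr01 divr_gt0// !mulr_gt0.
have [dl1 dl10 h1] := hd _ e10; have [dl2 dl20 h2] := cexp_diff0 e20.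
pose D := Num.min (dl2 / A) (dl1 / (4 * A * (cabs k + 1))).
have D0 : 0 < D by rewrite lt_min !divr_gt0// !mulr_gt0.
exists D => // x' y' xD yD.
set a := x' - x; set b := y' - y.
pose D1 : R := `|a| + `|b|.
have an := normr_ge0 a; have bn := normr_ge0 b.
pose sa := (s2 - s1) * a; pose tb := P * b.
have saA : `|sa| <= A * `|a| by rewrite normrM ler_wpM2r// /A; lra.
have tbA : `|tb| <= A * `|b|.
  by rewrite normrM ler_wpM2r// /A ger0_norm//; have := normr_ge0 (s2 - s1); lra.
have A0' := ltW A0.
have small (t : R) : `|t| < D -> A * `|t| < dl2.
  by rewrite lt_min => /andP[+ _]; rewrite ltr_pdivlMr// mulrC.
have hexp := h2 sa tb (le_lt_trans saA (small _ xD)) (le_lt_trans tbA (small _ yD)).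
pose u := k * (cexp sa tb - 1).
have sum_le : `|sa| + `|tb| <= A * D1 by rewrite /D1 mulrDr lerD.
have D1ge : 0 <= D1 by rewrite addr_ge0.
have AD1 : 0 <= A * D1 by rewrite mulr_ge0.
have lin_le : cabs (Complex sa tb) <= A * D1.
  by apply: le_trans (cabs_le_ReIm _) _.
have k0 := cabs_ge0 k.
have ule : cabs u <= cabs k * (2 * (A * D1)).
  rewrite /u cabsM ler_wpM2l//.
  rewrite -[cexp _ _ - 1](subrK (Complex sa tb)) (le_trans (cabsD _ _))//.
  have : e2 * (`|sa| + `|tb|) <= 1 * (A * D1).
    by rewrite ler_pM// ?addr_ge0// ?(ltW e20)// ge_min lexx.
  by lra.
have kk : cabs k * (2 * (A * D1)) <= 2 * A * (cabs k + 1) * D1.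
  have : 0 <= 2 * (A * D1) by rewrite mulr_ge0.
  by rewrite [X in _ -> _ <= X](_ : _ = cabs k * (2 * (A * D1)) + 2 * (A * D1)); [lra|ring].
have udl1 : cabs u < dl1.
  apply: (le_lt_trans ule); apply: (le_lt_trans kk).
  move: xD yD; rewrite !lt_min => /andP[_ xD] /andP[_ yD].
  have q0 : 0 < 4 * A * (cabs k + 1) by rewrite !mulr_gt0.
  move: xD yD; rewrite !ltr_pdivlMr// -/a -/b /D1 => xD yD.
  have -> : 2 * A * (cabs k + 1) * (`|a| + `|b|) =
    (`|a| * (4 * A * (cabs k + 1)) + `|b| * (4 * A * (cabs k + 1))) / 2 by field.
  by lra.
have EK : K x' y' = h (z0 + k + u).
  rewrite /K /u /k -addrA; congr (h (_ + _)).
  rewrite mulrBr mulr1 addrCA subrr addr0 -cexpD /sa /tb /a /b /P.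
  by congr cexp; ring.
have Elin : (s2 - s1)%:C%C * a%:C%C + Complex 0 P * b%:C%C = Complex sa tb.
  by apply/eqP; rewrite eq_complex /=; apply/andP; split; apply/eqP; rewrite /sa /tb; ring.
rewrite EK Elin.
rewrite (_ : _ - _ - _ = (h (z0 + k + u) - h (z0 + k) - d * u) +
  d * k * (cexp sa tb - 1 - Complex sa tb)); last by rewrite /u /K -/k; ring.
have b1 := h1 u udl1.
have b2 : cabs (d * k * (cexp sa tb - 1 - Complex sa tb)) <= e / 2 * D1.
  rewrite !cabsM.
  have s1' : cabs (cexp sa tb - 1 - Complex sa tb) <=
      e / (2 * A * ((cabs d + 1) * (cabs k + 1))) * (A * D1).
    apply: (le_trans hexp); rewrite ler_pM ?addr_ge0 ?(ltW e20)//.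
    by rewrite ge_min lexx orbT.
  apply: (@le_trans _ _ ((cabs d + 1) * (cabs k + 1) *
     (e / (2 * A * ((cabs d + 1) * (cabs k + 1))) * (A * D1)))).
    rewrite ler_pM ?mulr_ge0 ?cabs_ge0//.
    by rewrite ler_pM ?cabs_ge0// lerDl.
  by rewrite le_eqVlt; apply/orP; left; apply/eqP; field; rewrite !gt_eqF.
have b3 : e1 * cabs u <= e / 2 * D1.
  apply: (@le_trans _ _ (e1 * (2 * A * (cabs k + 1) * D1))).
    by rewrite ler_wpM2l ?(ltW e10)// (le_trans ule).
  by rewrite le_eqVlt; apply/orP; left; apply/eqP; rewrite /e1; field; rewrite !gt_eqF.
rewrite (le_trans (cabsD _ _))// (le_trans (lerD b1 b2))//.
by rewrite (le_trans (lerD b3 (lexx _)))// -mulrDl -splitr.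
Qed.

(** Compare with a circle so small that [Re h] stays above [Re (h z0) - dl0 / 2] on it. In log-polar
    coordinates the annulus between the circles is the unit square, the radial sides cancel by
    periodicity, and [goursat_square] bounds the difference of the two circular sums. *)
Lemma Re_circle h z0 (rho dl0 : R) : 0 < rho -> 0 < dl0 ->
  (forall z, 0 < cabs (z - z0) <= rho -> cdiff h z) -> ccont h z0 ->
  ~ forall z, cabs (z - z0) = rho -> complex.Re (h z) <= complex.Re (h z0) - dl0.
Proof.
move=> rho0 dl00 hd hc hle.
have [rc rc0 hrc] := hc _ (divr_gt0 dl00 (ltr0n R 2)).
pose rho' := Num.min rho rc / 2.
have rho'0 : 0 < rho' by rewrite divr_gt0// lt_min rho0.
have rho'rho : rho' < rho.
  have : Num.min rho rc <= rho by rewrite ge_min lexx.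
  by rewrite /rho'; lra.
have rho'rc : rho' < rc.
  have : Num.min rho rc <= rc by rewrite ge_min lexx orbT.
  by rewrite /rho'; lra.
pose s1 := ln rho'; pose s2 := ln rho.
have s12 : s1 < s2 by rewrite ltr_ln ?posrE.
pose K x y := h (z0 + cexp (s1 + (s2 - s1) * x) (pi *+ 2 * y)).
have [|M /(_ M (leqnn M))] := @goursat_square R (s2 - s1)%:C%C (Complex 0 (pi *+ 2)) K _ dl0 dl00.
  move=> x y /andP[x0 x1] y01.
  have [|d dP] := @cdiff_polar h z0 s1 s2 x y.
    apply: hd; rewrite addrC addKr cabs_cexp expR_gt0 /=.
    rewrite -[rho]lnK ?posrE// ler_expR -/s2.
    have : (s2 - s1) * x <= (s2 - s1) * 1 by rewrite ler_wpM2l// subr_ge0 ltW.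
    by lra.
  by exists d => e /dP[dl ? dlP]; exists dl => // x' y' _ _; exact: dlP.
rewrite block_boundary.
set G := grid K 0 M 0 0; set m := (2 ^ M)%N.
have m0 : 0 < m%:R :> R by rewrite ltr0n expn_gt0.
have mE : (m%:R : R) = 2 ^+ M by rewrite natrX.
have GE j k : G j k = K (j%:R / m%:R) (k%:R / m%:R) by rewrite /G /grid !mul0n !add0n mE.
have per j : G j m = G j 0%N.
  rewrite !GE mul0r divff ?gt_eqF// /K mulr1 mulr0; congr (h (_ + _)).
  by rewrite /cexp cos2pi sin2pi cos0 sin0.
rewrite big1 ?mulr0 ?add0r => [|j _]; last by rewrite !per; ring.
have out k : complex.Re (G m k) <= complex.Re (h z0) - dl0.
  rewrite GE divff ?gt_eqF// /K mulr1; apply: hle.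
  by rewrite addrC addKr cabs_cexp addrCA subrr addr0 lnK.
have inn k : complex.Re (h z0) - dl0 / 2 <= complex.Re (G 0 k).
  rewrite GE mul0r /K mulr0 addr0.
  have := hrc (cexp s1 (pi *+ 2 * (k%:R / m%:R))); rewrite cabs_cexp lnK ?posrE//.
  move=> /(_ rho'rc); set w := h _ => hw.
  have := le_lt_trans (Re_le_cabs _) hw; rewrite ltr_norml => /andP[+ _].
  by case: (w) (h z0) => ? ? [? ?] /=; lra.
set S := \sum_(k < m) _; rewrite cabsM.
(* Each summand loses [2 * dl0] on the outer circle and at most [dl0] on the inner one, so [cabs S]
   is at least [dl0 * m]. The factor [2 * pi >= 4] then contradicts the bound [dl0 * m] from
   [goursat_square]. *)
have SRe : complex.Re S <= - dl0 *+ m.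
  have Re_add : {morph (@complex.Re R) : x y / x + y} by move=> [? ?] [? ?].
  rewrite /S (big_morph _ Re_add (erefl : complex.Re 0 = 0 :> R)).
  rewrite -[X in _ *+ X](card_ord m) -sumr_const ler_sum// => k _.
  have := out k; have := out k.+1; have := inn k; have := inn k.+1.
  by case: (G m k) (G m k.+1) (G 0 k) (G 0 k.+1) => [? ?] [? ?] [? ?] [? ?] /=; lra.
have Sbig : dl0 * m%:R <= cabs S.
  apply: le_trans (Re_le_cabs S); rewrite ler0_norm; last first.
    by rewrite (le_trans SRe)// mulNrn oppr_le0 mulrn_wge0// ltW.
  by move: SRe; rewrite mulNrn -mulr_natr; lra.
have -> : cabs (Complex 0 (pi *+ 2)) = pi *+ 2 :> R.
  by rewrite cabsE /= expr0n add0r sqrtr_sqr ger0_norm// mulrn_wge0// pi_ge0.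
rewrite -mE; apply/negP; rewrite -ltNge.
have dm : 0 < dl0 * m%:R by rewrite mulr_gt0.
have : 4 * (dl0 * m%:R) <= pi *+ 2 * cabs S.
  apply: ler_pM => //; first exact: ltW.
  by have := pi_ge2 R; rewrite mulr2n; lra.
by lra.
Qed.

End ComplexPlane.

(** * Maximum modulus, Schwarz lemma and uniform limits *)

Section MaximumModulus.
Context {R : realType}.
Implicit Types (z w : R[i]) (h g : R[i] -> R[i]).

Lemma Re_mulconj z w : complex.Re (z^*%C * w) =
  complex.Re z * complex.Re w + complex.Im z * complex.Im w.
Proof. by case: z => a b; case: w => c d /=; ring. Qed.

(* A maximum of Re (c h) + eps |z|^2 inside the disc would contradict Re_circle
   for c h + 2 eps conj(z0) z, where z0 is the point of maximum. *)
Lemma maximum_modulus h r M : 0 < r ->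
  (forall z, 0 < cabs z <= r -> cdiff h z) -> ccont h 0 ->
  (forall z, cabs z = r -> cabs (h z) <= M) ->
  forall z, cabs z <= r -> cabs (h z) <= M.
Proof.
move=> r0 hd hc hM z1 z1r; rewrite leNgt; apply/negP => Mh.
have M0 : 0 <= M.
  apply: le_trans (hM r%:C%C _); first exact: cabs_ge0.
  by rewrite cabsR ger0_norm// ltW.
have h10 : 0 < cabs (h z1) by rewrite (le_lt_trans M0).
pose c : R[i] := (h z1)^*%C * ((cabs (h z1))^-1)%:C%C.
have c1 : cabs c = 1.
  rewrite /c cabsM cabs_conj cabsR ger0_norm ?invr_ge0 ?ltW//.
  by rewrite divff// gt_eqF.
have ch1 : complex.Re (c * h z1) = cabs (h z1).
  rewrite /c mulrAC conj_mul_cabs -rmorphM /= expr2 -mulrA divff ?mulr1//.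
  by rewrite gt_eqF.
(* Small enough that adding [eps * |z| ^ 2] does not lift the boundary values of [Phi] to its value
   at [z1]. *)
pose eps := (cabs (h z1) - M) / (r ^+ 2 + 1).
have r21 : 0 < r ^+ 2 + 1 by rewrite ltr_wpDl// sqr_ge0.
have eps0 : 0 < eps by rewrite divr_gt0// subr_gt0.
have epsr : eps * r ^+ 2 < cabs (h z1) - M.
  rewrite /eps mulrAC ltr_pdivrMr// ltr_pM2l ?subr_gt0//.
  by rewrite ltrDl.
pose Phi z := complex.Re (c * h z) + eps * cabs z ^+ 2.
have hcont z : cabs z <= r -> ccont h z.
  move=> zr; have [->//|z0] := eqVneq z 0.
  by apply/cdiff_cont/hd; rewrite cabs_gt0 z0.
have [z0 z0r z0max] : exists2 z0 : R[i], cabs z0 <= r &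
    forall z, cabs z <= r -> Phi z <= Phi z0.
  have [| |z0 /set_mem z0r z0max] := @compact_EVT_max R[i]^o R Phi
      [set z | cabs z <= r] _ (@cdisc_compact R r).
  - by exists z1.
  - apply: continuous_in_subspaceT => z /set_mem /= zr.
    have FF : Filter (nbhs (z : R[i]^o)) by exact: nbhs_filter.
    have cabs2 := cvgM (@cabs_continuous R z) (@cabs_continuous R z).
    have ecabs2 := cvgM (cvg_cst eps) (cabs2 FF).
    suff cRe : (fun x : R[i]^o => complex.Re (c * h x)) @ nbhs (z : R[i]^o) -->
        complex.Re (c * h z) by exact: (cvgD cRe (ecabs2 FF FF)).
    apply/(@cvgrPdist_lt _ _ _ _ (nbhs_filter (z : R[i]^o))) => e e0.
    have [dl dl0 dlP] := hcont z zr e e0.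
    have : nbhs (z : R[i]^o) [set y | rnorm (y - z) < dl] by apply/nbhs_rnormP; exists dl.
    apply: filterS => y yz.
    have := dlP (y - z) yz; rewrite [z + _]addrC subrK => hyz.
    rewrite distrC; apply: le_lt_trans hyz.
    have -> : complex.Re (c * h y) - complex.Re (c * h z) = complex.Re (c * (h y - h z)).
      by case: (c) (h y) (h z) => [? ?] [? ?] [? ?] /=; ring.
    by rewrite (le_trans (Re_le_cabs _))// cabsM c1 mul1r.
  - by exists z0 => // z zr; apply: z0max; rewrite inE.
have PhiB z : cabs z = r -> Phi z < Phi z0.
  move=> zr; apply: (@lt_le_trans _ _ (Phi z1)); last exact: z0max.
  rewrite /Phi ch1 zr; apply: (@lt_le_trans _ _ (cabs (h z1))).
    have : complex.Re (c * h z) <= M.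
      apply: le_trans (hM _ zr); apply: le_trans (ler_norm _) _.
      by rewrite (le_trans (Re_le_cabs _))// cabsM c1 mul1r.
    by lra.
  by rewrite lerDl mulr_ge0 ?sqr_ge0 ?ltW.
have z0r' : cabs z0 < r.
  rewrite lt_neqAle z0r andbT; apply/eqP => zr.
  by have := PhiB _ zr; rewrite ltxx.
(* The closed disc of radius [rho] about [z0] stays inside the given disc and meets 0 at most in its
   centre, because [h] is only known to be continuous at 0. *)
pose rho := (if z0 == 0 then r else Num.min (r - cabs z0) (cabs z0)) / 2.
have rho0 : 0 < rho.
  rewrite divr_gt0//; case: eqVneq => // z00.
  by rewrite lt_min subr_gt0 z0r' cabs_gt0.
have rhor z : cabs (z - z0) <= rho -> cabs z <= r.
  move=> zz; have := @rnorm_subD R R[i]^o z z0; rewrite -/(cabs _) -/(cabs z) -/(cabs z0).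
  move: zz; rewrite /rho; case: eqVneq => [->|z00]; first by rewrite cabs0; lra.
  have := ge_min (r - cabs z0) (r - cabs z0) (cabs z0); rewrite lexx /=.
  by move: (Num.min _ _) => q; lra.
have rhod z : 0 < cabs (z - z0) <= rho -> z != 0.
  move=> /andP[zz0 zz]; apply/eqP => z00; move: zz0 zz.
  rewrite z00 sub0r cabsN /rho; case: eqVneq => [->|z0n0]; first by rewrite cabs0 ltxx.
  have := ge_min (cabs z0) (r - cabs z0) (cabs z0); rewrite lexx orbT.
  by move: (Num.min _ _) => q; lra.
(* Since [|z|^2 = |z0|^2 + 2 Re (conj z0 (z - z0)) + |z - z0|^2], the linear part is the real part
   of a holomorphic function, and the last term turns maximality of [Phi z0] into a drop of
   [eps * rho ^ 2] of [Re g] on the circle. *)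
pose g z := c * h z + (2 * eps%:C%C * z0^*%C) * z.
apply: (@Re_circle R g z0 rho (eps * rho ^+ 2) rho0).
- by rewrite mulr_gt0// exprn_gt0.
- move=> z zz; apply: (@cdiff_comb _ c _ h id); last exact: cdiff_id.
  apply: hd; rewrite cabs_gt0 (rhod z zz) /= rhor//.
  by case/andP: zz.
- have [z00|z00] := eqVneq z0 0; last first.
    apply: cdiff_cont; apply: (@cdiff_comb _ c _ h id); last exact: cdiff_id.
    by apply: hd; rewrite cabs_gt0 z00.
  move=> e e0; rewrite /g z00; have [dl dl0 dlP] := hc e e0; exists dl => // u udl.
  rewrite conjc0 !mulr0 !mul0r !addr0 -mulrBr cabsM c1 mul1r.
  exact: dlP.
- move=> z zz.
  have := z0max z; rewrite rhor ?zz// => /(_ isT).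
  have E : cabs z ^+ 2 = cabs z0 ^+ 2 + 2 * complex.Re (z0^*%C * (z - z0)) + rho ^+ 2.
    rewrite -zz !sqr_cabs Re_mulconj.
    by case: (z) (z0) => [? ?] [? ?] /=; ring.
  have E2 w : complex.Re (g w) = complex.Re (c * h w) + 2 * eps * complex.Re (z0^*%C * w).
    rewrite /g; case: (c * h w) (z0^*%C) => [? ?] [? ?]; case: (w) => [? ?] /=.
    by ring.
  rewrite /Phi E !E2.
  have -> : complex.Re (z0^*%C * (z - z0)) =
      complex.Re (z0^*%C * z) - complex.Re (z0^*%C * z0).
    by case: (z0^*%C) (z) (z0) => [? ?] [? ?] [? ?] /=; ring.
  by move: (rho ^+ 2) => q; lra.
Qed.

Lemma cdiff_quotient g z0 z : z != 0 -> cdiff g z ->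
  cdiff (fun w => (g w - z0) / w) z.
Proof.
move=> zn0 [d hd]; pose G := g z - z0; exists ((d * z - G) / z ^+ 2) => e e0.
have Z0 : 0 < cabs z by rewrite cabs_gt0.
pose Q : R := cabs (G - d * z) / cabs z ^+ 2.
have Q0 : 0 <= Q by rewrite divr_ge0 ?cabs_ge0// sqr_ge0.
have e10 : 0 < e * cabs z / 4 by rewrite divr_gt0// mulr_gt0.
have [dl dl0 dlP] := hd _ e10.
pose D : R := Num.min dl (Num.min (cabs z / 2) (e * cabs z / (4 * (Q + 1)))).
have Q1 : 0 < Q + 1 by rewrite ltr_wpDl.
exists D; first by rewrite !lt_min dl0 !divr_gt0// mulr_gt0.
move=> u; rewrite !lt_min => /andP[/dlP hu /andP[uz uQ]].
have zu : cabs z / 2 <= cabs (z + u).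
  by have := cabsB (z + u) u; rewrite addrK; lra.
have zu0 : 0 < cabs (z + u) by rewrite (lt_le_trans _ zu)// divr_gt0.
have zun0 : z + u != 0 by rewrite -cabs_gt0.
set E := g (z + u) - g z - d * u in hu.
rewrite (_ : _ - _ - _ = E / (z + u) + (G - d * z) / z ^+ 2 * u ^+ 2 / (z + u)); last first.
  by rewrite /E /G; field; rewrite zun0 zn0.
have zuV : (cabs (z + u))^-1 <= 2 / cabs z.
  by rewrite -[2 / _]invf_div lef_pV2// posrE// divr_gt0.
have u0 := cabs_ge0 u.
have b1 : cabs (E / (z + u)) <= e / 2 * cabs u.
  rewrite cabsM cabsV; apply: (@le_trans _ _ (e * cabs z / 4 * cabs u * (2 / cabs z))).
    by rewrite ler_pM ?cabs_ge0 ?invr_ge0// cabs_ge0.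
  by rewrite le_eqVlt; apply/orP; left; apply/eqP; field; rewrite gt_eqF.
have b2 : cabs ((G - d * z) / z ^+ 2 * u ^+ 2 / (z + u)) <= e / 2 * cabs u.
  rewrite cabsM cabsV; set W := _ * _ ^+ 2.
  have WE : cabs W = Q * cabs u * cabs u.
    by rewrite /W /Q !expr2 !cabsM cabsV cabsM; ring.
  rewrite WE; apply: (@le_trans _ _ (Q * (e * cabs z / (4 * (Q + 1))) * cabs u * (2 / cabs z))).
    apply: ler_pM => //; first exact: mulr_ge0 (mulr_ge0 Q0 u0) u0.
      by rewrite invr_ge0 cabs_ge0.
    by rewrite ler_wpM2r// ler_wpM2l// ltW.
  rewrite (_ : _ * _ = Q / (Q + 1) * (e / 2 * cabs u)); last first.
    by field; rewrite !gt_eqF.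
  rewrite ler_piMl//; first by rewrite mulr_ge0 ?divr_ge0// ltW.
  by rewrite ler_pdivrMr// mul1r lerDl.
by rewrite (le_trans (cabsD _ _))//; lra.
Qed.

(** The difference quotient at 0, completed by the derivative, is at most [2 * M / r] on the circle,
    hence in the disc. Its continuity at 0 is immediate but its differentiability there is not,
    which is why [maximum_modulus] exempts the centre. *)
Lemma schwarz g r M : 0 < r -> (forall z, cabs z <= r -> cdiff g z) ->
  (forall z, cabs z <= r -> cabs (g z) <= M) ->
  forall z, cabs z <= r -> cabs (g z - g 0) <= 2 * M / r * cabs z.
Proof.
move=> r0 gd gM z zr.
have c0r : cabs (0 : R[i]) <= r by rewrite cabs0 ltW.
have [d0 d0P] := gd 0 c0r.
pose h w := if w == 0 then d0 else (g w - g 0) / w.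
suff hle : cabs (h z) <= 2 * M / r.
  have [->|z0] := eqVneq z 0; first by rewrite subrr cabs0 mulr0.
  move: hle; rewrite /h (negbTE z0) cabsM cabsV ler_pdivrMr//.
  by rewrite cabs_gt0.
apply: (maximum_modulus r0) zr.
- move=> w /andP[w0 wr]; have wn0 : w != 0 by rewrite -cabs_gt0.
  have [d dP] := cdiff_quotient (g 0) wn0 (gd w wr); exists d => e /dP[dl dl0 dlP].
  exists (Num.min dl (cabs w)) => [|u]; first by rewrite lt_min dl0.
  rewrite lt_min => /andP[/dlP + uw]; rewrite /h (negbTE wn0) ifN//.
  rewrite -cabs_gt0; have := cabsB (w + u) u; rewrite addrK.
  by lra.
- move=> e e0; have e2 : 0 < e / 2 by rewrite divr_gt0.
  have [dl dl0 dlP] := d0P _ e2; exists dl => // u udl.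
  rewrite add0r /h eqxx; case: eqVneq => [_|u0]; first by rewrite subrr cabs0.
  have := dlP u udl; rewrite add0r => hu.
  have -> : (g u - g 0) / u - d0 = (g u - g 0 - d0 * u) / u by field.
  rewrite cabsM cabsV ltr_pdivrMr ?cabs_gt0//; apply: le_lt_trans hu _.
  by rewrite ltr_pM2r ?cabs_gt0//; lra.
- move=> w wr; rewrite /h; case: eqVneq => [w0|w0].
    by move: wr r0; rewrite w0 cabs0 => ->; rewrite ltxx.
  rewrite cabsM cabsV wr ler_pM2r ?invr_gt0// (le_trans (cabsB _ _))//.
  by have := gM w; have := gM 0 c0r; rewrite wr => ? /(_ (lexx _)); lra.
Qed.

Lemma complex_cauchy (F : set_system R[i]^o) : ProperFilter F ->
  (forall e : R, 0 < e -> exists z : R[i], F [set w | cabs (w - z) < e]) ->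
  exists l : R[i]^o, F --> l.
Proof.
move=> FF Fc.
have part (p : R[i] -> R) : (forall z w, `|p z - p w| <= cabs (w - z)) ->
    exists a : R, p @ F --> a.
  move=> plip; apply/cvg_ex; apply: cauchy_cvg; apply: cauchy_exP => e e0.
  have [z zP] := Fc e e0; exists (p z).
  apply: (filterS _ zP : F [set w | `|p z - p w| < e]) => w.
  exact: le_lt_trans (plip z w).
have [|a aP] := part (@complex.Re R).
  move=> z w; rewrite distrC; apply: le_trans (Re_le_cabs (w - z)).
  by case: (z) (w) => ? ? [? ?].
have [|b bP] := part (@complex.Im R).
  move=> z w; rewrite distrC; apply: le_trans (Im_le_cabs (w - z)).
  by case: (z) (w) => ? ? [? ?].
exists (Complex a b); apply/cvg_rnormP => e e0.
have e2 : 0 < e / 2 by rewrite divr_gt0.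
move/cvgrPdist_lt : aP => /(_ _ e2) aP; move/cvgrPdist_lt : bP => /(_ _ e2) bP.
apply: filterS2 aP bP => w wa wb; apply: (le_lt_trans (cabs_le_ReIm (w - Complex a b))).
move: wa wb; rewrite (distrC a) (distrC b).
by case: w => ? ? /=; lra.
Qed.

(** Slopes of precision [en n] and [en m], compared on one common small increment, differ by at most
    [en n + en m]. They are thus Cauchy, and their limit is the derivative. *)
Lemma cdiff_approx g z : (forall e : R, 0 < e -> exists d : R[i], exists2 dl : R, 0 < dl &
    forall u, cabs u < dl -> cabs (g (z + u) - g z - d * u) <= e * cabs u) ->
  cdiff g z.
Proof.
move=> gP; pose en (n : nat) : R := n.+1%:R^-1.
have en0 n : 0 < en n by rewrite invr_gt0 ltr0n.
have /choice[d dP] : forall n, exists d : R[i], exists2 dl : R, 0 < dl &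
    forall u, cabs u < dl -> cabs (g (z + u) - g z - d * u) <= en n * cabs u.
  by move=> n; exact: gP.
have dd n m : cabs (d n - d m) <= en n + en m.
  have [dl dl0 dlP] := dP n; have [dl' dl'0 dl'P] := dP m.
  pose t : R := Num.min dl dl' / 2; have t0 : 0 < t by rewrite divr_gt0// lt_min dl0.
  have [tdl tdl'] : t < dl /\ t < dl'.
    have : Num.min dl dl' <= dl by rewrite ge_min lexx.
    have : Num.min dl dl' <= dl' by rewrite ge_min lexx orbT.
    by rewrite /t; split; lra.
  have ct : cabs t%:C%C = t by rewrite cabsR ger0_norm// ltW.
  have := dlP t%:C%C; have := dl'P t%:C%C; rewrite ct => /(_ tdl') h' /(_ tdl) h.
  rewrite -(@ler_pM2r _ t)// -{1}ct -cabsM.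
  rewrite (_ : _ * _ = (g (z + t%:C%C) - g z - d m * t%:C%C) -
     (g (z + t%:C%C) - g z - d n * t%:C%C)); last by ring.
  by rewrite (le_trans (cabsB _ _))// mulrDl addrC lerD.
have ensmall e : 0 < e -> exists N, forall n, (N <= n)%N -> en n < e.
  move=> e0; have := @near_infty_natSinv_lt R (PosNum e0).
  by move=> [N _ NP]; exists N => n Nn; exact: NP.
have [|l dl] := @complex_cauchy ((d : nat -> R[i]^o) @ \oo).
  move=> e e0; have [|N NP] := ensmall (e / 2); first by rewrite divr_gt0.
  exists (d N); exists N => // n /= Nn; rewrite (le_lt_trans (dd _ _))//.
  by have := NP n Nn; have := NP N (leqnn N); lra.
exists l => e e0; have [|N NP] := ensmall (e / 4); first by rewrite divr_gt0.
have e4 : 0 < e / 4 by rewrite divr_gt0.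
move/cvg_rnormP : dl => /(_ _ e4) [N' _ N'P].
pose n := maxn N N'.
have dnl : cabs (d n - l) < e / 4 by apply: N'P; rewrite /= leq_maxr.
have nN : en n < e / 4 by apply: NP; rewrite leq_maxl.
have [dl dl0 dlP] := dP n; exists dl => // u /dlP h.
rewrite (_ : _ - _ - _ = g (z + u) - g z - d n * u + (d n - l) * u); last by ring.
rewrite (le_trans (cabsD _ _))// cabsM.
have u0 := cabs_ge0 u.
have : en n * cabs u <= e / 4 * cabs u by rewrite ler_wpM2r// ltW.
have : cabs (d n - l) * cabs u <= e / 4 * cabs u by rewrite ler_wpM2r// ltW.
have : 0 <= e * cabs u by rewrite mulr_ge0// ltW.
by move: h; lra.
Qed.

Lemma cdiff_uniform_limit g r : 0 < r ->
  (forall e : R, 0 < e -> exists2 h, forall z, cabs z <= r -> cdiff h z &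
    forall z, cabs z <= r -> cabs (h z - g z) <= e) ->
  cdiff g 0.
Proof.
move=> r0 gP; apply: cdiff_approx => e e0.
(* Then [2 * e1 / r] is [e / 2]; the other half of [e] goes to the differentiability of [h] at 0. *)
pose e1 : R := e * r / 4; have e10 : 0 < e1 by rewrite divr_gt0// mulr_gt0.
have [h hd hg] := gP _ e10.
have c0r : cabs (0 : R[i]) <= r by rewrite cabs0 ltW.
have close u : cabs u <= r -> cabs ((h u - h 0) - (g u - g 0)) <= 2 * e1 / r * cabs u.
  (* [g] is not yet known to be differentiable, so the Schwarz lemma is applied to [h - k], where
     [k] is a second and arbitrarily better approximant of [g]. *)
  move=> ur; apply/ler_addgt0Pr => e2 e20.
  pose e3 : R := e2 / 4; have e30 : 0 < e3 by rewrite divr_gt0.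
  have [k kd kg] := gP _ e30.
  have hk w : cabs w <= r -> cabs (1 * h w + (-1) * k w) <= e1 + e3.
    move=> wr; rewrite (_ : _ + _ = (h w - g w) - (k w - g w)); last by ring.
    by rewrite (le_trans (cabsB _ _))// lerD ?hg ?kg.
  have hkd w : cabs w <= r -> cdiff (fun w => 1 * h w + (-1) * k w) w.
    by move=> wr; apply: cdiff_comb; [exact: hd|exact: kd].
  have := schwarz r0 hkd hk ur.
  rewrite (_ : _ - _ = (h u - h 0) - (k u - k 0)); last by ring.
  move=> S; rewrite (_ : _ - _ =
    ((h u - h 0) - (k u - k 0)) + ((k u - g u) - (k 0 - g 0))); last by ring.
  rewrite (le_trans (cabsD _ _))// (le_trans (lerD S (cabsB _ _)))//.
  have := kg u ur; have := kg 0 c0r.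
  have -> : 2 * (e1 + e3) / r * cabs u = 2 * e1 / r * cabs u + 2 * e3 * (cabs u / r) by ring.
  have : 2 * e3 * (cabs u / r) <= 2 * e3 * 1.
    apply: ler_wpM2l; first by rewrite mulr_ge0// ltW.
    by rewrite ler_pdivrMr// mul1r.
  by rewrite /e3; lra.
have [d hdP] := hd 0 c0r; have e2 : 0 < e / 2 by rewrite divr_gt0.
have [dl dl0 dlP] := hdP _ e2.
exists d; exists (Num.min dl r) => [|u]; first by rewrite lt_min dl0.
rewrite lt_min => /andP[/dlP + ur]; rewrite !add0r => hu.
rewrite (_ : _ - _ - _ = (h u - h 0 - d * u) - ((h u - h 0) - (g u - g 0))); last by ring.
rewrite (le_trans (cabsB _ _))// (le_trans (lerD hu (close _ (ltW ur))))//.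
by rewrite le_eqVlt; apply/orP; left; apply/eqP; rewrite /e1; field; rewrite gt_eqF.
Qed.

Lemma derivable_cdiff (f : R[i]^o -> R[i]^o) (z : R[i]) :
  derivable f z 1 <-> cdiff f z.
Proof.
split.
  move=> /cvg_ex[d fd]; exists d => e e0.
  move/cvg_rnormP : fd => /(_ _ e0) /nbhs_rnormP[dl dl0 dlP]; exists dl => // u udl.
  have [->|u0] := eqVneq u 0; first by rewrite addr0 mulr0 !subrr cabs0 mulr0.
  have := dlP u; rewrite subr0 => /(_ udl u0); rewrite /= -/(cabs _) => h.
  rewrite (_ : _ - _ - _ = (u^-1 *: (f (u *: 1 + z) - f z) - d) * u).
    by rewrite cabsM ler_wpM2r ?cabs_ge0// ltW.
  by rewrite /GRing.scale /= mulr1 (addrC u); field.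
move=> [d fd]; apply/cvg_ex; exists d; apply/cvg_rnormP => e e0.
have e2 : 0 < e / 2 by rewrite divr_gt0.
have [dl dl0 dlP] := fd _ e2; apply/nbhs_rnormP; exists dl => // u.
rewrite subr0 => udl u0; have := dlP u udl => h.
rewrite /= -/(cabs _) (_ : _ - _ = (f (z + u) - f z - d * u) / u); last first.
  by rewrite /GRing.scale /= mulr1 (addrC u); field.
rewrite cabsM cabsV ltr_pdivrMr ?cabs_gt0//; apply: le_lt_trans h _.
by rewrite ltr_pM2r ?cabs_gt0//; lra.
Qed.

End MaximumModulus.

(** * Hahn-Banach and uniform boundedness *)

Section HahnBanach.
Context {R : realType} {E : normedModType R[i]}.
Implicit Types (p q : E -> R) (x y : E).

Definition sublinear p := (forall x y, p (x + y) <= p x + p y) /\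
  (forall (t : R) x, 0 < t -> p (t%:C%C *: x) = t * p x).

Lemma sublinear0 p : sublinear p -> p 0 = 0.
Proof.
by move=> [_ /(_ 2 0 (ltr0n R 2))]; rewrite scaler0; lra.
Qed.

Lemma sublinearN_ge p x : sublinear p -> - p (- x) <= p x.
Proof.
by move=> sp; have := sp.1 x (- x); rewrite subrr sublinear0//; lra.
Qed.

Lemma rnorm_sublinear : sublinear (@rnorm R E).
Proof.
split=> [|t x t0]; first exact: rnormD.
by rewrite rnormZ cabsR ger0_norm// ltW.
Qed.

(* The largest sublinear q <= p with q (- a) = - p a. *)
Definition tilt p (a x : E) : R :=
  inf [set p (x + t%:C%C *: a) - t * p a | t in [set t : R | 0 <= t]].

Lemma tilt_lb p a x t : sublinear p -> 0 <= t ->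
  - p (- x) <= p (x + t%:C%C *: a) - t * p a.
Proof.
move=> sp; rewrite le_eqVlt => /predU1P[<-|t0].
  by rewrite scale0r addr0 mul0r subr0 sublinearN_ge.
have := sp.1 (x + t%:C%C *: a) (- x).
by rewrite addrAC subrr add0r sp.2//; lra.
Qed.

Lemma tilt_le p a x t : sublinear p -> 0 <= t ->
  tilt p a x <= p (x + t%:C%C *: a) - t * p a.
Proof.
move=> sp t0; apply: ge_inf; last by exists t.
by exists (- p (- x)) => _ [s /= s0 <-]; exact: tilt_lb.
Qed.

Lemma tilt_le_id p a x : sublinear p -> tilt p a x <= p x.
Proof.
by move=> sp; have := @tilt_le p a x 0 sp (lexx _); rewrite scale0r addr0 mul0r subr0.
Qed.

Lemma le_tilt p a x (c : R) :
  (forall t : R, 0 <= t -> c <= p (x + t%:C%C *: a) - t * p a) -> c <= tilt p a x.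
Proof.
move=> h; apply: lb_le_inf => [|_ [t /= t0 <-]]; last exact: h.
by exists (p (x + 0%:C%C *: a) - 0 * p a); exists 0 => /=.
Qed.

Lemma tilt_sublinear p a : sublinear p -> sublinear (tilt p a).
Proof.
move=> sp; split=> [x y|t x t0].
  rewrite -lerBlDr; apply: le_tilt => t t0; rewrite lerBlDr [leRHS]addrC -lerBlDr.
  apply: le_tilt => s s0; rewrite lerBlDr.
  apply: le_trans (@tilt_le p a _ (s + t) sp (addr_ge0 s0 t0)) _.
  rewrite rmorphD scalerDl addrACA mulrDl.
  have := sp.1 (x + t%:C%C *: a) (y + s%:C%C *: a).
  by rewrite (addrACA x) (addrC (s%:C%C *: a)) addrACA; lra.
have half (u : R) z : 0 < u -> tilt p a (u%:C%C *: z) <= u * tilt p a z.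
  move=> u0; rewrite -ler_pdivrMl//; apply: le_tilt => s s0.
  rewrite ler_pdivrMl// mulrBr -(sp.2 u)// scalerDr scalerA -rmorphM mulrA.
  by apply: tilt_le => //; rewrite mulr_ge0// ltW.
apply/eqP; rewrite eq_le half//=.
have := half t^-1 (t%:C%C *: x); rewrite invr_gt0 => /(_ t0).
by rewrite scalerA -rmorphM mulVf ?gt_eqF// scale1r ler_pdivlMl.
Qed.

(** Zorn's lemma gives a minimal sublinear [q] below [p]. Minimality forces [tilt q y = q], and the
    parameter [t = 1] in the infimum gives [q x <= q (x + y) - q y], the missing half of
    additivity. *)
Lemma exists_linear_minorant p : sublinear p -> exists q,
  [/\ sublinear q, forall x, q x <= p x & forall x y, q (x + y) = q x + q y].
Proof.
move=> sp.
pose T := {q : E -> R | sublinear q /\ forall x, q x <= p x}.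
(* The order is reversed, so that a maximal element for [rel] is a minimal functional. *)
pose rel (s t : T) := `[< forall x, sval t x <= sval s x >].
have [|r s t|s t|A Atot|[q [sq qp]] qmin] := @Zorn T rel.
- by move=> t; apply/asboolP.
- by move=> /asboolP rs /asboolP st; apply/asboolP => x; exact: le_trans (st x) (rs x).
- case: s t => [s ps] [t pt] /asboolP st /asboolP ts.
  apply: eq_exist; apply/funext => x.
  by apply/eqP; rewrite eq_le st ts.
- have [[s0 As0]|nA] := pselect (exists s, A s); last first.
    have pT : sublinear p /\ forall x, p x <= p x by [].
    by exists (exist _ p pT) => s As; case: nA; exists s.
  pose q x := inf [set sval s x | s in A].
  have qlb x : has_lbound [set sval s x | s in A].
    exists (- p (- x)) => _ [[s [ss sp']] _ <-] /=.
    by rewrite (le_trans _ (sublinearN_ge x ss))// lerN2.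
  have qle s x : A s -> q x <= sval s x.
    by move=> As; apply: ge_inf; [exact: qlb|exists s].
  have leq' x (c : R) : (forall s, A s -> c <= sval s x) -> c <= q x.
    move=> h; apply: lb_le_inf => [|_ [s As <-]]; last exact: h.
    by exists (sval s0 x); exists s0.
  have sq : sublinear q.
    split=> [x y|t x t0].
      rewrite -lerBlDr; apply: (leq' _) => s1 As1; rewrite lerBlDr [leRHS]addrC -lerBlDr.
      apply: (leq' _) => s2 As2; rewrite lerBlDr.
      have : exists s, [/\ A s, sval s x <= sval s1 x & sval s y <= sval s2 y].
        have [/asboolP h|/asboolP h] := Atot s1 s2 As1 As2.
          by exists s2; split.
        by exists s1; split.
      move=> [s [As sx sy]]; apply: le_trans (qle s (x + y) As) _.
      by have := (svalP s).1.1 x y; lra.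
    have half (u : R) z : 0 < u -> q (u%:C%C *: z) <= u * q z.
      move=> u0; rewrite -ler_pdivrMl//; apply: (leq' _) => s As.
      by rewrite ler_pdivrMl// -(svalP s).1.2//; exact: qle.
    apply/eqP; rewrite eq_le half//=.
    have := half t^-1 (t%:C%C *: x); rewrite invr_gt0 => /(_ t0).
    by rewrite scalerA -rmorphM mulVf ?gt_eqF// scale1r ler_pdivlMl.
  have qp x : q x <= p x by apply: le_trans (qle s0 x As0) _; exact: (svalP s0).2.
  have qT : sublinear q /\ forall x, q x <= p x by [].
  by exists (exist _ q qT) => s As; apply/asboolP => x; exact: qle.
exists q; split => // x y; apply/eqP; rewrite eq_le sq.1 /=.
have tT : sublinear (tilt q y) /\ forall x, tilt q y x <= p x.
  by split=> [|z]; [exact: tilt_sublinear|exact: le_trans (tilt_le_id _ _ sq) (qp z)].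
have := qmin (exist _ _ tT).
have -> : rel (exist _ q (conj sq qp)) (exist _ _ tT).
  by apply/asboolP => z /=; exact: tilt_le_id.
move=> /(_ isT) /(congr1 sval) /= tq.
have := @tilt_le q y x 1 sq ler01; rewrite tq scale1r mul1r.
by lra.
Qed.

Lemma cdual_of_bound (f : E -> R[i]) (B : R) : linear (f : E -> R[i]^o) ->
  (forall x, cabs (f x) <= B * rnorm x) -> (f : E -> R[i]^o) \in @cdual_pred R E.
Proof.
move=> fl fB; apply/mem_set; split => // x; apply/cvg_rnormP => e e0.
have B1 : 0 < `|B| + 1 by rewrite ltr_wpDl.
have : nbhs x [set y | rnorm (y - x) < e / (`|B| + 1)].
  by apply/nbhs_rnormP; exists (e / (`|B| + 1)) => //; rewrite divr_gt0.
apply: filterS => y; rewrite /= ltr_pdivlMr// => yx.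
have -> : f y - f x = f (y - x).
  by have := fl (-1) x y; rewrite !scaleN1r (addrC (- x)) => ->; rewrite addrC.
apply: le_lt_trans (fB _) _; apply: le_lt_trans yx; rewrite mulrC.
by rewrite ler_wpM2l ?rnorm_ge0//; have := ler_norm B; lra.
Qed.

Lemma hahn_banach_norming x0 : exists2 e : cdual E, val e x0 = (rnorm x0)%:C%C &
  forall x, cabs (val e x) <= rnorm x.
Proof.
(* Starting from the tilted norm forces [q (- x0) <= - rnorm x0], which makes [q] norming at
   [x0]. *)
have [q [sq qp qD]] := exists_linear_minorant (tilt_sublinear x0 rnorm_sublinear).
have qle x : q x <= rnorm x by apply: le_trans (qp x) (tilt_le_id _ _ rnorm_sublinear).
have qN x : q (- x) = - q x.
  by have := qD x (- x); rewrite subrr sublinear0//; lra.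
have qx0 : rnorm x0 <= q x0.
  have := @tilt_le (@rnorm R E) x0 (- x0) 1 rnorm_sublinear ler01.
  rewrite scale1r addNr rnorm0 mul1r => h.
  by have := qp (- x0); rewrite qN; lra.
have qZ (t : R) x : q (t%:C%C *: x) = t * q x.
  have [t0|t0|->] := ltgtP t 0; last by rewrite scale0r sublinear0// mul0r.
    rewrite -[t]opprK rmorphN scaleNr qN sq.2 ?oppr_gt0//.
    by ring.
  exact: sq.2.
(* The complex-linear functional whose real part is [q]. *)
pose f x : R[i] := Complex (q x) (- q ('i%C *: x)).
have fD x y : f (x + y) = f x + f y.
  by rewrite /f scalerDr !qD; apply/eqP; rewrite eq_complex /= opprD !eqxx.
have fZ a x : f (a *: x) = a * f x.
  case: a => a b; have E1 : Complex a b = a%:C%C + b%:C%C * 'i%C :> R[i].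
    by apply/eqP; rewrite eq_complex /=; apply/andP; split; apply/eqP; ring.
  rewrite E1 /f; have -> : 'i%C *: ((a%:C%C + b%:C%C * 'i%C) *: x) =
      a%:C%C *: ('i%C *: x) - b%:C%C *: x.
    rewrite !scalerDl scalerDr !scalerA -scaleNr; congr (_ *: x + _ *: x).
      by rewrite mulrC.
    by apply/eqP; rewrite eq_complex /=; apply/andP; split; apply/eqP; ring.
  rewrite scalerDl -scalerA !qD qN !qZ.
  by apply/eqP; rewrite eq_complex /=; apply/andP; split; apply/eqP; ring.
have fle x : cabs (f x) <= 1 * rnorm x.
  rewrite mul1r; have [->|fx0] := eqVneq (f x) 0; first by rewrite cabs0 rnorm_ge0.
  have c0 : 0 < cabs (f x) by rewrite cabs_gt0.
  pose c : R[i] := (f x)^*%C * ((cabs (f x))^-1)%:C%C.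
  have cE : cabs c = 1.
    by rewrite /c cabsM cabs_conj cabsR ger0_norm ?invr_ge0 ?ltW// divff// gt_eqF.
  have : f (c *: x) = (cabs (f x))%:C%C.
    rewrite fZ /c mulrAC conj_mul_cabs -rmorphM /= expr2 -mulrA divff ?mulr1//.
    by rewrite gt_eqF.
  move=> /(congr1 (@complex.Re R)) /= <-.
  by rewrite (le_trans (qle _))// rnormZ cE mul1r.
have fl : linear (f : E -> R[i]^o) by move=> a x y; rewrite fD fZ.
exists (exist _ (f : E -> R[i]^o) (cdual_of_bound fl fle)) => /= [|x]; last first.
  by have := fle x; rewrite mul1r.
have qx0E : q x0 = rnorm x0 by apply/eqP; rewrite eq_le qle.
have := fle x0; rewrite mul1r -(@ler_pXn2r _ 2)// ?nnegrE ?cabs_ge0 ?rnorm_ge0//.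
rewrite sqr_cabs /f /= qx0E gerDl => h.
have : - q ('i%C *: x0) == 0 by rewrite -sqrf_eq0 eq_le h sqr_ge0.
by move=> /eqP ->.
Qed.

Lemma rnorm_le_dual x (M : R) :
  (forall e : cdual E, (forall y, cabs (val e y) <= rnorm y) -> cabs (val e x) <= M) ->
  rnorm x <= M.
Proof.
have [e ex e1] := hahn_banach_norming x => /(_ e e1).
by rewrite ex cabsR ger0_norm// rnorm_ge0.
Qed.

Lemma cdual_linear (e : cdual E) : linear (val e).
Proof. by have [] := set_mem (valP e). Qed.

Lemma cdual_continuous (e : cdual E) : continuous (val e).
Proof. by have [] := set_mem (valP e). Qed.

End HahnBanach.

Section UniformBoundedness.
Context {R : realType} {E : normedModType R[i]}.

(* A gliding hump: if the bound fails, points x n of S and norming functionals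
   f n give a functional, a sum of some of the 4^-n f n, unbounded on S. *)
Lemma weakly_bounded_bounded (S : set E) :
  (forall e : cdual E, exists M : R, forall x, S x -> cabs (val e x) <= M) ->
  exists M : R, forall x, S x -> rnorm x <= M.
Proof.
move=> wb; apply: contrapT => nb.
pose q n : R := 4 ^- n.
have q0 n : 0 < q n by rewrite invr_gt0 exprn_gt0.
have qS n : q n = 4 * q n.+1 by rewrite /q exprS invfM mulrA divff ?mul1r// pnatr_eq0.
(* At [x n] the partial sum [s n.+1] is at least half of [q n * rnorm (x n)] and the later terms
   amount to at most a third of it; [1 / 2 - 1 / 3 = 1 / 6] explains the 6. *)
have /choice[x xP] : forall n : nat, exists x, S x /\ 6 * n%:R / q n < rnorm x.
  move=> n; apply: contrapT => h; apply: nb; exists (6 * n%:R / q n) => x Sx.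
  by rewrite leNgt; apply/negP => ?; apply: h; exists x.
have /choice[f fP] : forall n : nat, exists f : cdual E,
    val f (x n) = (rnorm (x n))%:C%C /\ forall y, cabs (val f y) <= rnorm y.
  by move=> n; have [f f1 f2] := hahn_banach_norming (x n); exists f.
(* A term is added only when the sum so far is small at [x k]; in both cases the new sum is at least
   [q k * rnorm (x k) / 2] there. *)
pose s := fix s n : E -> R[i] := if n is k.+1 then
  (if q k * rnorm (x k) / 2 <= cabs (s k (x k)) then s k
   else fun y => s k y + (q k)%:C%C * val (f k) y) else fun=> 0.
have sl n a y z : s n (a *: y + z) = a * s n y + s n z.
  elim: n => [|n IH] /=; first by rewrite mulr0 addr0.
  case: ifP => _; rewrite IH// (cdual_linear (f n)) /GRing.scale /=.
  by ring.
have step n y : cabs (s n.+1 y - s n y) <= q n * rnorm y.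
  rewrite /=; case: ifP => _.
    by rewrite subrr cabs0 mulr_ge0 ?rnorm_ge0// ltW.
  rewrite addrC addKr cabsM cabsR ger0_norm ?(ltW (q0 n))//.
  by apply: ler_wpM2l; [exact: ltW|exact: (fP n).2].
have hump n : q n * rnorm (x n) / 2 <= cabs (s n.+1 (x n)).
  rewrite /=; case: ifPn => //; rewrite -ltNge => lt.
  rewrite (fP n).1 -rmorphM /= addrC.
  have := cabsB ((q n * rnorm (x n))%:C%C + s n (x n)) (s n (x n)).
  rewrite addrK cabsR ger0_norm; last by rewrite mulr_ge0 ?rnorm_ge0// ltW.
  by lra.
have tail n k y : cabs (s (n + k)%N y - s n y) <= (4 * q n - 4 * q (n + k)%N) / 3 * rnorm y.
  elim: k => [|k IH]; first by rewrite addn0 !subrr cabs0 mul0r mul0r.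
  rewrite (le_trans (cdistD (s (n + k)%N y) _ _))// addnS.
  rewrite (le_trans (lerD (step _ _) IH))// -mulrDl ler_wpM2r ?rnorm_ge0//.
  by have := qS (n + k)%N; lra.
have tail' n m y : (n <= m)%N -> cabs (s m y - s n y) <= 2 * q n * rnorm y.
  move=> /subnKC <-; rewrite (le_trans (tail _ _ _))// ler_wpM2r ?rnorm_ge0//.
  by have := q0 (n + (m - n))%N; have := q0 n; lra.
have qsmall (B e : R) : 0 <= B -> 0 < e -> exists n, q n * B < e.
  move=> B0 e0; pose n := (Num.truncn (B / e)).+1; exists n.
  rewrite mulrC ltr_pdivrMr ?exprn_gt0// mulrC -ltr_pdivrMr//.
  apply: (@lt_le_trans _ _ n%:R); first by rewrite truncnS_gt.
  by rewrite -natrX ler_nat ltnW// ltn_expl.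
have /choice[e eP] : forall y, exists l : R[i], forall n,
    cabs (l - s n y) <= 4 / 3 * q n * rnorm y.
  move=> y; have [|l ls] := @complex_cauchy R ((fun n => s n y : R[i]^o) @ \oo).
    move=> e e0; have [|N NP] := @qsmall (2 * rnorm y) e _ e0.
      by rewrite mulr_ge0// rnorm_ge0.
    exists (s N y); exists N => // n /= Nn; apply: le_lt_trans (tail' _ _ _ Nn) _.
    by rewrite mulrAC mulrC.
  exists l => n; apply/ler_addgt0Pr => e e0.
  move/cvg_rnormP : ls => /(_ _ e0) [N _ NP].
  have := NP (n + N)%N; rewrite /= leq_addl => /(_ isT).
  rewrite -/(cabs _) cdistC => h.
  rewrite (le_trans (cdistD (s (n + N)%N y) _ _))// addrC lerD// ?(ltW h)//.
  rewrite (le_trans (tail _ _ _))// ler_wpM2r ?rnorm_ge0//.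
  by have := q0 (n + N)%N; lra.
have el : linear (e : E -> R[i]^o).
  move=> a y z; apply/eqP; rewrite -subr_eq0 -cabs_eq0 eq_le cabs_ge0 andbT.
  apply/ler_addgt0Pr => c c0; rewrite add0r.
  pose B := 4 / 3 * (rnorm (a *: y + z) + cabs a * rnorm y + rnorm z).
  have [|n nc] := @qsmall B c _ c0.
    by rewrite mulr_ge0 ?addr_ge0 ?mulr_ge0 ?rnorm_ge0 ?cabs_ge0.
  apply: le_trans (ltW nc).
  rewrite (_ : _ - _ = (e (a *: y + z) - s n (a *: y + z)) -
    (a * (e y - s n y) + (e z - s n z))); last by rewrite sl /GRing.scale /=; ring.
  rewrite (le_trans (cabsB _ _))// (le_trans (lerD (eP _ n) (cabsD _ _)))//.
  rewrite cabsM; have := ler_wpM2l (cabs_ge0 a) (eP y n); have := eP z n.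
  by rewrite /B; lra.
have eB y : cabs (e y) <= 4 / 3 * rnorm y.
  by have := eP y 0%N; rewrite /= subr0 /q expr0 invr1 mulr1.
have [M MP] := wb (exist _ (e : E -> R[i]^o) (cdual_of_bound el eB)).
pose n := (Num.truncn M).+1.
have Mn : M < n%:R by rewrite truncnS_gt.
have := MP (x n) (xP n).1; rewrite /=; apply/negP; rewrite -ltNge.
apply: lt_le_trans Mn _.
have := cdistD (e (x n)) (s n.+1 (x n)) 0; rewrite !subr0 cdistC => h.
have h1 := hump n; have h2 := eP (x n) n.+1.
have := (xP n).2; rewrite ltr_pdivrMr// => h3.
have := qS n; move: h h1 h2 h3; set r := rnorm (x n) => h h1 h2 h3 h4.
rewrite h4 in h1 h3; lra.
Qed.

End UniformBoundedness.

(** * Topologies generated by seminorms *)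

Section SeminormTopology.
Context {R : realType} {Y : lmodType R[i]}.
Implicit Types (p q : Y -> R) (Q : set (Y -> R)) (T : Topological Y) (x y : Y).

Lemma seminorm0 q : is_seminorm q -> q 0 = 0.
Proof. by move=> [_ /(_ 0 0)]; rewrite scaler0 rnorm0 mul0r. Qed.

Lemma seminormZ q (a : R[i]) x : is_seminorm q -> q (a *: x) = cabs a * q x.
Proof. by move=> [_ ->]. Qed.

Lemma seminormN q x : is_seminorm q -> q (- x) = q x.
Proof. by move=> sq; rewrite -scaleN1r seminormZ// cabsN cabs1 mul1r. Qed.

Lemma seminorm_ge0 q x : is_seminorm q -> 0 <= q x.
Proof.
by move=> sq; have := sq.1 x (- x); rewrite subrr seminorm0// seminormN//; lra.
Qed.

Lemma seminormB q x y : is_seminorm q -> q (x - y) = q (y - x).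
Proof. by move=> sq; rewrite -opprB seminormN. Qed.

Lemma seminorm_dist q y x z : is_seminorm q -> q (x - z) <= q (x - y) + q (y - z).
Proof. by move=> sq; have := sq.1 (x - y) (y - z); rewrite addrA subrK. Qed.

Lemma seminorm_subD q x y : is_seminorm q -> q x <= q (x - y) + q y.
Proof. by move=> sq; have := sq.1 (x - y) y; rewrite subrK. Qed.

Lemma seminormD p q : is_seminorm p -> is_seminorm q -> is_seminorm (fun y => p y + q y).
Proof.
move=> sp sq; split=> [x y|a x]; last by rewrite !seminormZ// mulrDr.
by have := sp.1 x y; have := sq.1 x y; lra.
Qed.

Lemma seminormM (c : R) p : 0 <= c -> is_seminorm p -> is_seminorm (fun y => c * p y).
Proof.
move=> c0 sp; split=> [x y|a x]; last by rewrite seminormZ// mulrCA.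
by rewrite -mulrDr ler_wpM2l// sp.1.
Qed.

Lemma nbhs_opens T x (A : set Y) : nbhs (x : Topological.Pack T) A <->
  exists U, [/\ opens T U, U x & U `<=` A].
Proof.
rewrite (@nbhsE (Topological.Pack T)); split=> [[U [oU Ux] UA]|[U [oU Ux UA]]].
  by exists U.
by exists U.
Qed.

Lemma eq_opens_nbhs T T' x (A : set Y) : opens T = opens T' ->
  nbhs (x : Topological.Pack T) A <-> nbhs (x : Topological.Pack T') A.
Proof. by move=> e; rewrite !nbhs_opens e. Qed.

Lemma opens_bigcup T (S : set (set Y)) : S `<=` opens T -> opens T (\bigcup_(U in S) U).
Proof. by move=> ST; apply: (@bigcup_open (Topological.Pack T)). Qed.

Lemma linear_topologyP T : linear_topology T <->
  (forall x y (A : set Y), nbhs (x + y : Topological.Pack T) A -> exists B C : set Y,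
    [/\ nbhs (x : Topological.Pack T) B, nbhs (y : Topological.Pack T) C &
      forall u w, B u -> C w -> A (u + w)]) /\
  (forall (a : R[i]) x (A : set Y), nbhs (a *: x : Topological.Pack T) A ->
    exists (e : R) (B : set Y), [/\ 0 < e, nbhs (x : Topological.Pack T) B &
      forall b u, cabs (b - a) < e -> B u -> A (b *: u)]).
Proof.
split=> [[Tadd Tscl]|[Tadd Tscl]]; split.
- move=> x y A xyA; have [[B C] /= [xB yC] BCA] := Tadd (x, y) A xyA.
  by exists B, C; split => // u w Bu Cw; exact: (BCA (u, w)).
- move=> a x A axA; have [[B C] /= [/nbhs_rnormP[e e0 eB] xC] BCA] := Tscl (a, x) A axA.
  by exists e, C; split => // b u be Cu; apply: (BCA (b, u)); split => //; exact: eB.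
- move=> [x y] A /Tadd[B [C [xB yC BCA]]]; exists (B, C) => //.
  by move=> [u w] [/= Bu Cw]; exact: BCA.
- move=> [a x] A /Tscl[e [B [e0 xB BA]]]; exists ([set b | cabs (b - a) < e], B).
    by split => //; apply/nbhs_rnormP; exists e.
  by move=> [b u] [/= be Bu]; exact: BA.
Qed.

Lemma eq_opens_linear T T' : opens T = opens T' -> linear_topology T -> linear_topology T'.
Proof.
move=> e /linear_topologyP[Tadd Tscl]; apply/linear_topologyP; split.
  move=> x y A /(eq_opens_nbhs _ _ e) /Tadd[B [C [xB yC BCA]]].
  by exists B, C; split => //; apply/(eq_opens_nbhs _ _ e).
move=> a x A /(eq_opens_nbhs _ _ e) /Tscl[d [B [d0 xB BA]]].
by exists d, B; split => //; apply/(eq_opens_nbhs _ _ e).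
Qed.

Lemma semiball_open Q q x (e : R) : Q q -> 0 < e ->
  opens (gen_by Q) [set y | q (y - x) < e].
Proof.
move=> Qq e0; exists [set [set y | q (y - x) < e]]; last by rewrite bigcup_set1.
move=> _ ->; exists [fset [set y | q (y - x) < e]]%fset.
  by move=> W; rewrite in_fset1 => /eqP ->; rewrite inE; exists q, x, e.
by rewrite set_fset1 bigcap_set1.
Qed.

Lemma gen_by_open Q (U : set Y) : (forall q, Q q -> is_seminorm q) ->
  (forall x, U x -> exists2 q, Q q & exists2 e : R, 0 < e &
    [set y | q (y - x) < e] `<=` U) -> opens (gen_by Q) U.
Proof.
move=> sQ Uq.
have -> : U = \bigcup_(W in [set W | opens (gen_by Q) W /\ W `<=` U]) W.
  rewrite eqEsubset; split=> [x Ux|x [W [_ WU]] /WU//].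
  have [q Qq [e e0 eU]] := Uq x Ux; exists [set y | q (y - x) < e].
    by split => //; exact: semiball_open.
  by rewrite /= subrr seminorm0//; exact: sQ.
by apply: opens_bigcup => W [].
Qed.

Lemma gen_by_min Q T : (forall q x (e : R), Q q -> 0 < e ->
  opens T [set y | q (y - x) < e]) -> opens (gen_by Q) `<=` opens T.
Proof.
move=> QT _ [B sB <-]; apply: opens_bigcup => _ /sB [D sD <-].
apply/opensP => x xD; apply: filter_bigI => E DE.
have /sD := DE; rewrite inE => -[q [z [e [Qq e0 EE]]]].
apply/nbhs_opens; exists E; split => //; last exact: xD.
by rewrite EE; exact: QT.
Qed.

Lemma sub_gen_by Q Q' : Q `<=` Q' -> opens (gen_by Q) `<=` opens (gen_by Q').
Proof. by move=> QQ'; apply: gen_by_min => q x e /QQ'; exact: semiball_open. Qed.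

(** The subbasic semiballs containing [x] may have other centres; the triangle inequality moves the
    centres to [x], and directedness merges finitely many seminorms into one. *)
Lemma nbhs_gen_by Q x (A : set Y) : directed_system Q ->
  (forall q, Q q -> is_seminorm q) ->
  nbhs (x : Topological.Pack (gen_by Q)) A <-> exists2 q, Q q & exists2 e : R, 0 < e &
    [set y | q (y - x) < e] `<=` A.
Proof.
move=> [[q0 Qq0] Qdir] sQ; split; last first.
  move=> [q Qq [e e0 eA]]; apply/nbhs_opens; exists [set y | q (y - x) < e].
  split => //; first exact: semiball_open.
  by rewrite /= subrr seminorm0//; exact: sQ.
move=> /nbhs_opens[_ [[B sB <-] [C BC Cx] BA]].
pose F := filter_from [set qe : (Y -> R) * R | Q qe.1 /\ 0 < qe.2]
  (fun qe => [set y | qe.1 (y - x) < qe.2]).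
have FF : Filter F.
  apply: filter_from_filter; first by exists (q0, 1) => /=.
  move=> [p e] [q d] [/= Qp e0] [/= Qq d0].
  have [r Qr rpq] := Qdir p q Qp Qq.
  exists (r, Num.min e d); first by rewrite /= lt_min e0.
  move=> y /=; rewrite lt_min => /andP[re rd]; have [rp rq] := rpq (y - x).
  by split; [exact: le_lt_trans rp re|exact: le_lt_trans rq rd].
suff [[q e] [/= Qq e0] qeC] : F C.
  by exists q => //; exists e => // y /qeC Cy; apply: BA; exists C.
have [D sD DC] := sB _ BC; rewrite -DC; apply: filter_bigI => E DE.
have /sD := DE; rewrite inE => -[q [z [e [Qq e0 EE]]]].
have : E x by move: Cx; rewrite -DC => /(_ _ DE).
rewrite EE /= => qxz; exists (q, e - q (x - z)) => /=.
  by rewrite subr_gt0.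
by move=> y /=; have := seminorm_dist x y z (sQ q Qq); lra.
Qed.

Lemma gen_by_linear Q : directed_system Q -> (forall q, Q q -> is_seminorm q) ->
  linear_topology (gen_by Q).
Proof.
move=> dQ sQ; apply/linear_topologyP; split=> [x y A|a x A].
  move=> /(nbhs_gen_by _ _ dQ sQ)[q Qq [e e0 eA]].
  have e2 : 0 < e / 2 by rewrite divr_gt0.
  exists [set u | q (u - x) < e / 2], [set u | q (u - y) < e / 2]; split.
  - by apply/(nbhs_gen_by _ _ dQ sQ); exists q => //; exists (e / 2).
  - by apply/(nbhs_gen_by _ _ dQ sQ); exists q => //; exists (e / 2).
  - move=> u w /= ux wy; apply: eA; rewrite /= opprD addrACA.
    by apply: le_lt_trans ((sQ q Qq).1 _ _) _; lra.
move=> /(nbhs_gen_by _ _ dQ sQ)[q Qq [e e0 eA]]; have sq := sQ q Qq.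
pose M : R := 2 * (cabs a + q x + 1).
have M0 : 0 < M by rewrite mulr_gt0// ltr_wpDl// addr_ge0 ?cabs_ge0// seminorm_ge0.
pose d : R := Num.min 1 (e / M).
have d0 : 0 < d by rewrite lt_min ltr01 divr_gt0.
exists d, [set u | q (u - x) < d]; split => //.
  by apply/(nbhs_gen_by _ _ dQ sQ); exists q => //; exists d.
move=> b u ba /= ux; apply: eA => /=.
have -> : b *: u - a *: x = b *: (u - x) + (b - a) *: x.
  by rewrite scalerBr scalerBl addrA subrK.
apply: le_lt_trans (sq.1 _ _) _; rewrite !seminormZ//.
have d1 : d <= 1 by rewrite ge_min lexx.
have dM : d * M <= e by rewrite -ler_pdivlMr// ge_min lexx orbT.
have bb : cabs b <= cabs a + 1.
  by have := cabsD (b - a) a; rewrite subrK; lra.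
have b0 := cabs_ge0 b; have x0 := seminorm_ge0 x sq.
have h1 : cabs b * q (u - x) <= (cabs a + 1) * d.
  by rewrite ler_pM ?seminorm_ge0// ltW.
have h2 : cabs (b - a) * q x <= d * q x by rewrite ler_wpM2r// ltW.
have : 0 < d * (cabs a + q x + 1).
  by rewrite mulr_gt0// ltr_wpDl// addr_ge0 ?cabs_ge0.
by move: dM; rewrite /M; lra.
Qed.

Lemma semiball_convex q x (e : R) : is_seminorm q -> convex_set [set y | q (y - x) < e].
Proof.
move=> sq y z t /set_mem /= yx /set_mem /= zx; apply/mem_set => /=.
have [t0 t1] : 0 <= t%:num /\ t%:num <= 1 by [].
pose s : R := complex.Re t%:num.
have sE : t%:num = s%:C%C by rewrite RRe_real// ger0_real.
have s0 : 0 <= s by rewrite -lecR -sE.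
have s1 : s <= 1 by rewrite -lecR -sE.
have -> : conv t y z - x = s%:C%C *: (y - x) + (1 - s)%:C%C *: (z - x).
  rewrite /conv /= sE rmorphB rmorph1 !scalerBr addrACA; congr (_ + _).
  by rewrite -opprD -scalerDl addrC subrK scale1r.
apply: le_lt_trans (sq.1 _ _) _; rewrite !seminormZ// !cabsR !ger0_norm ?subr_ge0//.
have [s00|] := eqVneq s 0; first by rewrite s00 mul0r subr0 mul1r add0r.
rewrite neq_lt ltNge s0 /= => s0'.
have : s * q (y - x) < s * e by rewrite ltr_pM2l.
have : (1 - s) * q (z - x) <= (1 - s) * e by rewrite ler_wpM2l ?subr_ge0// ltW.
by lra.
Qed.

Lemma gen_by_locally_convex_hausdorff Q T : directed_system Q ->
  (forall q, Q q -> is_seminorm q) -> (forall y, (forall q, Q q -> q y = 0) -> y = 0) ->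
  opens T = opens (gen_by Q) -> locally_convex_hausdorff T.
Proof.
move=> dQ sQ Q0 eT; split.
- by apply: (eq_opens_linear (esym eT)); exact: gen_by_linear.
- exists (semiballs Q).
    by move=> b /set_mem[q [x [e [Qq e0 ->]]]]; apply: semiball_convex; exact: sQ.
  split=> [b [q [x [e [Qq e0 ->]]]]|x A].
    by rewrite -/(opens T) eT; exact: semiball_open.
  move=> /(eq_opens_nbhs _ _ eT) /(nbhs_gen_by _ _ dQ sQ)[q Qq [e e0 eA]].
  exists [set y | q (y - x) < e] => //; split; first by exists q, x, e.
  by rewrite /= subrr seminorm0//; exact: sQ.
- move=> x y xy; apply: (@subr0_eq Y); apply: Q0 => q Qq; have sq := sQ q Qq.
  apply/eqP; rewrite eq_le seminorm_ge0// andbT; apply/ler_addgt0Pr => e e0.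
  have e2 : 0 < e / 2 by rewrite divr_gt0.
  have nb z : nbhs (z : Topological.Pack T) [set y | q (y - z) < e / 2].
    apply/(eq_opens_nbhs _ _ eT)/(nbhs_gen_by _ _ dQ sQ).
    by exists q => //; exists (e / 2).
  have [z [/= zx zy]] := xy _ _ (nb x) (nb y).
  rewrite add0r (le_trans (seminorm_dist z x y sq))// (seminormB x)//.
  by lra.
Qed.

Lemma seminorm_continuous Q T q : Q q -> is_seminorm q -> opens T = opens (gen_by Q) ->
  continuous (q : Topological.Pack T -> R).
Proof.
move=> Qq sq eT x; apply/(@cvgrPdist_lt _ _ _ _ (nbhs_filter (x : Topological.Pack T))).
move=> e e0; apply/(eq_opens_nbhs _ _ eT)/nbhs_opens.
exists [set y | q (y - x) < e]; split; first exact: semiball_open.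
  by rewrite /= subrr seminorm0.
move=> y /=; apply: le_lt_trans; rewrite ler_norml.
have := seminorm_subD x y sq; have := seminorm_subD y x sq; rewrite (seminormB x)//.
by move=> ? ?; apply/andP; split; lra.
Qed.

(** * Minkowski functionals of absolutely convex absorbing sets *)

Section Gauge.
Variable D : set Y.
Hypothesis Dconv : forall (a b : R[i]) x y, cabs a + cabs b <= 1 -> D x -> D y ->
  D (a *: x + b *: y).
Hypothesis Dabs : forall x, exists2 t : R, 0 < t & D (t%:C%C *: x).

Let S x := [set t : R | 0 < t /\ D (t^-1%:C%C *: x)].

Definition gauge x := inf (S x).

Let Dbal (a : R[i]) x : cabs a <= 1 -> D x -> D (a *: x).
Proof.
move=> a1 Dx; rewrite -[_ *: _]addr0 -(scale0r x).
by apply: Dconv => //; rewrite cabs0 addr0.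
Qed.

Let S_neq0 x : S x !=set0.
Proof. by have [t t0 Dt] := Dabs x; exists t^-1; split; rewrite ?invr_gt0// invrK. Qed.

Let S_lb x : has_lbound (S x).
Proof. by exists 0 => t [/ltW]. Qed.

Lemma gauge_le x t : S x t -> gauge x <= t.
Proof. by move=> St; apply: ge_inf. Qed.

Lemma le_gauge x (c : R) : (forall t, S x t -> c <= t) -> c <= gauge x.
Proof. by move=> h; apply: lb_le_inf. Qed.

Lemma gauge_le1 x : D x -> gauge x <= 1.
Proof. by move=> Dx; apply: gauge_le; split => //; rewrite invr1 scale1r. Qed.

Lemma gauge_lt1 x : gauge x < 1 -> D x.
Proof.
move=> /(inf_lt (S_neq0 x))[t [t0 Dt] t1].
have -> : x = t%:C%C *: (t^-1%:C%C *: x).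
  by rewrite scalerA -rmorphM divff ?scale1r// gt_eqF.
by apply: Dbal => //; rewrite cabsR ger0_norm ltW.
Qed.

Lemma gauge_seminorm : is_seminorm gauge.
Proof.
have cpos (t : R) : 0 < t -> cabs t%:C%C = t by move=> t0; rewrite cabsR ger0_norm// ltW.
split=> [x y|a x].
  rewrite -lerBlDr; apply: le_gauge => t [t0 Dt]; rewrite lerBlDr [leRHS]addrC -lerBlDr.
  apply: le_gauge => s [s0 Ds]; rewrite lerBlDr; apply: gauge_le.
  have st0 : 0 < s + t by rewrite addr_gt0.
  split => //.
  have -> : (s + t)^-1%:C%C *: (x + y) =
      (t / (s + t))%:C%C *: (t^-1%:C%C *: x) + (s / (s + t))%:C%C *: (s^-1%:C%C *: y).
    rewrite !scalerA -!rmorphM scalerDr.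
    by congr (_%:C%C *: _ + _%:C%C *: _); field; rewrite !gt_eqF.
  apply: Dconv => //; rewrite !cpos ?divr_gt0// -mulrDl addrC divff//.
  by rewrite gt_eqF.
have half (b : R[i]) z : b != 0 -> gauge (b *: z) <= cabs b * gauge z.
  rewrite -cabs_gt0 => b0; rewrite -ler_pdivrMl//; apply: le_gauge => t [t0 Dt].
  rewrite ler_pdivrMl//; apply: gauge_le; split; first by rewrite mulr_gt0.
  have -> : (cabs b * t)^-1%:C%C *: (b *: z) =
      (b * (cabs b)^-1%:C%C) *: (t^-1%:C%C *: z).
    by rewrite !scalerA invfM rmorphM; congr (_ *: _); ring.
  by apply: Dbal => //; rewrite cabsM cpos ?invr_gt0// divff// gt_eqF.
rewrite -/(cabs a); have [->|a0] := eqVneq a 0.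
  rewrite scale0r cabs0 mul0r; apply/eqP; rewrite eq_le; apply/andP; split.
    apply/ler_addgt0Pr => e e0; rewrite add0r; apply: gauge_le; split => //.
    have [t t0 Dt] := Dabs 0; rewrite scaler0; move: Dt; rewrite scaler0.
    by [].
  by apply: le_gauge => t [/ltW].
apply/eqP; rewrite eq_le half//=.
have := half a^-1 (a *: x); rewrite invr_eq0 => /(_ a0).
by rewrite scalerA mulVf// scale1r cabsV ler_pdivlMl ?cabs_gt0.
Qed.

End Gauge.

End SeminormTopology.

(** * The mixed topology *)

Section MixedSeminorms.
Context {R : realType} {Y : lmodType R[i]}.
Variables (N : Y -> R) (tau : Topological Y) (Gamma : set (Y -> R)).
Hypotheses (normN : is_norm N) (sysG : saks_system N tau Gamma).
Implicit Types (p q : Y -> R) (x y : Y).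

Let seminorm_N : is_seminorm N := normN.1.

Lemma saks_seminorm q : Gamma q -> is_seminorm q.
Proof. by case: sysG => _ h _ _ /h[]. Qed.

Lemma saks_directed : directed_system Gamma.
Proof. by case: sysG. Qed.

Lemma saks_opens : opens tau = opens (gen_by Gamma).
Proof. by case: sysG. Qed.

Lemma saks_le_norm q y : Gamma q -> q y <= N y.
Proof.
case: sysG => _ _ _ supN Gq; rewrite -lee_fin supN; apply: ereal_sup_ubound.
by exists q.
Qed.

Lemma norm_le_saks y (c : R) : (forall q, Gamma q -> q y <= c) -> N y <= c.
Proof.
case: sysG => _ _ _ supN h; rewrite -lee_fin supN; apply: ge_ereal_sup.
by move=> _ [q Gq <-]; rewrite lee_fin h.
Qed.

(* These turn out to be the continuous seminorms of the mixed topology. *)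
Definition mixed_seminorms : set (Y -> R) := [set p | is_seminorm p /\
  forall k e : R, 0 < e -> exists q, Gamma q /\ exists2 d : R, 0 < d &
    forall y, N y <= k -> q y < d -> p y < e].

Lemma saks_mixed_seminorm : Gamma `<=` mixed_seminorms.
Proof.
move=> q Gq; split; first exact: saks_seminorm.
by move=> k e e0; exists q; split => //; exists e.
Qed.

Lemma mixed_seminormD p q : mixed_seminorms p -> mixed_seminorms q ->
  mixed_seminorms (fun y => p y + q y).
Proof.
move=> [sp hp] [sq hq]; split; first exact: seminormD.
move=> k e e0; have e2 : 0 < e / 2 by rewrite divr_gt0.
have [r [Gr [d d0 rd]]] := hp k _ e2; have [r' [Gr' [d' d'0 rd']]] := hq k _ e2.
have [s Gs sP] := saks_directed.2 r r' Gr Gr'; exists s; split => //.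
exists (Num.min d d'); first by rewrite lt_min d0.
move=> y Ny; rewrite lt_min => /andP[sd sd']; have [rs rs'] := sP y.
have := rd y Ny (le_lt_trans rs sd); have := rd' y Ny (le_lt_trans rs' sd').
by lra.
Qed.

Lemma mixed_seminormM (c : R) p : 0 < c -> mixed_seminorms p ->
  mixed_seminorms (fun y => c * p y).
Proof.
move=> c0 [sp hp]; split; first by apply: seminormM => //; exact: ltW.
move=> k e e0; have [|q [Gq [d d0 qd]]] := hp k (e / c); first by rewrite divr_gt0.
exists q; split => //; exists d => // y Ny qy.
by rewrite mulrC -ltr_pdivlMr// qd.
Qed.

Lemma mixed_directed : directed_system mixed_seminorms.
Proof.
split.
  by have [q Gq] := saks_directed.1; exists q; exact: saks_mixed_seminorm.
move=> p q mp mq; exists (fun y => p y + q y); first exact: mixed_seminormD.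
move=> y; have := seminorm_ge0 y mp.1; have := seminorm_ge0 y mq.1.
by move=> ? ?; split; lra.
Qed.

Let mixed_is_seminorm p : mixed_seminorms p -> is_seminorm p.
Proof. by case. Qed.

Lemma saks_linear : linear_topology tau.
Proof.
apply: (eq_opens_linear (esym saks_opens)); apply: gen_by_linear.
  exact: saks_directed.
exact: saks_seminorm.
Qed.

Lemma mixed_between : between_and_agrees N tau (gen_by mixed_seminorms).
Proof.
split.
- by apply: gen_by_linear mixed_is_seminorm; exact: mixed_directed.
- by rewrite saks_opens; exact: (sub_gen_by saks_mixed_seminorm).
- apply: gen_by_min => p x e [sp hp] e0; apply: gen_by_open => [q ->//|y /= yx].
  have e'0 : 0 < e - p (y - x) by rewrite subr_gt0.
  have [q [Gq [d d0 qd]]] := hp 1 _ e'0.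
  exists N => //; exists (Num.min 1 d) => [|z /=]; first by rewrite lt_min ltr01.
  rewrite lt_min => /andP[/ltW N1 Nd].
  have := qd _ N1 (le_lt_trans (saks_le_norm _ Gq) Nd).
  by have := seminorm_dist y z x sp; lra.
- move=> B [M NM]; rewrite eqEsubset; split; last first.
    move=> _ [U oU <-]; exists U => //; apply: (sub_gen_by saks_mixed_seminorm).
    by rewrite -saks_opens.
  move=> _ [U oU <-].
  exists (\bigcup_(W in [set W | opens tau W /\ W `&` B `<=` U]) W).
    by apply: opens_bigcup => W [].
  rewrite eqEsubset; split=> x [Wx Bx]; split => //.
    by case: Wx => W [_ WU] Wx; exact: WU.
  move/opensP : oU => /(_ x Wx) /(nbhs_gen_by _ _ mixed_directed mixed_is_seminorm).
  (* Differences of points of [B] lie in the ball of radius [M + M], so the smallness of [p] is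
     required there. *)
  move=> [p [sp hp] [e e0 eU]]; have [q [Gq [d d0 qd]]] := hp (M + M) e e0.
  exists [set y | q (y - x) < d]; last by rewrite /= subrr seminorm0//; exact: saks_seminorm.
  split; first by rewrite saks_opens; exact: semiball_open.
  move=> y [/= yx By]; apply: eU; apply: qd yx.
  have := seminorm_N.1 y (- x); rewrite (seminormN x seminorm_N).
  by have := NM x Bx; have := NM y By; lra.
Qed.

Lemma norm_le0 y : N y <= 0 -> y = 0.
Proof. by move=> Ny; apply: normN.2; apply/eqP; rewrite eq_le Ny seminorm_ge0. Qed.

Lemma opens_tau_norm : opens tau `<=` opens (gen_by [set N]).
Proof. by case: mixed_between => _ h h' _; exact: subset_trans h h'. Qed.

Lemma absorbing_of_balls (D : set Y) :
  (forall k : R, exists q, Gamma q /\ exists2 d : R, 0 < d &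
    forall y, N y <= k -> q y < d -> D y) ->
  forall x, exists2 t : R, 0 < t & D (t%:C%C *: x).
Proof.
move=> Dball x; have [q [Gq [d d0 qd]]] := Dball (N x).
have sq := saks_seminorm Gq.
have q0 : 0 <= q x by exact: seminorm_ge0.
have q1 : 0 < q x + 1 by rewrite ltr_wpDl.
pose t : R := Num.min 1 (d / (q x + 1)).
have t0 : 0 < t by rewrite lt_min ltr01 divr_gt0.
have ct : cabs t%:C%C = t by rewrite cabsR ger0_norm// ltW.
exists t => //; apply: qd.
  by rewrite seminormZ// ct ler_piMl ?seminorm_ge0// ge_min lexx.
rewrite seminormZ ?ct//.
apply: (@lt_le_trans _ _ (t * (q x + 1))); first by rewrite ltr_pM2l// ltrDl.
by rewrite -ler_pdivlMr// ge_min lexx orbT.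
Qed.

(** Smallness of the gauge on the ball of radius [k] follows by stretching points by [2 / e] and
    using the hypothesis on the ball of radius [2 * k / e]. A set described ball by ball thus
    becomes a mixed seminorm. *)
Lemma gauge_mixed_seminorm (D : set Y) :
  (forall (a b : R[i]) x y, cabs a + cabs b <= 1 -> D x -> D y -> D (a *: x + b *: y)) ->
  (forall k : R, exists q, Gamma q /\ exists2 d : R, 0 < d &
    forall y, N y <= k -> q y < d -> D y) ->
  mixed_seminorms (gauge D).
Proof.
move=> Dconv Dball; have Dabs := absorbing_of_balls Dball.
split; first exact: gauge_seminorm.
move=> k e e0; have e2 : 0 < e / 2 by rewrite divr_gt0.
have [q [Gq [d d0 qd]]] := Dball (2 * k / e).
have ce (t : R) : 0 < t -> cabs t%:C%C = t by move=> t0; rewrite cabsR ger0_norm// ltW.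
exists q; split => //; exists (e / 2 * d); first by rewrite mulr_gt0.
move=> y Ny qy; apply: (@le_lt_trans _ _ (e / 2)); last by lra.
have ye : y = (e / 2)%:C%C *: ((e / 2)^-1%:C%C *: y).
  by rewrite scalerA -rmorphM divff ?scale1r// gt_eqF.
rewrite ye seminormZ ?ce//; last exact: gauge_seminorm.
rewrite ler_piMr ?(ltW e2)//; apply: gauge_le1; apply: qd.
  rewrite seminormZ ?ce ?invr_gt0// ler_pdivrMl//.
  have -> : e / 2 * (2 * k / e) = k by field; rewrite gt_eqF.
  by [].
rewrite seminormZ ?ce ?invr_gt0//; first by rewrite ltr_pdivrMl.
exact: saks_seminorm.
Qed.

(* A mixed neighbourhood U of 0 contains U_1 + ... + U_n for all n, where U_j is a
   tau-neighbourhood of 0 in the ball of radius j; the union over n of these sums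
   may be taken absolutely convex, and its gauge is a mixed seminorm. *)
Lemma mixed_nbhs0 T (U : set Y) : between_and_agrees N tau T ->
  nbhs (0 : Topological.Pack T) U ->
  exists2 p, mixed_seminorms p & [set y | p y < 1] `<=` U.
Proof.
move=> [linT _ _ agT] U0.
have [Tadd _] := (linear_topologyP T).1 linT.
pose nb (V : set Y) := nbhs (0 : Topological.Pack T) V.
(* The premise [nb V] stands inside the existential so that a choice is possible for every set; [V]
   itself is the default when it is no neighbourhood. *)
have half V : exists W, nb V -> nb W /\ forall u w, W u -> W w -> V (u + w).
  have [nV|nnV] := pselect (nb V); last by exists V.
  have [|B [C [nB nC BC]]] := Tadd 0 0 V; first by rewrite addr0.
  by exists (B `&` C) => _; split; [exact: filterI|move=> u w [Bu _] [_ Cw]; exact: BC].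
have [h hP] := choice half.
pose V n := iter n h U.
have V0 n : nb (V n) by elim: n => // n /hP[].
have VD n u w : V n.+1 u -> V n.+1 w -> V n (u + w).
  by have [_] := hP _ (V0 n); exact.
have loc n : exists qd : (Y -> R) * R, [/\ Gamma qd.1, 0 < qd.2 &
    forall y, N y <= n.+1%:R -> qd.1 y < qd.2 -> V n.+1 y].
  have /nbhs_opens[G [oG G0 GV]] := V0 n.+1.
  have bB : norm_bounded N [set y | N y <= n.+1%:R] by exists n.+1%:R.
  have : [set W `&` [set y | N y <= n.+1%:R] | W in opens T] (G `&` [set y | N y <= n.+1%:R]).
    by exists G.
  rewrite (agT _ bB) => -[W oW WO].
  have W0 : W 0.
    have : (G `&` [set y | N y <= n.+1%:R]) 0 by split => //=; rewrite seminorm0.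
    by rewrite -WO => -[].
  have : nbhs (0 : Topological.Pack (gen_by Gamma)) W.
    by apply/nbhs_opens; exists W; split => //; rewrite -saks_opens.
  move=> /(nbhs_gen_by _ _ saks_directed saks_seminorm)[q Gq [d d0 qdW]].
  exists (q, d); split => // y Ny qy; apply: GV.
  have : (W `&` [set y | N y <= n.+1%:R]) y by split => //; apply: qdW; rewrite /= subr0.
  by rewrite WO => -[].
have [qd qdP] := choice loc.
(* The index shift matters: [A n] lies in [V n.+1], so that sums of elements of [A 0], ..., [A n]
   remain in [V 0 = U]. *)
pose A n y := N y <= n.+1%:R /\ (qd n).1 y < (qd n).2.
have sq n : is_seminorm (qd n).1 by have [/saks_seminorm] := qdP n.
have A0 n : A n 0.
  by split; rewrite seminorm0//; have [] := qdP n.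
have Aconv n (a b : R[i]) x y : cabs a + cabs b <= 1 -> A n x -> A n y ->
    A n (a *: x + b *: y).
  move=> ab [Nx qx] [Ny qy].
  have [a0 b0] := (cabs_ge0 a, cabs_ge0 b).
  have n0 : 0 <= n.+1%:R :> R by [].
  split.
    apply: le_trans (seminorm_N.1 _ _) _; rewrite !seminormZ//.
    apply: (@le_trans _ _ ((cabs a + cabs b) * n.+1%:R)); last by rewrite ler_piMl.
    by rewrite mulrDl lerD// ler_wpM2l.
  apply: le_lt_trans ((sq n).1 _ _) _; rewrite !seminormZ//.
  pose m : R := Num.max ((qd n).1 x) ((qd n).1 y).
  apply: (@le_lt_trans _ _ m); last by rewrite gt_max qx qy.
  have m0 : 0 <= m by rewrite le_max seminorm_ge0.
  apply: (@le_trans _ _ ((cabs a + cabs b) * m)); last by rewrite ler_piMl.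
  by rewrite mulrDl lerD// ler_wpM2l// le_max lexx ?orbT.
pose D y := exists n (u : nat -> Y), (forall j, A j (u j)) /\ y = \sum_(j < n) u j.
have DU : D `<=` U.
  move=> _ [n [u [uA ->]]].
  have uV j : V j.+1 (u j) by have [_ _ h'] := qdP j; have [] := uA j; exact: h'.
  (* The spare summand carries the induction: [u m] and [w], both in [V m.+1], merge into one
     element of [V m]. *)
  suff : forall m w, V m w -> V 0%N (\sum_(j < m) u j + w).
    move=> /(_ n 0); rewrite addr0; apply.
    exact: nbhs_singleton (V0 n).
  elim=> [w|m IH w wV]; first by rewrite big_ord0 add0r.
  by rewrite big_ord_recr /= -addrA; apply: IH; exact: VD.
have widen m (u : nat -> Y) n : (forall j, A j (u j)) -> exists u' : nat -> Y,
    (forall j, A j (u' j)) /\ \sum_(j < m) u j = \sum_(j < m + n) u' j.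
  move=> uA; exists (fun j => if (j < m)%N then u j else 0); split.
    by move=> j; case: ifP.
  rewrite big_split_ord /= [X in _ + X]big1 ?addr0 => [|j _].
    by apply: eq_bigr => j _; rewrite ltn_ord.
  by rewrite ltnNge leq_addr.
have Dconv (a b : R[i]) x y : cabs a + cabs b <= 1 -> D x -> D y -> D (a *: x + b *: y).
  move=> ab [m [u [uA ->]]] [n [w [wA ->]]].
  have [u' [u'A ->]] := widen m u n uA; have [w' [w'A ->]] := widen n w m wA.
  exists (m + n)%N, (fun j => a *: u' j + b *: w' j); split.
    by move=> j; exact: Aconv.
  by rewrite big_split /= -!scaler_sumr (addnC n).
have Asub n y : A n y -> D y.
  move=> Ay; exists n.+1, (fun j => if j == n then y else 0); split.
    by move=> j; case: eqP => [->|].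
  by rewrite (bigD1 ord_max)//= eqxx big1 ?addr0// => j; rewrite -val_eqE => /negPf ->.
have Dball (k : R) : exists q, Gamma q /\ exists2 d : R, 0 < d &
    forall y, N y <= k -> q y < d -> D y.
  have [Gq d0 _] := qdP (Num.truncn k); exists (qd (Num.truncn k)).1; split => //.
  exists (qd (Num.truncn k)).2 => // y Ny qy; apply: (Asub (Num.truncn k)); split => //.
  by rewrite (le_trans Ny)// ltW// truncnS_gt.
exists (gauge D); first exact: gauge_mixed_seminorm.
by move=> y /(gauge_lt1 Dconv (absorbing_of_balls Dball)) /DU.
Qed.

Lemma nbhs_shift T x (A : set Y) : linear_topology T ->
  nbhs (x : Topological.Pack T) A ->
  nbhs (0 : Topological.Pack T) [set w | A (x + w)].
Proof.
move=> /linear_topologyP[Tadd _] xA.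
have [|B [C [xB C0 BC]]] := Tadd x 0 A; first by rewrite addr0.
apply: filterS C0 => w Cw; apply: BC => //.
exact: nbhs_singleton xB.
Qed.

(** The mixed topology belongs to the very family whose supremum it is, so [mixed_nbhs0] applies to
    it. The converse inclusion is its maximality. *)
Lemma opens_mixed : opens (mixed N tau) = opens (gen_by mixed_seminorms).
Proof.
rewrite eqEsubset; split; last by apply: mixed_finest; exact: mixed_between.
have bm := mixed_agrees saks_linear opens_tau_norm.
move=> U /opensP oU; apply: gen_by_open => // x Ux.
have [linm _ _ _] := bm.
have [p mp pU] := mixed_nbhs0 bm (nbhs_shift linm (oU x Ux)).
exists p => //; exists 1 => // y /= /pU /=.
by rewrite addrC subrK.
Qed.

Lemma nbhs_mixedP x (A : set Y) : nbhs (x : mixed_topology N tau) A <->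
  exists2 p, mixed_seminorms p & [set y | p (y - x) < 1] `<=` A.
Proof.
rewrite (eq_opens_nbhs x A opens_mixed : nbhs (x : mixed_topology N tau) A <-> _).
rewrite (nbhs_gen_by x A mixed_directed mixed_is_seminorm).
split=> [[p mp [e e0 eA]]|[p mp pA]]; last by exists p => //; exists 1.
exists (fun y => e^-1 * p y); first by apply: mixed_seminormM; rewrite ?invr_gt0.
by move=> y /=; rewrite ltr_pdivrMl// mulr1 => /eA.
Qed.

Lemma cvg_mixed_seminorms (F : set_system Y) x : Filter F ->
  (forall p, mixed_seminorms p -> F [set y | p (y - x) < 1]) ->
  F --> (x : mixed_topology N tau).
Proof. by move=> FF Fp A /nbhs_mixedP[p /Fp pF pA]; exact: filterS pA pF. Qed.

(** Differences with [x] stay in the ball of radius [k + N x], where one seminorm of [Gamma] governs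
    [p]. *)
Lemma mixed_seminorm_small (F : set_system Y) x (k : R) p : Filter F ->
  F [set y | N y <= k] ->
  (forall q e, Gamma q -> 0 < e -> F [set y | q (y - x) < e]) ->
  mixed_seminorms p -> forall e, 0 < e -> F [set y | p (y - x) < e].
Proof.
move=> FF Fk Fq [sp hp] e e0; have [q [Gq [d d0 qd]]] := hp (k + N x) e e0.
apply: filterS2 Fk (Fq q d Gq d0) => y /= yk /qd; apply.
by apply: le_trans (seminorm_N.1 _ _) _; rewrite (seminormN _ seminorm_N) lerD2r.
Qed.

End MixedSeminorms.

(** * Completeness and C-sequentiality of mixed topologies *)

Section MixedProperties.
Context {R : realType} {Y : lmodType R[i]}.
Variables (N : Y -> R) (tau : Topological Y) (Gamma : set (Y -> R)).
Hypotheses (normN : is_norm N) (sysG : saks_system N tau Gamma).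
Implicit Types (p q : Y -> R) (x y : Y).

Let seminorm_N : is_seminorm N := normN.1.
Let good : set (Y -> R) := mixed_seminorms N Gamma.
Let goodD p q : good p -> good q -> good (fun y => p y + q y).
Proof. exact: (mixed_seminormD sysG). Qed.
Let saks_good q : Gamma q -> good q.
Proof. exact: (saks_mixed_seminorm sysG). Qed.

Lemma tvs_cauchy_mixed (F : set_system Y) p : Filter F ->
  tvs_cauchy (F : set_system (mixed_topology N tau)) -> good p ->
  exists2 A, F A & forall x y, A x -> A y -> p (x - y) < 1.
Proof.
move=> FF Fc mp.
have /Fc[[A B] /= [FA FB] AB] : nbhs (0 : mixed_topology N tau) [set y | p y < 1].
  by apply/(nbhs_mixedP normN sysG); exists p => // y /=; rewrite subr0.
exists (A `&` B); first exact: filterI.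
by move=> x y [Ax _] [_ By]; exact: (AB (x, y)).
Qed.

(* A mixed Cauchy filter meets all its uniform neighbourhoods inside one fixed
   ball: otherwise failures p_n at radius 2n+1 would make the mixed seminorm with
   unit ball the x that are p_n-close to the ball of radius n+1 for all n
   contradict the Cauchy property. *)
Lemma cauchy_near_ball (F : set_system Y) : ProperFilter F ->
  (forall p, good p -> exists2 A, F A & forall x y, A x -> A y -> p (x - y) < 1) ->
  exists k : R, forall A p, F A -> good p -> exists a y,
    [/\ A a, N y <= k & p (a - y) <= 1].
Proof.
move=> FF Fc; apply: contrapT => h.
have bad (n : nat) : exists Ap : set Y * (Y -> R), [/\ F Ap.1, good Ap.2 &
    forall a y, Ap.1 a -> N y <= n%:R + n.+1%:R -> 1 < Ap.2 (a - y)].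
  apply: contrapT => h'; apply: h; exists (n%:R + n.+1%:R) => A p FA mp.
  apply: contrapT => h''; apply: h'; exists (A, p); split => // a y /= Aa Ny.
  by rewrite ltNge; apply/negP => pay; apply: h''; exists a, y.
have [Ap ApP] := choice bad.
pose p n := (Ap n).2.
have gp n : good (p n) by have [] := ApP n.
have sp n : is_seminorm (p n) by have [] := gp n.
pose D x := forall n, exists2 y, N y <= n.+1%:R & p n (x - y) <= 1.
have Dconv (a b : R[i]) x y : cabs a + cabs b <= 1 -> D x -> D y -> D (a *: x + b *: y).
  move=> ab Dx Dy n; have [x' Nx px] := Dx n; have [y' Ny py] := Dy n.
  have [a0 b0] := (cabs_ge0 a, cabs_ge0 b).
  exists (a *: x' + b *: y').
    apply: le_trans (seminorm_N.1 _ _) _; rewrite !seminormZ//.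
    apply: (@le_trans _ _ ((cabs a + cabs b) * n.+1%:R)); last by rewrite ler_piMl.
    by rewrite mulrDl lerD// ler_wpM2l.
  rewrite opprD addrACA -!scalerBr.
  apply: le_trans ((sp n).1 _ _) _; rewrite !seminormZ//.
  apply: le_trans ab; apply: lerD; first by rewrite ler_piMr.
  by rewrite ler_piMr.
(* On the ball of radius [k] only the conditions with [n < truncn k] bite, and the sum [r] of these
   [p n] controls them; for larger [n] the point is its own approximant. *)
have Dk (k : R) : exists q, Gamma q /\ exists2 d : R, 0 < d & forall y, N y <= k -> q y < d -> D y.
  have [r [gr rp]] : exists r, good r /\ forall n y, (n < Num.truncn k)%N -> p n y <= r y.
    elim: (Num.truncn k) => [|m [r [gr rp]]]; first by exists (p 0%N).
    exists (fun y => r y + p m y); split; first exact: goodD.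
    move=> n y; rewrite ltnS leq_eqVlt => /predU1P[->|nm].
      by rewrite lerDr seminorm_ge0//; have [] := gr.
    by rewrite (le_trans (rp n y nm))// lerDl seminorm_ge0.
  have [q [Gq [d d0 qd]]] := gr.2 k 1 ltr01.
  exists q; split => //; exists d => // y Ny qy n.
  have [nk|kn] := ltnP n (Num.truncn k).
    exists 0; first by rewrite seminorm0.
    by rewrite subr0 (le_trans (rp n y nk))// ltW// qd.
  exists y; last by rewrite subrr seminorm0.
  by rewrite (le_trans Ny)// ltW// (lt_le_trans (truncnS_gt k))// ler_nat ltnS.
have Dabs := absorbing_of_balls normN sysG Dk.
have gD : good (gauge D) by exact: (gauge_mixed_seminorm normN sysG).
have [A FA AP] := Fc _ gD.
have [a' Aa'] := filter_ex FA.
(* Here [N a' < k.+1], and the approximant [y] of [a - a'] at index [k.+1] has norm at most [k.+2].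
   So [y + a'] has norm at most [k.+1 + k.+2], exactly the radius for which [Ap k.+1] was chosen. *)
pose k := Num.truncn (N a').
have [FAk _ hk] := ApP k.+1.
have [a [Aa Aka]] := filter_ex (filterI FA FAk).
have [y Ny py] := gauge_lt1 Dconv Dabs (AP a a' Aa Aa') k.+1.
have E : a - (y + a') = a - a' - y by rewrite opprD (addrC (- y)) addrA.
have Nya : N (y + a') <= k.+1%:R + k.+2%:R.
  apply: le_trans (seminorm_N.1 _ _) _; rewrite addrC lerD//.
  by rewrite ltW// truncnS_gt.
by have := hk a (y + a') Aka Nya; rewrite E ltNge py.
Qed.

(** A Cauchy filter need not contain a ball. The points of the ball from [cauchy_near_ball] that are
    close to members of [F] form a second Cauchy filter [G], and the limit of [G] is a limit of
    [F]. *)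
Lemma mixed_complete :
  (forall (k : R) (G : set_system Y), ProperFilter G -> G [set y | N y <= k] ->
    (forall q (e : R), Gamma q -> 0 < e ->
      exists2 A, G A & forall x y, A x -> A y -> q (x - y) < e) ->
    exists l, forall q (e : R), Gamma q -> 0 < e -> G [set y | q (y - l) < e]) ->
  tvs_complete (mixed_topology N tau).
Proof.
move=> ballc F FF Fc.
have Fc' p : good p -> exists2 A, F A & forall x y, A x -> A y -> p (x - y) < 1.
  by move=> gp; exact: tvs_cauchy_mixed Fc gp.
have [k kP] := cauchy_near_ball FF Fc'.
pose S (Ap : set Y * (Y -> R)) := [set y | N y <= k /\ exists2 a, Ap.1 a & Ap.2 (a - y) <= 1].
pose G := filter_from [set Ap : set Y * (Y -> R) | F Ap.1 /\ good Ap.2] S.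
have [q0 Gq0] := (saks_directed sysG).1.
have GG : ProperFilter G.
  apply: filter_from_proper; last first.
    move=> [A p] [/= FA gp]; have [a [y [Aa Ny pay]]] := kP A p FA gp.
    by exists y; split => //; exists a.
  apply: filter_from_filter.
    by exists (setT, q0); split; [exact: filterT|exact: saks_good].
  move=> [A p] [B q] [/= FA gp] [/= FB gq].
  exists (A `&` B, fun y => p y + q y); first by split; [exact: filterI|exact: goodD].
  move=> y [Ny [a [/= Aa Ba] pq]].
  have := seminorm_ge0 (a - y) gp.1; have := seminorm_ge0 (a - y) gq.1 => q1 p1.
  by split; split => //; exists a => //=; lra.
have Gk : G [set y | N y <= k].
  by exists (setT, q0) => [|y []//]; split; [exact: filterT|exact: saks_good].
have scale p (c : R) : 0 < c -> good p -> good (fun y => c * p y).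
  by move=> c0 gp; apply: mixed_seminormM.
have GC q (e : R) : Gamma q -> 0 < e ->
    exists2 A, G A & forall x y, A x -> A y -> q (x - y) < e.
  (* With this factor each of [x - a], [a - b] and [b - y] costs at most [e / 4]. *)
  move=> Gq e0; have c0 : 0 < 4 / e by rewrite divr_gt0.
  have gq := scale q _ c0 (saks_good Gq); have [A FA AP] := Fc' _ gq.
  exists (S (A, fun y => 4 / e * q y)); first by exists (A, fun y => 4 / e * q y).
  move=> x y [_ [a Aa ax]] [_ [b Ab bY]]; have sq := saks_seminorm sysG Gq.
  have q4 z : 4 / e * q z <= 1 -> q z <= e / 4.
    by rewrite mulrC -ler_pdivlMr// mul1r invf_div.
  have := q4 _ (ltW (AP a b Aa Ab)); have := q4 _ ax; have := q4 _ bY.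
  have := seminorm_dist a x y sq; have := seminorm_dist b a y sq.
  by rewrite (seminormB x a)//; lra.
have [l lP] := ballc k G GG Gk GC.
exists l; apply: (cvg_mixed_seminorms normN sysG) => p gp.
have [A FA AP] := Fc' _ (scale p 4 (ltr0n R 4) gp).
have sp := gp.1.
have GS : G (S (A, fun y => 4 * p y)).
  by exists (A, fun y => 4 * p y) => //; split => //; exact: scale.
have Gl : G [set y | p (y - l) < 1 / 4].
  have FG : Filter G by exact: GG.
  have q14 : (0 : R) < 1 / 4 by rewrite divr_gt0.
  exact: (mixed_seminorm_small normN FG Gk lP gp q14).
have [y [[_ [a Aa /= pay]] /= pyl]] := filter_ex (filterI GS Gl).
apply: filterS FA => b Ab /=; have /= := AP b a Ab Aa.
have := seminorm_dist a b l sp; have := seminorm_dist y a l sp.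
by lra.
Qed.

Lemma convex_comb (A : set Y) x y (t : R) : convex_set A -> A x -> A y -> 0 <= t <= 1 ->
  A (t%:C%C *: x + (1 - t)%:C%C *: y).
Proof.
move=> cA Ax Ay /andP[t0 t1].
have t0' : 0 <= t%:C%C :> R[i] by rewrite ler0c.
have t1' : t%:C%C <= 1 :> R[i] by rewrite (_ : 1 = 1%:C%C)// lecR.
have := cA x y (Itv01 t0' t1') (mem_set Ax) (mem_set Ay).
by move=> /set_mem; rewrite /conv /= rmorphB rmorph1.
Qed.

(** A countable cofinal chain of seminorms permits a diagonal choice: if no neighbourhood of 0 in
    some ball were carried into [A] by adding [x], a bounded null sequence [w] with [x + w n]
    outside [A] would contradict sequential openness. *)
Lemma mixed_C_sequential (qs : nat -> Y -> R) :
  (forall n, Gamma (qs n)) -> (forall n y, qs n y <= qs n.+1 y) ->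
  (forall q, Gamma q -> exists n, forall y, q y <= qs n y) ->
  C_sequential (mixed_topology N tau).
Proof.
move=> Gqs qsS cof A cA soA.
have qs_le m n y : (m <= n)%N -> qs m y <= qs n y.
  by move=> /subnKC <-; elim: (n - m)%N => [|k IH]; rewrite ?addn0// addnS (le_trans IH).
rewrite openE => x Ax; rewrite /interior.
have ball (k : R) : exists n : nat, forall w, N w <= k -> qs n w < n.+1%:R^-1 -> A (x + w).
  apply: contrapT => h.
  have /choice[w wP] : forall n : nat, exists w, [/\ N w <= k, qs n w < n.+1%:R^-1 & ~ A (x + w)].
    move=> n; apply: contrapT => h'; apply: h; exists n => w Nw qw.
    by apply: contrapT => nA; apply: h'; exists w.
  have wx : (fun n => x + w n : mixed_topology N tau) @ \oo --> (x : mixed_topology N tau).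
    apply: (cvg_mixed_seminorms normN sysG) => p [sp /(_ k 1 ltr01)[q [Gq [d d0 qd]]]].
    have [m mP] := cof q Gq.
    have [M _ MP] := @near_infty_natSinv_lt R (PosNum d0).
    exists (maxn m M) => // n; rewrite /= geq_max => /andP[mn Mn].
    have [Nw qw _] := wP n; rewrite addrC addKr; apply: qd => //.
    apply: le_lt_trans (mP _) _; apply: le_lt_trans (qs_le _ _ _ mn) _.
    by apply: lt_trans qw _; exact: MP.
  have [M _ MP] := soA (fun n => x + w n) x Ax wx.
  by have [_ _] := wP M; apply; exact: (MP M (leqnn M)).
(* The translate of [A] is merely convex. Its balanced core is absolutely convex and still contains
   a neighbourhood of 0 in each ball, because factors of modulus at most 1 do not increase a
   seminorm. *)
pose D w := forall c : R[i], cabs c <= 1 -> A (x + c *: w).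
(* The missing weight [1 - (a + b)] falls on [x], which belongs to [A]. *)
have pos_comb (a b : R) u w : 0 <= a -> 0 <= b -> a + b <= 1 -> A (x + u) -> A (x + w) ->
    A (x + (a%:C%C *: u + b%:C%C *: w)).
  move=> a0 b0 ab Au Aw.
  have [s0|s0] := eqVneq (a + b) 0.
    have -> : a = 0 by lra.
    have -> : b = 0 by lra.
    by rewrite !scale0r !addr0.
  have s00 : 0 < a + b by rewrite lt_def s0 addr_ge0.
  have t01 : 0 <= a / (a + b) <= 1.
    by rewrite divr_ge0 ?addr_ge0//= ler_pdivrMr// mul1r lerDl.
  have A1 := convex_comb cA Au Aw t01.
  have s01 : 0 <= a + b <= 1 by rewrite addr_ge0.
  have := convex_comb cA A1 Ax s01; congr A.
  have C1 : (1 - a / (a + b))%:C%C = (b / (a + b))%:C%C.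
    by congr (_%:C%C); field.
  rewrite C1 !scalerDr !scalerA -!rmorphM.
  have -> : (a + b) * (a / (a + b)) = a by field.
  have -> : (a + b) * (b / (a + b)) = b by field.
  rewrite addrACA -scalerDl -rmorphD addrAC -scalerDl -rmorphD.
  by rewrite (_ : a + b + (1 - (a + b)) = 1) ?scale1r//; ring.
have unit_part (a : R[i]) : exists2 s : R[i], cabs s <= 1 & a = (cabs a)%:C%C * s.
  have [->|a0] := eqVneq a 0; first by exists 0; rewrite ?cabs0// mulr0.
  have ca : 0 < cabs a by rewrite cabs_gt0.
  exists (a * (cabs a)^-1%:C%C).
    by rewrite cabsM cabsR ger0_norm ?invr_ge0 ?cabs_ge0// divff// gt_eqF.
  by rewrite mulrCA -rmorphM divff ?mulr1// gt_eqF.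
have Dconv (a b : R[i]) u w : cabs a + cabs b <= 1 -> D u -> D w -> D (a *: u + b *: w).
  move=> ab Du Dw c c1; have [s s1 aE] := unit_part a; have [t t1 bE] := unit_part b.
  have -> : c *: (a *: u + b *: w) =
      (cabs a)%:C%C *: ((c * s) *: u) + (cabs b)%:C%C *: ((c * t) *: w).
    by rewrite {1}aE {1}bE scalerDr !scalerA; congr (_ *: _ + _ *: _); ring.
  apply: pos_comb; rewrite ?cabs_ge0//.
    by apply: Du; rewrite cabsM mulr_ile1 ?cabs_ge0.
  by apply: Dw; rewrite cabsM mulr_ile1 ?cabs_ge0.
have Dball (k : R) : exists q, Gamma q /\ exists2 d : R, 0 < d &
    forall w, N w <= k -> q w < d -> D w.
  have [n nP] := ball k; exists (qs n); split => //; exists n.+1%:R^-1.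
    by rewrite invr_gt0 ltr0n.
  move=> w Nw qw c c1.
  have sq := saks_seminorm sysG (Gqs n).
  apply: nP; rewrite seminormZ//.
    by rewrite (le_trans _ Nw)// ler_piMl// seminorm_ge0.
  by apply: le_lt_trans qw; rewrite ler_piMl// seminorm_ge0.
have Dabs := absorbing_of_balls normN sysG Dball.
apply/(nbhs_mixedP normN sysG); exists (gauge D); last first.
  move=> y /= /(gauge_lt1 Dconv Dabs) /(_ 1); rewrite cabs1 scale1r addrC subrK.
  exact.
exact: (gauge_mixed_seminorm normN sysG).
Qed.

End MixedProperties.

(** * Bounded sets, compact balls and the submixed topology *)

Section SubmixedTopology.
Context {R : realType} {Y : lmodType R[i]}.
Variables (N : Y -> R) (tau : Topological Y) (Gamma : set (Y -> R)).
Hypotheses (normN : is_norm N) (sysG : saks_system N tau Gamma).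
Implicit Types (p q : Y -> R) (x y : Y).

Let seminorm_N : is_seminorm N := normN.1.

Lemma nat_seq_ub (a : nat -> R) : (forall n, 0 <= a n) -> a @ \oo --> 0 ->
  exists2 A : R, 0 <= A & forall n, a n <= A.
Proof.
move=> a0 /cvgrPdist_lt /(_ 1 ltr01)[M _ MP].
exists (1 + \sum_(j < M) a j); first by rewrite addr_ge0// sumr_ge0.
move=> n; have [nM|Mn] := ltnP n M.
  rewrite (bigD1 (Ordinal nM))//= addrCA lerDl addr_ge0// sumr_ge0//.
have := MP n Mn; rewrite /= sub0r normrN ger0_norm// => /ltW an.
by rewrite (le_trans an)// lerDl sumr_ge0.
Qed.

Section WeightedSup.
Variables (q : nat -> Y -> R) (a : nat -> R).
Hypotheses (sq : forall n, is_seminorm (q n)) (qN : forall n y, q n y <= N y).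
Hypotheses (a0 : forall n, 0 <= a n) (acvg : a @ \oo --> 0).

Let p y := sup [set q n y * a n | n in [set: nat]].

Lemma wsup_ge n y : q n y * a n <= p y.
Proof.
have [A A0 aA] := nat_seq_ub a0 acvg.
apply: ub_le_sup; last by exists n.
exists (N y * A) => _ [m _ <-]; rewrite ler_pM//; exact: seminorm_ge0.
Qed.

Lemma wsup_le y (c : R) : (forall n, q n y * a n <= c) -> p y <= c.
Proof.
move=> h; apply: ge_sup => [|_ [n _ <-]]; last exact: h.
by exists (q 0%N y * a 0%N); exists 0%N.
Qed.

Lemma wsup_seminorm : is_seminorm p.
Proof.
split=> [x y|c x].
  apply: wsup_le => n; have := wsup_ge n x; have := wsup_ge n y.
  by have := ler_wpM2r (a0 n) ((sq n).1 x y); rewrite mulrDl; lra.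
have half (b : R[i]) z : p (b *: z) <= cabs b * p z.
  apply: wsup_le => n; rewrite seminormZ// -mulrA ler_wpM2l ?cabs_ge0//.
  exact: wsup_ge.
rewrite -/(cabs c); apply/eqP; rewrite eq_le half /=.
have [->|c0] := eqVneq c 0.
  rewrite cabs0 mul0r scale0r; apply: le_trans (wsup_ge 0 0).
  by rewrite seminorm0// mul0r.
have := half c^-1 (c *: x); rewrite scalerA mulVf// scale1r cabsV.
by rewrite ler_pdivlMl// cabs_gt0.
Qed.

(** For large [n] the bound [q n y <= N y] and the smallness of [a n] keep the terms below [e / 2];
    the finitely many others are controlled by one seminorm of [Gamma]. The [q n] may lie outside
    [Gamma], since [mixed_submixed] takes them from [Gamma']. *)
Lemma wsup_mixed_seminorm :
  (forall n (e : R), 0 < e -> exists r, Gamma r /\ exists2 d : R, 0 < d &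
     forall y, r y < d -> q n y < e) ->
  mixed_seminorms N Gamma p.
Proof.
move=> loc; split=> [|k e e0]; first exact: wsup_seminorm.
have [A A0 aA] := nat_seq_ub a0 acvg.
have K0 : 0 < 2 * (`|k| + 1) by rewrite mulr_gt0// ltr_wpDl.
have [M _ MP] : \forall n \near \oo, a n * (2 * (`|k| + 1)) < e.
  move/cvgrPdist_lt : acvg => /(_ (e / (2 * (`|k| + 1)))).
  rewrite divr_gt0// => /(_ isT); apply: filterS => n.
  by rewrite sub0r normrN ger0_norm// ltr_pdivlMr.
have A1 : 0 < 2 * (A + 1) by rewrite mulr_gt0// ltr_wpDl.
have [r [Gr [d d0 rd]]] : exists r, Gamma r /\ exists2 d : R, 0 < d &
    forall n y, (n < M)%N -> r y < d -> q n y < e / (2 * (A + 1)).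
  elim: M {MP} => [|m [r [Gr [d d0 rd]]]].
    by have [r Gr] := (saks_directed sysG).1; exists r; split => //; exists 1.
  have [|s [Gs [d' d'0 sd']]] := loc m (e / (2 * (A + 1))); first by rewrite divr_gt0.
  have [t Gt tP] := (saks_directed sysG).2 r s Gr Gs; exists t; split => //.
  exists (Num.min d d'); first by rewrite lt_min d0.
  move=> n y; rewrite ltnS lt_min leq_eqVlt => /predU1P[->|nm] /andP[td td'].
    by apply: sd'; apply: le_lt_trans td'; have [] := tP y.
  by apply: rd => //; apply: le_lt_trans td; have [] := tP y.
exists r; split => //; exists d => // y Ny ry.
apply: (@le_lt_trans _ _ (e / 2)); last by lra.
apply: wsup_le => n; have qy0 := seminorm_ge0 y (sq n).
have [nM|Mn] := ltnP n M.
  have h := rd n y nM ry.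
  apply: (@le_trans _ _ (e / (2 * (A + 1)) * (A + 1))).
    by apply: ler_pM => //; [exact: ltW|rewrite (le_trans (aA n))// lerDl].
  by rewrite le_eqVlt; apply/orP; left; apply/eqP; field; rewrite gt_eqF// ltr_wpDl.
have h := MP n Mn; have ky : q n y <= `|k|.
  by rewrite (le_trans (qN n y))// (le_trans Ny)// ler_norm.
apply: (@le_trans _ _ (`|k| * a n)); first by rewrite ler_wpM2r.
have := a0 n; have := normr_ge0 k.
by move: h => /=; lra.
Qed.

End WeightedSup.

(** An unbounded [B] provides [q n] in [Gamma] and points [y n] with [q n (y n) > (n + 1) ^ 2]. The
    mixed seminorm with weights [1 / (n + 1)] exceeds [n + 1] at [y n], so its unit ball does not
    absorb [B]. *)
Lemma mixed_bounded (B : set Y) : tvs_bounded (B : set (mixed_topology N tau)) ->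
  exists k : R, forall y, B y -> N y <= k.
Proof.
move=> bB; apply: contrapT => h.
have unb (n : nat) : exists yq : Y * (Y -> R), [/\ B yq.1, Gamma yq.2 &
    n.+1%:R * n.+1%:R < yq.2 yq.1].
  apply: contrapT => h'; apply: h; exists (n.+1%:R * n.+1%:R) => y By.
  apply: (norm_le_saks sysG) => q Gq; rewrite leNgt; apply/negP => lt.
  by apply: h'; exists (y, q).
have [yq yqP] := choice unb.
pose q n := (yq n).2; pose a n : R := n.+1%:R^-1.
have Gq n : Gamma (q n) by have [] := yqP n.
have sq n : is_seminorm (q n) by exact: (saks_seminorm sysG).
have qN n y : q n y <= N y by exact: (saks_le_norm sysG y (Gq n)).
have a0 n : 0 <= a n by rewrite invr_ge0.
have acvg : a @ \oo --> 0.
  apply/cvgrPdist_lt => e e0; have [M _ MP] := @near_infty_natSinv_lt R (PosNum e0).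
  by exists M => // n Mn; rewrite sub0r normrN ger0_norm//; exact: MP.
have gp : mixed_seminorms N Gamma (fun y => sup [set q n y * a n | n in [set: nat]]).
  by apply: wsup_mixed_seminorm => // n e e0; exists (q n); split => //; exists e.
have [] := bB [set y | sup [set q n y * a n | n in [set: nat]] < 1].
  apply/(nbhs_mixedP normN sysG); eexists; first exact: gp.
  by move=> y /=; rewrite subr0.
move=> r r0 /(_ r%:C%C); rewrite -/(cabs _) cabsR (ger0_norm (ltW r0)) => /(_ (lexx _)) Br.
pose n := Num.truncn r.
have [/Br[x /= px yx] _ big] := yqP n.
have := wsup_ge sq qN a0 acvg n x.
have rn : r < n.+1%:R by rewrite truncnS_gt.
have n0 : 0 < n.+1%:R :> R by [].
have : n.+1%:R < r * (q n x * a n).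
  rewrite -/(q n) -yx seminormZ// cabsR (ger0_norm (ltW r0)) in big.
  by rewrite mulrA /a ltr_pdivlMr.
have : r * (q n x * a n) < r.
  by rewrite -[ltRHS]mulr1 ltr_pM2l//; apply: le_lt_trans px; exact: wsup_ge.
by lra.
Qed.

Definition balls_compact := forall (k : R) (G : set_system Y), UltraFilter G ->
  G [set y | N y <= k] -> exists2 l, N l <= k &
    forall q (e : R), Gamma q -> 0 < e -> G [set y | q (y - l) < e].

Lemma mixed_semi_montel : balls_compact -> semi_montel (mixed_topology N tau).
Proof.
move=> cb B /mixed_bounded[k kB].
exists [set y | N y <= k]; first by move=> y /kB.
split.
  rewrite compact_ultra => G UG Gk.
  have [l Nl lP] := cb k G UG Gk; exists l; split => //=.
  apply: (cvg_mixed_seminorms normN sysG) => p gp.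
  by apply: (mixed_seminorm_small normN _ Gk lP gp).
(* The ball is closed because [N] is a supremum of seminorms that are continuous for the mixed
   topology. *)
move=> y clB /=; apply: (norm_le_saks sysG) => q Gq.
apply/ler_addgt0Pr => e e0; have sq := saks_seminorm sysG Gq.
have nb : nbhs (y : mixed_topology N tau) [set z | q (z - y) < e].
  apply/(nbhs_mixedP normN sysG); exists (fun z => e^-1 * q z).
    by apply: mixed_seminormM; rewrite ?invr_gt0//; exact: (saks_mixed_seminorm sysG).
  by move=> z /=; rewrite ltr_pdivrMl// mulr1.
have [z [/= Nz qz]] := clB _ nb.
have := seminorm_subD y z sq; rewrite (seminormB y z)//.
by have := saks_le_norm sysG z Gq; lra.
Qed.

(* The argument of the Banach-Dieudonne theorem: given a mixed neighbourhood V of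
   0, compactness of the balls yields successively q n in Gamma' and c n > n with
   N <= n and q j <= c j for j < n implying membership in V. *)
Lemma mixed_submixed (tau' : Topological Y) Gamma' : saks_system N tau' Gamma' ->
  (forall q' (e : R), Gamma' q' -> 0 < e -> exists r, Gamma r /\ exists2 d : R, 0 < d &
     forall y, r y < d -> q' y < e) ->
  balls_compact ->
  opens (mixed N tau) = opens (gen_by (submixed_seminorms Gamma')).
Proof.
move=> sysG' loc cb; rewrite eqEsubset; split; last first.
  apply: gen_by_min => _ x e [q [a [Gq a0 acvg ->]]] e0.
  rewrite (opens_mixed normN sysG).
  apply: (@semiball_open _ _ (mixed_seminorms N Gamma)
    (fun y => sup [set q n y * a n | n in [set: nat]])) => //.
  apply: wsup_mixed_seminorm => //.
  - by move=> n; exact: (saks_seminorm sysG').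
  - by move=> n y; exact: (saks_le_norm sysG' y (Gq n)).
  - by move=> n d d0; exact: loc.
rewrite (opens_mixed normN sysG) => U /opensP oU.
have sm p : submixed_seminorms Gamma' p -> is_seminorm p.
  move=> [q [a [Gq a0 acvg ->]]]; apply: wsup_seminorm => //.
  - by move=> n; exact: (saks_seminorm sysG').
  - by move=> n y; exact: (saks_le_norm sysG' y (Gq n)).
apply: gen_by_open => // x Ux.
pose V w := U (x + w).
have Vopen w : V w -> exists2 p, mixed_seminorms N Gamma p & [set z | p (z - w) < 1] `<=` V.
  move=> Vw; have : nbhs (x + w : mixed_topology N tau) U.
    by apply/(eq_opens_nbhs _ _ (opens_mixed normN sysG)); exact: oU.
  move=> /(nbhs_mixedP normN sysG)[p gp pU]; exists p => // z /= pzw.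
  by apply: pU => /=; rewrite opprD addrACA subrr add0r.
pose closed_lim (C : set Y) := forall f,
  (forall q (e : R), Gamma q -> 0 < e -> exists2 y, C y & q (y - f) < e) -> C f.
(* The second component will be a finite intersection of sublevel sets. Its closedness under limits
   for [Gamma] is carried along in order to place the limit [f] below in [C]. *)
pose good (nC : nat * set Y) :=
  (forall w, N w <= nC.1%:R -> nC.2 w -> V w) /\
  forall (G : set_system Y) f, ProperFilter G -> G nC.2 ->
    (forall q (e : R), Gamma q -> 0 < e -> G [set y | q (y - f) < e]) -> nC.2 f.
pose next (s t : nat * set Y) := t.1 = s.1.+1 /\ exists q (c : R),
  [/\ Gamma' q, s.1%:R < c & t.2 = s.2 `&` [set w | q w <= c]].
have lim_le (G : set_system Y) f q' (c : R) : ProperFilter G -> Gamma' q' ->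
    (forall q (e : R), Gamma q -> 0 < e -> G [set y | q (y - f) < e]) ->
    G [set w | q' w <= c] -> q' f <= c.
  move=> GG Gq' Gf Gc; apply/ler_addgt0Pr => e e0.
  have [r [Gr [d d0 rd]]] := loc q' e Gq' e0.
  have [y [/= yc yf]] := filter_ex (filterI Gc (Gf r d Gr d0)).
  have sq' := saks_seminorm sysG' Gq'.
  have := rd _ yf; have := seminorm_subD f y sq'; rewrite (seminormB f y)//.
  by lra.
have step s : good s -> exists2 t, good t & next s t.
  case: s => n C [/= CV Ccl]; apply: contrapT => h.
  (* If no pair [(q, c)] works, the counterexamples generate a filter. An ultrafilter above it has a
     limit [f] in [C] with [q f <= n] for every [q] in [Gamma'], so [N f <= n] and [V f] holds;
     being open, [V] then contains a counterexample. *)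
  have stuck q (c : R) : Gamma' q -> n%:R < c ->
      exists w, [/\ N w <= n.+1%:R, C w, q w <= c & ~ V w].
    move=> Gq nc; apply: contrapT => h'; apply: h.
    exists (n.+1, C `&` [set w | q w <= c]); last by split => //; exists q, c.
    split => /=.
      move=> w Nw [Cw qw]; apply: contrapT => nV; apply: h'.
      by exists w.
    move=> G f GG GC Gf; split.
      by apply: (Ccl G) => //; apply: filterS GC => y [].
    by apply: (lim_le G) => //; apply: filterS GC => y [].
  pose S (qc : (Y -> R) * R) := [set w | [/\ N w <= n.+1%:R, C w, qc.1 w <= qc.2 & ~ V w]].
  pose G0 := filter_from [set qc : (Y -> R) * R | Gamma' qc.1 /\ n%:R < qc.2] S.
  have [q0 Gq0] := (saks_directed sysG').1.
  have G00 : ProperFilter G0.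
    apply: filter_from_proper; last first.
      by move=> [q c] [/= Gq nc]; have [w] := stuck q c Gq nc; exists w.
    apply: filter_from_filter.
      by exists (q0, n%:R + 1); split => //=; rewrite ltrDl.
    move=> [q c] [r d] [/= Gq nc] [/= Gr nd].
    have [s Gs sP] := (saks_directed sysG').2 q r Gq Gr.
    exists (s, Num.min c d); first by split => //=; rewrite lt_min nc.
    move=> w [/= Nw Cw]; rewrite le_min => /andP[sc sd] nV; have [qs rs] := sP w.
    by split; split => //=; [exact: le_trans qs sc|exact: le_trans rs sd].
  have [G [UG G0G]] := ultraFilterLemma G00.
  have inG q (c : R) : Gamma' q -> n%:R < c -> G (S (q, c)).
    by move=> Gq nc; apply: G0G; exists (q, c).
  have n1 : n%:R < n%:R + 1 :> R by rewrite ltrDl.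
  have Gk : G [set w | N w <= n.+1%:R].
    by apply: filterS (inG q0 _ Gq0 n1) => w [].
  have [f _ fP] := cb _ G UG Gk.
  have Cf : C f.
    by apply: (Ccl G) => //; apply: filterS (inG q0 _ Gq0 n1) => w [].
  have Nf : N f <= n%:R.
    apply: (norm_le_saks sysG') => q Gq; apply/ler_addgt0Pr => e e0.
    apply: (lim_le G) => //; have ne : n%:R < n%:R + e by rewrite ltrDl.
    by apply: filterS (inG q _ Gq ne) => w [].
  have [p gp pV] := Vopen f (CV f Nf Cf).
  have Gp := mixed_seminorm_small normN _ Gk fP gp ltr01.
  have [w [/pV Vw [_ _ _]]] := filter_ex (filterI (Gp _) (inG q0 _ Gq0 n1)).
  by apply.
have good0 : good (0%N, setT).
  split => //= w; move=> /(norm_le0 normN) -> _.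
  by rewrite /V addr0.
have [|s [s0 sS]] := @dependent_choice _ (fun s t => good s -> good t /\ next s t) _ (0%N, setT).
  move=> s; apply: cid; have [/step[t gt nt]|ns] := pselect (good s); first by exists t.
  by exists s.
have gs n : good (s n) by elim: n => [|n /sS[]//]; rewrite s0.
have s1 n : (s n).1 = n.
  by elim: n => [|n IH]; [rewrite s0|have [_ [-> _]] := sS n (gs n); rewrite IH].
have /choice[qc qcP] : forall n, exists qc : (Y -> R) * R, [/\ Gamma' qc.1, n%:R < qc.2 &
    (s n.+1).2 = (s n).2 `&` [set w | qc.1 w <= qc.2]].
  move=> n; have [_ [_ [q [c [Gq nc e]]]]] := sS n (gs n).
  by exists (q, c); split => //=; rewrite -(s1 n).
(* The weights are a null sequence because the level chosen at stage [n] exceeds [n]. *)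
pose q n := (qc n).1; pose a n : R := (qc n).2^-1.
have c0 n : 0 < (qc n).2 by have [_ h _] := qcP n; apply: le_lt_trans h.
have Gq n : Gamma' (q n) by have [] := qcP n.
have a0 n : 0 <= a n by rewrite invr_ge0 ltW.
have acvg : a @ \oo --> 0.
  apply/cvgrPdist_lt => e e0; have [M _ MP] := @near_infty_natSinv_lt R (PosNum e0).
  exists M.+1 => // n /= Mn; rewrite sub0r normrN ger0_norm//.
  apply: le_lt_trans (MP M (leqnn M)).
  rewrite /a lef_pV2 ?posrE//; have [_ /ltW nc _] := qcP n.
  by rewrite (le_trans _ nc)// ler_nat.
exists (fun y => sup [set q n y * a n | n in [set: nat]]).
  by exists q, a.
exists 1 => // y /= py1.
have qa n : q n (y - x) <= (qc n).2.
  rewrite -[leRHS]mul1r -ler_pdivrMr//; apply: ltW; apply: le_lt_trans py1.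
  apply: wsup_ge => // m; first exact: (saks_seminorm sysG').
  by move=> z; exact: (saks_le_norm sysG' z (Gq m)).
have Cn n : (s n).2 (y - x).
  elim: n => [|n IH]; first by rewrite s0.
  by have [_ _ ->] := qcP n; split => //; exact: qa.
have : V (y - x).
  apply: (gs (Num.truncn (N (y - x))).+1).1 (Cn _).
  by rewrite s1 ltW// truncnS_gt.
by rewrite /V addrC subrK.
Qed.

End SubmixedTopology.

(** * Weighted spaces of holomorphic functions *)

Lemma entourage_rnormP {R : realType} (V : normedModType R[i]) (A : set (V * V)) :
  entourage A <-> exists2 e : R, 0 < e & forall x y, rnorm (x - y) < e -> A (x, y).
Proof.
rewrite -entourage_ballE; split=> [[e /= e0 eA]|[e e0 eA]].
  have eE : e = (complex.Re e)%:C%C by rewrite RRe_real// gtr0_real.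
  exists (complex.Re e) => [|x y xy]; first by rewrite -ltcR -eE.
  by apply: eA; rewrite /= -ball_normE /ball_ /= normE eE ltcR.
exists e%:C%C => /=; first by rewrite ltcR.
by move=> [x y]; rewrite /= -ball_normE /ball_ /= normE ltcR => /eA.
Qed.

Section WeightedSpaces.
Context {R : realType} {X : tvsType R[i]} {Omega : set X}.
Variables (v : Omega -> {posnum R}) (E : normedModType R[i]).
Hypothesis Omega0 : Omega !=set0.
Hypothesis cv : continuous (fun z : Omega => (v z)%:num : R).
Implicit Types (f g : Hv v E) (z : Omega) (S : set Omega) (SS : set (set Omega)).

Let N : Hv v E -> R := Hv_norm (v := v) (E := E).

Lemma Omega_pt : exists z : Omega, True.
Proof. by have [x Ox] := Omega0; exists (exist _ x (mem_set Ox)). Qed.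

Lemma Hv_valD f g z : val (f + g) z = val f z + val g z.
Proof. by []. Qed.

Lemma Hv_valB f g z : val (f - g) z = val f z - val g z.
Proof. by []. Qed.

Lemma Hv_valZ (a : R[i]) f z : val (a *: f) z = a *: val f z.
Proof. by []. Qed.

Lemma weighted_sup_ge S f z : S z -> rnorm (val f z) * (v z)%:num <= weighted_sup S f.
Proof.
move=> Sz; apply: ub_le_sup; last by exists z.
have [_ [M Mf]] := set_mem (valP f); exists M => _ [w _ <-].
by apply: Mf; exists w.
Qed.

(** The condition [0 <= c] accounts for an empty [S], where [sup] takes its default value 0. *)
Lemma weighted_sup_le S f (c : R) : 0 <= c ->
  (forall z, S z -> rnorm (val f z) * (v z)%:num <= c) -> weighted_sup S f <= c.
Proof.
move=> c0 h; have [[z Sz]|nS] := pselect (S !=set0).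
  apply: ge_sup => [|_ [w Sw <-]]; last exact: h.
  by exists (rnorm (val f z) * (v z)%:num); exists z.
rewrite /weighted_sup (_ : [set _ | z in S] = set0) ?sup0//.
by rewrite -subset0 => t [z Sz _]; case: nS; exists z.
Qed.

Lemma weighted_sup_ge0 S f : 0 <= weighted_sup S f.
Proof.
have [[z Sz]|nS] := pselect (S !=set0).
  by apply: le_trans (weighted_sup_ge f Sz); rewrite mulr_ge0// rnorm_ge0.
rewrite /weighted_sup (_ : [set _ | z in S] = set0) ?sup0//.
by rewrite -subset0 => t [z Sz _]; case: nS; exists z.
Qed.

Lemma weighted_sup_seminorm S : is_seminorm (weighted_sup S : Hv v E -> R).
Proof.
split=> [f g|a f].
  apply: weighted_sup_le => [|z Sz]; first by rewrite addr_ge0 ?weighted_sup_ge0.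
  rewrite Hv_valD; have := weighted_sup_ge f Sz; have := weighted_sup_ge g Sz.
  have : rnorm (val f z + val g z) * (v z)%:num <=
      (rnorm (val f z) + rnorm (val g z)) * (v z)%:num by rewrite ler_wpM2r// rnormD.
  by rewrite mulrDl; lra.
have half (b : R[i]) (h : Hv v E) : weighted_sup S (b *: h) <= cabs b * weighted_sup S h.
  apply: weighted_sup_le => [|z Sz]; first by rewrite mulr_ge0 ?cabs_ge0 ?weighted_sup_ge0.
  by rewrite Hv_valZ rnormZ -mulrA ler_wpM2l ?cabs_ge0// weighted_sup_ge.
rewrite -/(cabs a); apply/eqP; rewrite eq_le half /=.
have [->|a0] := eqVneq a 0; first by rewrite cabs0 mul0r weighted_sup_ge0.
have := half a^-1 (a *: f); rewrite scalerA mulVf// scale1r cabsV.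
by rewrite ler_pdivlMl// cabs_gt0.
Qed.

Lemma weighted_sup_mono S S' f : S `<=` S' -> weighted_sup S f <= weighted_sup S' f.
Proof.
move=> SS'; apply: weighted_sup_le => [|z Sz]; first exact: weighted_sup_ge0.
by apply: weighted_sup_ge; exact: SS'.
Qed.

Lemma Hv_is_norm : is_norm N.
Proof.
split=> [|f Nf0]; first exact: weighted_sup_seminorm.
apply/val_inj/funext => z; apply: rnorm_eq0; apply/eqP.
have h : rnorm (val f z) * (v z)%:num <= N f by exact: weighted_sup_ge.
rewrite Nf0 in h.
by rewrite eq_le rnorm_ge0 andbT -(@pmulr_lle0 _ (v z)%:num).
Qed.

Definition weighted_seminorms SS : set (Hv v E -> R) := [set weighted_sup S | S in SS].

(** Singletons already recover the norm, and unions give directedness; this treats finite and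
    compact sets alike. *)
Lemma weighted_saks_system (tau : Topological (Hv v E)) SS :
  (forall z, SS [set z]) -> (forall S S', SS S -> SS S' -> SS (S `|` S')) ->
  opens tau = opens (gen_by (weighted_seminorms SS)) ->
  saks_system N tau (weighted_seminorms SS).
Proof.
move=> SS1 SSU eT; have [z0 _] := Omega_pt; split.
- split; first by exists (weighted_sup [set z0]), [set z0].
  move=> _ _ [S SSS <-] [S' SSS' <-]; exists (weighted_sup (S `|` S')).
    by exists (S `|` S') => //; exact: SSU.
  by move=> f; split; apply: weighted_sup_mono => z ?; [left|right].
- move=> q Gq; have sq : is_seminorm q by case: Gq => S _ <-; exact: weighted_sup_seminorm.
  by split => //; exact: (seminorm_continuous Gq sq eT).
- by [].
- move=> f; apply/eqP; rewrite eq_le; apply/andP; split; last first.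
    by apply: ge_ereal_sup => _ [_ [S _ <-] <-]; rewrite lee_fin; exact: weighted_sup_mono.
  have ubq S : SS S -> ((weighted_sup S f)%:E <= ereal_sup
      [set (q f)%:E | q in weighted_seminorms SS])%E.
    by move=> SSS; apply: ereal_sup_ubound; exists (weighted_sup S) => //; exists S.
  case sE : (ereal_sup _) => [c| |].
  + rewrite lee_fin; apply: weighted_sup_le => [|z _].
      have := ubq _ (SS1 z0); rewrite sE lee_fin; apply: le_trans.
      exact: weighted_sup_ge0.
    have := ubq _ (SS1 z); rewrite sE lee_fin; apply: le_trans.
    exact: weighted_sup_ge.
  + by rewrite leey.
  + by have := ubq _ (SS1 z0); rewrite sE leeNy_eq.
Qed.

Lemma weight_bounds (K : set Omega) : compact K -> exists m M : R,
  [/\ 0 < m, 0 < M & forall z, K z -> m <= (v z)%:num <= M].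
Proof.
move=> cK; have [[z Kz]|nK] := pselect (K !=set0); last first.
  by exists 1, 1; split => // z Kz; case: nK; exists z.
have cvK := continuous_subspaceT cv : {within K, continuous _}.
have K0 : K !=set0 by exists z.
have [a /set_mem Ka amin] := compact_EVT_min K0 cK cvK.
have [b /set_mem Kb bmax] := compact_EVT_max K0 cK cvK.
exists (v a)%:num, (v b)%:num; split => // w Kw.
by rewrite amin ?inE// bmax ?inE.
Qed.

(** On a compact set the weight lies between two positive constants, so it changes the seminorms of
    compact convergence only by bounded factors. *)
Lemma tau_co_opens :
  opens (tau_co v E) = opens (gen_by (weighted_seminorms compact)).
Proof.
have sQ q : weighted_seminorms compact q -> is_seminorm q.
  by move=> [S _ <-]; exact: weighted_sup_seminorm.
have dQ : directed_system (weighted_seminorms compact).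
  split; first by exists (weighted_sup set0), set0 => //; exact: compact0.
  move=> _ _ [S cS <-] [S' cS' <-]; exists (weighted_sup (S `|` S')).
    by exists (S `|` S') => //; exact: compactU.
  by move=> f; split; apply: weighted_sup_mono => z ?; [left|right].
rewrite eqEsubset; split.
  move=> U /opensP oU; apply/opensP => f Uf.
  suff : nbhs (f : Topological.Pack (gen_by (weighted_seminorms compact))) -->
      (f : Topological.Pack (tau_co v E)) by apply; exact: oU.
  move=> A /= [B [[W oW <-] Wf WA]].
  have fcvg : (fun g : Hv v E => val g : {family compact, Omega -> E}) @
      nbhs (f : Topological.Pack (gen_by (weighted_seminorms compact)))
      --> (val f : {family compact, Omega -> E}).
    apply/fam_cvgP => K cK P /uniform_nbhs[A0 [/entourage_rnormP[d d0 dA0] A0P]].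
    have [m [M [m0 M0 mM]]] := weight_bounds cK.
    rewrite nbhs_simpl /=; apply/(nbhs_gen_by _ _ dQ sQ).
    exists (weighted_sup K); first by exists K.
    exists (d * m); first by rewrite mulr_gt0.
    move=> g /= gf; apply: A0P => z Kz; apply: dA0.
    rewrite rdistC -(@ltr_pM2r _ m)//; apply: le_lt_trans gf.
    apply: le_trans (weighted_sup_ge (g - f) Kz); rewrite Hv_valB.
    by rewrite ler_wpM2l ?rnorm_ge0//; case/andP: (mM z Kz).
  have : nbhs (val f : {family compact, Omega -> E}) W by exact: open_nbhs_nbhs.
  by move=> /fcvg WW; rewrite nbhs_filterE; exact: filterS WA WW.
apply: gen_by_min => _ f e [K cK <-] e0; apply/opensP => g /= gf.
have [m [M [m0 M0 mM]]] := weight_bounds cK.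
pose d : R := (e - weighted_sup K (g - f)) / (2 * M).
have d0 : 0 < d by rewrite divr_gt0 ?subr_gt0// mulr_gt0.
have nb : nbhs (val g : {family compact, Omega -> E})
    [set h : Omega -> E | forall z, K z -> rnorm (val g z - h z) < d].
  apply: (@fam_nbhs _ _ compact K [set xy : E * E | rnorm (xy.1 - xy.2) < d]) => //.
  by apply/entourage_rnormP; exists d.
have := @initial_continuous (Hv v E) {family compact, Omega -> E} val g _ nb.
rewrite nbhs_simpl /=; apply: filterS => h /= hd.
have -> : h - f = (h - g) + (g - f) by rewrite addrA subrK.
apply: le_lt_trans ((weighted_sup_seminorm K).1 _ _) _.
suff : weighted_sup K (h - g) <= d * M.
  have : d * M = (e - weighted_sup K (g - f)) / 2 by rewrite /d; field; rewrite gt_eqF.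
  by lra.
apply: weighted_sup_le => [|z Kz]; first by rewrite mulr_ge0// ltW.
rewrite Hv_valB ler_pM ?rnorm_ge0//; first by rewrite rdistC ltW// hd.
by case/andP: (mM z Kz).
Qed.

Lemma tau_co_saks : saks_system N (tau_co v E) (weighted_seminorms compact).
Proof.
apply: weighted_saks_system tau_co_opens; first exact: compact_set1.
by move=> S S'; exact: compactU.
Qed.

Lemma Hv_saks_space : saks_space N (tau_co v E).
Proof.
have sys := tau_co_saks; split.
- exact: Hv_is_norm.
- apply: gen_by_locally_convex_hausdorff tau_co_opens.
  + exact: (saks_directed sys).
  + by move=> q Gq; exact: (saks_seminorm sys).
  + move=> f f0; apply: Hv_is_norm.2; apply/eqP.
    rewrite eq_le seminorm_ge0 ?andbT; last exact: Hv_is_norm.1.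
    by apply: (norm_le_saks sys) => q /f0 ->.
- exact: (opens_tau_norm Hv_is_norm sys).
- by exists (weighted_seminorms compact).
Qed.

End WeightedSpaces.

(** * Weak holomorphy along complex lines *)

Section WeakHolomorphy.
Context {R : realType} {X : tvsType R[i]} {Omega : set X}.
Implicit Types (x y eta : X) (xi z : Omega).

Lemma extend0_val (V : zmodType) (f : Omega -> V) z : extend0 f (val z) = f z.
Proof. by rewrite /extend0 valK. Qed.

Lemma set_type_val x : Omega x -> exists z : Omega, val z = x.
Proof. by move=> Ox; exists (exist _ x (mem_set Ox)). Qed.

Lemma val_in_set z : Omega (val z).
Proof. exact: set_mem (valP z). Qed.

Lemma cdualB (E : normedModType R[i]) (e : cdual E) (a b : E) :
  val e (a - b) = val e a - val e b.
Proof.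
have := cdual_linear e (-1) b a; rewrite !scaleN1r (addrC (- b)) => ->.
by rewrite addrC.
Qed.

Lemma cdual_bounded (E : normedModType R[i]) (e : cdual E) :
  exists2 C : R, 0 < C & forall y : E, cabs (val e y) <= C * rnorm y.
Proof.
have e0 : val e 0 = 0.
  by have := cdual_linear e (-1) 0 0; rewrite !scaleN1r !addNr.
have eZ (a : R[i]) (y : E) : val e (a *: y) = a * val e y.
  by have := cdual_linear e a y 0; rewrite e0 !addr0.
have /cvg_rnormP /(_ 1 ltr01) /nbhs_rnormP[d d0 dP] := @cdual_continuous R E e 0.
exists (2 / d) => [|y]; first by rewrite divr_gt0.
have [->|y0] := eqVneq y 0; first by rewrite e0 cabs0 rnorm0 mulr0.
have yn0 : 0 < rnorm y.
  by rewrite lt_def rnorm_ge0 andbT; apply: contraNneq y0 => /rnorm_eq0 ->.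
pose t : R := d / (2 * rnorm y); have t0 : 0 < t by rewrite divr_gt0// mulr_gt0.
have ct : cabs t%:C%C = t by rewrite cabsR ger0_norm// ltW.
have := dP (t%:C%C *: y); rewrite /= !subr0 e0 subr0 rnormZ ct eZ.
rewrite -/(cabs _) cabsM ct.
have -> : t * rnorm y = d / 2 by rewrite /t; field; rewrite gt_eqF.
rewrite ltr_pdivrMr// ltr_pMr// ltr1n => /(_ isT); rewrite mulrC -ltr_pdivlMr//.
by move=> /ltW/le_trans; apply; rewrite le_eqVlt /t; apply/orP; left; apply/eqP;
  field; rewrite !gt_eqF.
Qed.

Lemma cdiff_shift (g : R[i] -> R[i]) (l : R[i]) : cdiff (fun m => g (l + m)) 0 <-> cdiff g l.
Proof.
by split=> -[d gd]; exists d => e /gd[dl dl0 dlP]; exists dl => // u /dlP;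
  rewrite add0r addr0.
Qed.

Lemma line_near (x eta : X) (l : R[i]) (A : set X) : nbhs (x + l *: eta) A ->
  exists2 r : R, 0 < r & forall m, cabs (m - l) < r -> A (x + m *: eta).
Proof.
move=> /(@add_continuous X (x, l *: eta))[[B C] /= [xB lC] BC].
have [[P Q] /= [lP eQ] PQ] := @scale_continuous _ X (l, eta) _ lC.
have [r r0 rP] := (nbhs_rnormP (l : R[i]^o) P).1 lP; exists r => // m ml.
apply: (BC (x, m *: eta)); split => /=; first exact: nbhs_singleton.
by apply: (PQ (m, eta)); split => /=; [exact: rP|exact: nbhs_singleton].
Qed.

(** The origin [x] of the line may lie outside [Omega]: every point of [Omega] on a complex line is
    tested, whatever the parametrisation. Continuity of [f] is not part of the notion. *)
Definition weakly_holomorphic (E : normedModType R[i]) (f : Omega -> E) :=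
  forall (e : cdual E) x eta (l : R[i]), Omega (x + l *: eta) ->
    cdiff (fun m => val e (extend0 f (x + m *: eta))) l.

Lemma holomorphic_weakly (E : normedModType R[i]) (f : Omega -> E) :
  holomorphic f -> weakly_holomorphic f.
Proof.
move=> [_ fh] e x eta l /set_type_val[z zx].
apply/cdiff_shift; have /nbhs_singleton/derivable_cdiff := fh z eta e.
congr cdiff; apply/funext => m; rewrite zx scalerDl addrA.
by [].
Qed.

Lemma weakly_holomorphicP (E : normedModType R[i]) (f : Omega -> E) : open Omega ->
  continuous f -> weakly_holomorphic f -> holomorphic f.
Proof.
move=> oO fc fh; split => // xi eta e.
have : nbhs (val xi + 0 *: eta) Omega.
  by rewrite scale0r addr0; apply: open_nbhs_nbhs; split => //; exact: val_in_set.
move=> /line_near[r r0 rP]; apply/nbhs_rnormP; exists r => // l lr.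
by apply/derivable_cdiff/fh; exact: rP.
Qed.

End WeakHolomorphy.

(** * Equicontinuity of bounded families and their pointwise limits *)

Section Equicontinuity.
Context {R : realType} {X : tvsType R[i]} {Omega : set X}.
Variables (v : Omega -> {posnum R}) (E : normedModType R[i]).
Hypothesis oOmega : open Omega.
Hypothesis cv : continuous (fun z : Omega => (v z)%:num : R).
Implicit Types (x y eta : X) (xi z : Omega).

Definition bounded_by (k : R) (f : Omega -> E) := forall z, rnorm (f z) * (v z)%:num <= k.

(** The neighbourhood is built from [v], [k] and [e] before any [f] is considered, which is the
    uniformity needed for limits. Continuity of [f] is a conclusion here, so the same statement
    serves functions known only to be weakly holomorphic. *)
Lemma equicontinuous_bounded (k : R) xi (e : R) : 0 < e ->
  \forall x \near (val xi : X), Omega x /\ forall f : Omega -> E,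
    weakly_holomorphic f -> bounded_by k f -> rnorm (extend0 f x - f xi) <= e.
Proof.
move=> e0; pose c : R := (v xi)%:num / 2.
have c0 : 0 < c by rewrite divr_gt0.
have xiO : nbhs (val xi : X) Omega by apply: open_nbhs_nbhs; split => //; exact: val_in_set.
have : nbhs xi [set z | c < (v z)%:num].
  have /cvgrPdist_lt /(_ c c0) := @cv xi; apply: filterS => z /=.
  by rewrite ltr_norml => /andP[_]; rewrite /c; lra.
move=> [B [[W oW <-] Wxi WB]].
have xiW : nbhs (val xi : X) W by exact: open_nbhs_nbhs.
have : nbhs (val xi + 0 : X) (W `&` Omega) by rewrite addr0; exact: filterI.
move=> /(@add_continuous X (val xi, 0))[[P Q] /= [xiP Q0] PQ].
have : nbhs (0 *: (0 : X)) Q by rewrite scale0r.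
move=> /(@scale_continuous _ X (0, 0))[[P' Q'] /= [P'0 Q'0] PQ'].
have [d d0 dP] := (nbhs_rnormP (0 : R[i]^o) P').1 P'0.
pose r : R := d / 2; have r0 : 0 < r by rewrite divr_gt0.
have inO u (l : R[i]) : Q' u -> cabs l <= r -> (W `&` Omega) (val xi + l *: u).
  move=> Q'u lr; apply: (PQ (val xi, l *: u)); split => /=; first exact: nbhs_singleton xiP.
  apply: (PQ' (l, u)); split => //=; apply: dP; rewrite subr0; apply: le_lt_trans lr _.
  by rewrite /r; lra.
pose M : R := `|k| / c; have M0 : 0 <= M by rewrite divr_ge0// ltW.
(* The Schwarz lemma at parameter [t] will give [2 * M / r * t], which this choice makes at most
   [e]; [M + 1] avoids division by 0. *)
pose t : R := Num.min r (e * r / (2 * (M + 1))).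
have M1 : 0 < M + 1 by rewrite ltr_wpDl.
have t0 : 0 < t by rewrite lt_min r0 divr_gt0// mulr_gt0.
have tr : t <= r by rewrite ge_min lexx.
have te : 2 * M / r * t <= e.
  apply: (@le_trans _ _ (2 * (M + 1) / r * (e * r / (2 * (M + 1))))); last first.
    by rewrite le_eqVlt; apply/orP; left; apply/eqP; field; rewrite !gt_eqF.
  apply: ler_pM; [|exact: ltW| |by rewrite ge_min lexx orbT].
    exact: divr_ge0 (mulr_ge0 (ler0n R 2) M0) (ltW r0).
  apply: ler_wpM2r; first by rewrite invr_ge0 ltW.
  by apply: ler_wpM2l => //; rewrite lerDl.
have ct : cabs t%:C%C = t by rewrite cabsR ger0_norm// ltW.
have : nbhs (t^-1%:C%C *: (0 : X)) Q' by rewrite scaler0.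
move=> /(@scale_continuous _ X (t^-1%:C%C, 0))[[T1 T2] /= [T1t T20] T12].
have : nbhs (val xi - val xi : X) T2 by rewrite subrr.
move=> /(@add_continuous X (val xi, - val xi))[[T3 T4] /= [T3x T4x] T34].
apply: filterS T3x => x T3x'.
(* Dividing by the fixed [t] puts [x] at parameter [t] on the line through [xi] with direction [u];
   closeness of [x] to [xi] puts [u] in [Q']. *)
have Q'u : Q' (t^-1%:C%C *: (x - val xi)).
  apply: (T12 (t^-1%:C%C, x - val xi)); split => /=; first exact: nbhs_singleton T1t.
  by apply: (T34 (x, - val xi)); split => //=; exact: nbhs_singleton T4x.
set u := _ *: _ in Q'u.
have xE : x = val xi + t%:C%C *: u.
  rewrite /u scalerA -rmorphM divff ?gt_eqF// scale1r addrC subrK.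
  by [].
split.
  by have [] := inO u t%:C%C Q'u; rewrite ?ct// -xE.
move=> f fh fk; apply: rnorm_le_dual => h h1.
pose g l := val h (extend0 f (val xi + l *: u)).
have gd l : cabs l <= r -> cdiff g l by move=> lr; apply: fh; have [] := inO u l Q'u lr.
have gM l : cabs l <= r -> cabs (g l) <= M.
  move=> lr; have [Wl /set_type_val[z zE]] := inO u l Q'u lr.
  rewrite /g -zE extend0_val (le_trans (h1 _))// /M ler_pdivlMr//.
  apply: le_trans (ler_norm k); apply: le_trans (fk z); rewrite ler_wpM2l ?rnorm_ge0//.
  by apply: ltW; apply: WB; rewrite /= -zE in Wl *.
have := schwarz r0 gd gM (z := t%:C%C); rewrite ct => /(_ tr).
have -> : g t%:C%C - g 0 = val h (extend0 f x - f xi).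
  by rewrite /g -xE scale0r addr0 extend0_val cdualB.
by move=> /le_trans; apply.
Qed.

Section Limit.
Variables (k : R) (G : set_system (Hv v E)) (l0 : Omega -> E).
Hypotheses (GG : ProperFilter G) (Gk : G [set g | Hv_norm g <= k]).
Hypothesis Gl0 : forall z (e : R), 0 < e -> G [set g | rnorm (val g z - l0 z) < e].

Lemma Hv_bounded_by (g : Hv v E) : Hv_norm g <= k -> bounded_by k (val g).
Proof. by move=> gk z; apply: le_trans gk; apply: weighted_sup_ge. Qed.

Lemma Hv_weakly_holomorphic (g : Hv v E) : weakly_holomorphic (val g).
Proof. by have [/holomorphic_weakly] := set_mem (valP g). Qed.

Lemma limit_bounded_by : bounded_by k l0.
Proof.
move=> z; apply/ler_addgt0Pr => e e0.
have ev : 0 < e / (v z)%:num by rewrite divr_gt0.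
have [g [/= gk gz]] := filter_ex (filterI Gk (Gl0 z ev)).
have := Hv_bounded_by gk z.
move: gz; rewrite ltr_pdivlMr// rdistC => gz.
have : rnorm (l0 z) * (v z)%:num <= (rnorm (l0 z - val g z) + rnorm (val g z)) * (v z)%:num.
  by rewrite ler_wpM2r// rnorm_subD.
by rewrite mulrDl; lra.
Qed.

Lemma limit_equicontinuous xi (e : R) : 0 < e -> \forall x \near (val xi : X),
  [/\ Omega x, forall g : Hv v E, Hv_norm g <= k -> rnorm (extend0 (val g) x - val g xi) <= e &
    rnorm (extend0 l0 x - l0 xi) <= e].
Proof.
move=> e0; apply: filterS (equicontinuous_bounded k xi e0) => x [Ox xP].
have gP (g : Hv v E) : Hv_norm g <= k -> rnorm (extend0 (val g) x - val g xi) <= e.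
  by move=> gk; apply: xP; [exact: Hv_weakly_holomorphic|exact: Hv_bounded_by].
split => //; have [z zx] := set_type_val Ox.
apply/ler_addgt0Pr => d d0; have d2 : 0 < d / 2 by rewrite divr_gt0.
have [g [[/= gk gz] gxi]] := filter_ex (filterI (filterI Gk (Gl0 z d2)) (Gl0 xi d2)).
have := gP g gk; rewrite -zx !extend0_val => gzxi.
have := rdistD (val g z) (l0 z) (l0 xi); rewrite (rdistC (l0 z) (val g z)).
have := rdistD (val g xi) (val g z) (l0 xi).
by move: gxi => /=; lra.
Qed.

(** Equicontinuity makes the approximation locally uniform, and compactness makes it uniform. The
    map [phi] allows two uses: the inclusion on compact subsets of [Omega], and a closed disc in a
    complex line. *)
Lemma limit_uniform (T : topologicalType) (D : set T) (phi : T -> X) (e : R) :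
  compact D -> continuous phi -> (forall t, D t -> Omega (phi t)) -> 0 < e ->
  G [set g | forall t, D t -> rnorm (extend0 (val g) (phi t) - extend0 l0 (phi t)) <= e].
Proof.
move=> /compact_near_coveringP cD cphi Dphi e0.
have e3 : 0 < e / 3 by rewrite divr_gt0.
apply: (cD (Hv v E) G (fun g t => rnorm (extend0 (val g) (phi t) - extend0 l0 (phi t)) <= e)).
move=> t Dt; have [xi xiE] := set_type_val (Dphi t Dt).
have Gx : G [set g | Hv_norm g <= k /\ rnorm (val g xi - l0 xi) < e / 3].
  by apply: filterI => //; exact: Gl0.
have := limit_equicontinuous xi e3; rewrite xiE => /cphi near_t.
exists ([set s | [/\ Omega (phi s), forall g : Hv v E, Hv_norm g <= k ->
  rnorm (extend0 (val g) (phi s) - val g xi) <= e / 3 &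
    rnorm (extend0 l0 (phi s) - l0 xi) <= e / 3]],
  [set g | Hv_norm g <= k /\ rnorm (val g xi - l0 xi) < e / 3]) => //.
move=> [s g] /= [[_ sP sl0] [gk gxi]].
have := sP g gk; have := rdistD (val g xi) (extend0 (val g) (phi s)) (extend0 l0 (phi s)).
have := rdistD (l0 xi) (val g xi) (extend0 l0 (phi s)).
rewrite (rdistC (l0 xi)).
by lra.
Qed.

Lemma limit_in_Hv : l0 \in @Hv_pred R X Omega v E.
Proof.
apply/mem_set; split; last by exists k => _ [z _ <-]; exact: limit_bounded_by.
apply: weakly_holomorphicP => //.
  move=> xi; apply/(@cvg_rnormP R E Omega (nbhs xi) l0 (l0 xi) (nbhs_filter xi)) => e e0.
  have e2 : 0 < e / 2 by rewrite divr_gt0.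
  have := limit_equicontinuous xi e2.
  move=> /(@initial_continuous Omega X set_val xi); rewrite nbhs_simpl /=.
  apply: filterS => z /= [_ _]; rewrite extend0_val => /le_lt_trans; apply.
  by lra.
move=> h x eta l Ol; pose x' := x + l *: eta.
have : nbhs (x' + 0 *: eta) Omega.
  by rewrite scale0r addr0; exact: open_nbhs_nbhs.
move=> /line_near[d d0 dP].
pose r : R := d / 2; have r0 : 0 < r by rewrite divr_gt0.
have inO (m : R[i]) : cabs m <= r -> Omega (x' + m *: eta).
  by move=> mr; apply: dP; rewrite subr0; apply: le_lt_trans mr _; rewrite /r; lra.
apply/cdiff_shift.
have -> : (fun m : R[i] => val h (extend0 l0 (x + (l + m) *: eta))) =
    (fun m => val h (extend0 l0 (x' + m *: eta))).
  by apply/funext => m; rewrite /x' scalerDl addrA.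
apply: (cdiff_uniform_limit r0) => e e0.
have [C C0 hC] := cdual_bounded h.
have cphi : continuous (fun m : R[i]^o => x' + (m : R[i]) *: eta).
  move=> m A /line_near[s s0 sP]; rewrite nbhs_simpl /=.
  by apply/nbhs_rnormP; exists s.
have [|g /= gP] := filter_ex (limit_uniform (cdisc_compact (r := r)) cphi inO (e := e / C) _).
  by rewrite divr_gt0.
exists (fun m => val h (extend0 (val g) (x' + m *: eta))) => m mr.
  by apply: Hv_weakly_holomorphic; exact: inO.
rewrite -cdualB (le_trans (hC _))// mulrC -ler_pdivlMr//.
exact: gP.
Qed.

Lemma limit_Hv : exists2 l : Hv v E, Hv_norm l <= k &
  forall (q : Hv v E -> R) (e : R), weighted_seminorms compact q -> 0 < e ->
    G [set g | q (g - l) < e].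
Proof.
exists (exist _ l0 limit_in_Hv).
  apply: weighted_sup_le => [|z _]; last exact: limit_bounded_by.
  have [g /= gk] := filter_ex Gk; exact: le_trans (weighted_sup_ge0 _ _) gk.
move=> _ e [K cK <-] e0.
have [m [M [m0 M0 mM]]] := weight_bounds cv cK.
have cval : continuous (fun z : Omega => val z : X) by exact: initial_continuous.
have d0 : 0 < e / (2 * M) by rewrite divr_gt0// mulr_gt0.
have := limit_uniform cK cval (fun z _ => val_in_set z) d0.
apply: filterS => g /= gP; apply: (@le_lt_trans _ _ (e / (2 * M) * M)); last first.
  have -> : e / (2 * M) * M = e / 2 by field; rewrite gt_eqF.
  by lra.
apply: weighted_sup_le => [|z Kz]; first by rewrite mulr_ge0// ltW.
rewrite ler_pM ?rnorm_ge0//; last by case/andP: (mM z Kz).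
by have := gP z Kz; rewrite !extend0_val.
Qed.

End Limit.

End Equicontinuity.

(** * Completeness, C-sequentiality and weak holomorphy for vector values *)

Section HolomorphicSaksSpace.
Context {R : realType} {X : tvsType R[i]} {Omega : set X}.
Variables (v : Omega -> {posnum R}) (E : normedModType R[i]).
Hypothesis Omega0 : Omega !=set0.
Hypothesis oOmega : open Omega.
Hypothesis cv : continuous (fun z : Omega => (v z)%:num : R).

Let N : Hv v E -> R := Hv_norm (v := v) (E := E).
Let normN : is_norm N. Proof. exact: Hv_is_norm. Qed.
Let sysG : saks_system N (tau_co v E) (weighted_seminorms compact).
Proof. exact: tau_co_saks. Qed.

Lemma compact_point (z : Omega) : weighted_seminorms compact
  (weighted_sup [set z] : Hv v E -> R).
Proof. by exists [set z] => //; exact: compact_set1. Qed.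

Lemma Hv_complete : banach_space E -> tvs_complete (mixed_topology N (tau_co v E)).
Proof.
move=> bE; apply: (mixed_complete normN sysG) => k G GG Gk GC.
have pt z : exists l : E, (fun g : Hv v E => val g z) @ G --> l.
  apply/cvg_ex; apply: bE => A /entourage_rnormP[e e0 eA].
  (* Singletons are compact, so the Cauchy condition holds at each point, up to the factor [v z]. *)
  have ev : 0 < e * (v z)%:num by rewrite mulr_gt0.
  have [B GB BP] := GC _ _ (compact_point z) ev.
  exists ([set val g z | g in B], [set val g z | g in B]).
    have GI : G [set g : Hv v E | [set val g z | g in B] (val g z)].
      by apply: filterS GB => g Bg; exists g.
    by split; exact: GI.
  move=> [_ _] /= [[f Bf <-] [g Bg <-]]; apply: eA.
  rewrite -(@ltr_pM2r _ (v z)%:num)//; apply: le_lt_trans (BP f g Bf Bg).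
  by rewrite -Hv_valB; exact: weighted_sup_ge.
have [l0 l0P] := choice pt.
have Gl0 z (e : R) : 0 < e -> G [set g | rnorm (val g z - l0 z) < e].
  by move=> e0; move/cvg_rnormP : (l0P z) => /(_ e e0).
by have [l _ lP] := limit_Hv oOmega cv GG Gk Gl0; exists l.
Qed.

Lemma Hv_C_sequential : hemicompact Omega -> C_sequential (mixed_topology N (tau_co v E)).
Proof.
move=> [K [cK Kcof]].
(* Finite unions make the exhaustion increasing, as the chain of seminorms in [mixed_C_sequential]
   must be. *)
pose L n : set Omega := \bigcup_(j in [set j | (j <= n)%N]) K j.
have cL n : compact (L n).
  elim: n => [|n IH].
    rewrite (_ : L 0%N = K 0%N)//; rewrite eqEsubset; split=> [z [j /=]|z Kz].
      by rewrite leqn0 => /eqP ->.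
    by exists 0%N.
  rewrite (_ : L n.+1 = L n `|` K n.+1); first exact: compactU.
  rewrite eqEsubset; split=> [z [j /=]|z [[j /= jn Kj]|Kz]].
  - by rewrite leq_eqVlt => /predU1P[->|jn] Kz; [right|left; exists j].
  - by exists j => //=; rewrite ltnW.
  - by exists n.+1 => /=.
apply: (mixed_C_sequential normN sysG (qs := fun n => weighted_sup (L n))).
- by move=> n; exists (L n).
- move=> n f; apply: weighted_sup_mono => z [j /= jn Kz].
  by exists j => //=; rewrite ltnW.
- move=> _ [S cS <-]; have [n Sn] := Kcof S cS; exists n => f.
  by apply: weighted_sup_mono => z /Sn Kz; exists n => /=.
Qed.

Lemma Hv_set_sigma : Hv_set v (E := E) = Hv_sigma v (E := E).
Proof.
rewrite eqEsubset; split=> f.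
  move=> [fh [M fM]] e.
  have [C C0 eC] := cdual_bounded e.
  have e0 : val e 0 = 0.
    by have := eC 0; rewrite rnorm0 mulr0 => h; apply/eqP; rewrite -cabs_eq0 eq_le h cabs_ge0.
  split; last first.
    exists (C * M) => _ [z _ <-]; apply: (@le_trans _ _ (C * (rnorm (f z) * (v z)%:num))).
      by rewrite mulrA; apply: ler_wpM2r => //; exact: eC.
    by rewrite ler_wpM2l ?(ltW C0)//; apply: fM; exists z.
  have extE x : extend0 (val e \o f) x = val e (extend0 f x).
    by rewrite /extend0; case: insubP => [u _ _|_] /=; rewrite ?e0.
  apply: weakly_holomorphicP => //.
    move=> z; apply: continuous_comp; first exact: fh.1.
    exact: cdual_continuous.
  move=> e' x eta l Ol.
  have ee' : (fun y => val e' (val e y) : R[i]^o) \in @cdual_pred R E.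
    apply/mem_set; split.
      by move=> a y w; rewrite (cdual_linear e) (cdual_linear e').
    by move=> y; apply: continuous_comp; [exact: cdual_continuous|exact: cdual_continuous].
  have := holomorphic_weakly fh (exist _ (fun y : E => val e' (val e y) : R[i]^o) ee' : cdual E) Ol.
  by congr cdiff; apply/funext => m /=; rewrite extE.
move=> fs.
(* Scalar functions are tested on the identity functional, which turns their holomorphy into plain
   complex differentiability along lines. *)
have idC : (fun c : R[i]^o => c) \in @cdual_pred R (R[i]^o : normedModType R[i]).
  by apply/mem_set; split => // c; exact: cvg_id.
have fw : weakly_holomorphic f.
  move=> e x eta l Ol; have [eh _] := fs e.
  have e0 : val e 0 = 0 by have := cdualB e 0 0; rewrite !subrr.
  have := holomorphic_weakly eh
    (exist _ (fun c : R[i]^o => c) idC : cdual (R[i]^o : normedModType R[i])) Ol.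
  congr cdiff; apply/funext => m /=.
  by rewrite /extend0; case: insubP => [u _ _|_] /=; rewrite ?e0.
(* Uniform boundedness is applied to the range of [v f]: each functional is bounded on it by the
   weighted bound for its composite with [f]. *)
have [k kP] : exists k : R, forall x, [set (v z)%:num%:C%C *: f z | z in [set: Omega]] x ->
    rnorm x <= k.
  apply: weakly_bounded_bounded => e; have [_ [M eM]] := fs e.
  exists M => _ [z _ <-].
  have -> : val e ((v z)%:num%:C%C *: f z) = (v z)%:num%:C%C * val e (f z).
    have := cdual_linear e (v z)%:num%:C%C (f z) 0.
    have -> : val e 0 = 0 by have := cdualB e 0 0; rewrite !subrr.
    by rewrite !addr0.
  by rewrite cabsM cabsR ger0_norm// mulrC; apply: eM; exists z.
have fk : bounded_by v k f.
  move=> z; have := kP ((v z)%:num%:C%C *: f z); rewrite rnormZ cabsR ger0_norm// mulrC.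
  by apply; exists z.
split; last by exists k => _ [z _ <-].
apply: weakly_holomorphicP => //.
move=> xi; apply/(@cvg_rnormP R E Omega (nbhs xi) f (f xi) (nbhs_filter xi)) => e e0.
have e2 : 0 < e / 2 by rewrite divr_gt0.
have := equicontinuous_bounded E oOmega cv k xi e2.
move=> /(@initial_continuous Omega X set_val xi); rewrite nbhs_simpl /=.
apply: filterS => z /= [_ /(_ f fw fk)]; rewrite extend0_val => /le_lt_trans; apply.
by lra.
Qed.

End HolomorphicSaksSpace.

Lemma ultra_fmap (T U : Type) (f : T -> U) (F : set_system T) :
  UltraFilter F -> UltraFilter (f @ F).
Proof.
move=> UF; split=> [|G GG FG]; first exact: fmap_proper_filter.
rewrite eqEsubset; split => // A GA.
have [//|FnA] := in_ultra_setVsetC (f @^-1` A) UF.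
have GnA : G (~` A) by exact: FG.
by have [x []] := filter_ex (filterI GA GnA).
Qed.

(** * Scalar functions: compact balls and the submixed topology *)

Section ScalarCase.
Context {R : realType} {X : tvsType R[i]} {Omega : set X}.
Variable v : Omega -> {posnum R}.
Hypothesis Omega0 : Omega !=set0.
Hypothesis oOmega : open Omega.
Hypothesis cv : continuous (fun z : Omega => (v z)%:num : R).

Let N : Hv v R[i]^o -> R := Hv_norm (v := v) (E := R[i]^o).

(** Evaluation at [z] maps the ball into a compact disc of radius [k / v z], so every ultrafilter on
    the ball converges pointwise, and [limit_Hv] upgrades this to compact convergence. *)
Lemma Hv_balls_compact : balls_compact N (weighted_seminorms compact).
Proof.
move=> k G UG Gk.
have pt z : exists l : R[i]^o, (fun g : Hv v R[i]^o => val g z) @ G --> l.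
  have := @cdisc_compact R (k / (v z)%:num); rewrite compact_ultra.
  move=> /(_ ((fun g : Hv v R[i]^o => val g z) @ G)) [].
  - exact: ultra_fmap.
  - have GI : G [set g : Hv v R[i]^o | cabs (val g z) <= k / (v z)%:num].
      apply: filterS Gk => g /= gk; rewrite ler_pdivlMr//.
      by apply: le_trans gk; exact: (weighted_sup_ge g (I : [set: Omega] z)).
    exact: GI.
  - by move=> l [_ lP]; exists l.
have [l0 l0P] := choice pt.
have Gl0 z (e : R) : 0 < e -> G [set g | rnorm (val g z - l0 z) < e].
  by move=> e0; move/cvg_rnormP : (l0P z) => /(_ e e0).
have GG : ProperFilter G by exact: ultra_proper.
by have [l Nl lP] := limit_Hv oOmega cv GG Gk Gl0; exists l.
Qed.

(** The system [Gamma] is arbitrary, but its members are continuous for [tau_S] and hence small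
    wherever some [weighted_sup S] with compact [S] is small. This is the comparison that
    [mixed_submixed] asks for. *)
Lemma Hv_submixed (SS : set (set Omega)) : SS `<=` compact ->
  (forall z, SS [set z]) -> (forall S S', SS S -> SS S' -> SS (S `|` S')) ->
  is_submixed N (tau_S v R[i]^o SS) (mixed N (tau_co v R[i]^o)).
Proof.
move=> SSc SS1 SSU; have normN : is_norm N by exact: Hv_is_norm.
have sysG : saks_system N (tau_co v R[i]^o) (weighted_seminorms compact).
  exact: tau_co_saks.
have sysS : saks_system N (tau_S v R[i]^o SS) (weighted_seminorms SS).
  exact: weighted_saks_system.
split=> [|Gamma sysGamma]; first by exists (weighted_seminorms SS).
apply: (mixed_submixed normN sysG sysGamma) Hv_balls_compact => q e Gq e0.
have : opens (tau_S v R[i]^o SS) [set y | q (y - 0) < e].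
  by rewrite (saks_opens sysGamma); exact: semiball_open.
have sq := saks_seminorm sysGamma Gq.
move=> /opensP /(_ 0); rewrite /= subrr seminorm0// => /(_ e0).
move=> /(eq_opens_nbhs _ _ (saks_opens sysS)).
move=> /(nbhs_gen_by _ _ (saks_directed sysS) (fun q => saks_seminorm sysS (q := q))).
move=> [_ [S SSS <-] [d d0 dP]]; exists (weighted_sup S); split.
  by exists S => //; exact: SSc.
by exists d => // y yd; have /= := dP y; rewrite !subr0; apply.
Qed.

End ScalarCase.

Theorem corollary4p6 (R : realType) (X : tvsType R[i]) (Omega : set X)
    (v : Omega -> {posnum R}) (E : normedModType R[i])
    (hX : hausdorff_space X) (oOmega : open Omega) (Omega0 : Omega !=set0)
    (cv : continuous (fun z : Omega => (v z)%:num : R)) :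
  [/\ (* a *)
      saks_space (Hv_norm (v := v) (E := E)) (tau_co v E),
      (* b *)
      kR_space X -> banach_space E ->
        saks_complete (Hv_norm (v := v) (E := E)) (tau_co v E),
      (* c *)
      hemicompact Omega ->
        saks_C_sequential (Hv_norm (v := v) (E := E)) (tau_co v E),
      (* d *)
      k_space X ->
        let N := Hv_norm (v := v) (E := R[i]^o) in
        [/\ saks_semi_montel N (tau_co v R[i]^o),
            is_submixed N (tau_S v R[i]^o [set K : set Omega | finite_set K])
              (mixed N (tau_co v R[i]^o)) &
            is_submixed N (tau_S v R[i]^o [set K : set Omega | compact K])
              (mixed N (tau_co v R[i]^o))] &
      (* e *)
      metrisable R X \/ DFM_space X -> banach_space E ->
        Hv_set v (E := E) = Hv_sigma v (E := E)].
Proof.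
split.
- exact: Hv_saks_space.
- by move=> _ bE; split; [exact: Hv_saks_space|exact: Hv_complete].
- by move=> hO; split; [exact: Hv_saks_space|exact: Hv_C_sequential].
- move=> _ N; split.
  + split; first exact: Hv_saks_space.
    apply: mixed_semi_montel (Hv_balls_compact oOmega cv); first exact: Hv_is_norm.
    exact: tau_co_saks.
  + apply: Hv_submixed => // [K|z|S S']; [exact: finite_compact|exact: finite_set1|].
    by rewrite /= finite_setU.
  + apply: Hv_submixed => // [z|S S']; [exact: compact_set1|exact: compactU].
- by move=> _ _; exact: Hv_set_sigma.
Qed.
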